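(* Let $\delta_0\in(-a,b)$ (i.e. $\delta_0$ is interior to the parameter set $[-a,b]$), and suppose the network is generated with true parameter $\delta_0$. Then the maximum likelihood estimator $\hat\delta_n$ satisfies, as $n\to\infty$, $$\sqrt{n}\,(\hat\delta_n-\delta_0)\rightsquigarrow N(0,\nu_0^{-1}),\qquad \nu_0=\sum_{k=1}^\infty\frac{\mu\, q_k^{(0)}}{(k+\delta_0)^2}-\frac{\mu}{(2\mu+\delta_0)^2},$$ where $\rightsquigarrow$ denotes convergence in distribution.
   Context: Initial degrees. $(m_t)_{t\ge1}$ is an i.i.d. sequence of positive-integer-valued random variables with $r_k=\mathbb{P}(m_1=k)$, mean $\mu=\mathbb{E}m_1\ge 1$ and finite second moment $\mu^{(2)}=\mathbb{E}m_1^2$. $M_t=\sum_{j=1}^t m_j$. Model (affine preferential attachment with random initial degrees, parameter $\delta>-1$). $\mathrm{PA}_1(\delta)$ has two vertices $v_0,v_1$ joined by $m_1$ edges. For $t\ge2$, given $\mathrm{PA}_{t-1}(\delta)=:\mathrm{PA}_{t,0}(\delta)$ with vertex set $V_{t-1}=\{v_0,\dots,v_{t-1}\}$, a new vertex $v_t$ is added, and sequentially for $i=1,\dots,m_t$ the network $\mathrm{PA}_{t,i}(\delta)$ is obtained from $\mathrm{PA}_{t,i-1}(\delta)$ by adding an edge between $v_t$ and a random vertex of $V_{t-1}$, where (conditionally on the past and on $(m_t)_{t\ge1}$) vertex $v_j\in V_{t-1}$ is chosen with probability $(\mathrm{Deg}_{t,i-1}(v_j)+\delta)/S_{t,i-1}(\delta)$.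 Here $\mathrm{Deg}_{t,i-1}(v)$ is the degree of $v$ in $\mathrm{PA}_{t,i-1}(\delta)$ and $S_{t,i-1}(\delta)=\sum_{v\in V_{t-1}}(\mathrm{Deg}_{t,i-1}(v)+\delta)=t\delta+2M_{t-1}+(i-1)$. Finally $\mathrm{PA}_t(\delta)=\mathrm{PA}_{t,m_t}(\delta)$. Statistics and MLE. $N_k(n)$ is the number of vertices of degree $k$ in the network at time $n$, $N_{>k}(n)=\sum_{j>k}N_j(n)$, and $R_{>k}(n)=2\cdot 1_{\{m_1>k\}}+\sum_{t=2}^n1_{\{m_t>k\}}$. For $\delta>-1$, the normalized log-likelihood (up to a term not depending on $\delta$) is $$\iota_n(\delta)=\sum_{k=1}^\infty\log(k+\delta)\frac{N_{>k}(n)-R_{>k}(n)}{n+1}-\frac1{n+1}\sum_{t=2}^n\sum_{i=1}^{m_t}\log S_{t,i-1}(\delta).$$ The parameter set is $[-a,b]$ with given numbers $-1<-a<b<\infty$, and the MLE is $\hat\delta_n=\arg\max_{\delta\in[-a,b]}\iota_n(\delta)$. Limits. For $\delta>-1$ let $\theta=2+\delta/\mu$ and let $(p_k(\delta))_{k\ge1}$ be defined by $p_0=0$ and $p_k=\frac{k-1+\delta}{\theta}p_{k-1}-\frac{k+\delta}{\theta}p_k+r_k$, $k\ge1$. Put $q_k(\delta)=\frac{(k+\delta)p_k(\delta)}{2\mu+\delta}$. The superscript $(0)$ means evaluation at the true value $\delta_0$: $q_k^{(0)}=q_k(\delta_0)$. *)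

(* Defs.v *)
From HB Require Import structures.
From mathcomp Require Import all_boot all_order all_algebra.
From mathcomp Require Import finmap.
From mathcomp Require Import all_classical all_reals all_analysis.

Set Implicit Arguments.
Unset Strict Implicit.
Unset Printing Implicit Defensive.

Import Order.TTheory GRing.Theory Num.Theory.
Import numFieldNormedType.Exports.

Local Open Scope classical_set_scope.
Local Open Scope ring_scope.

Section Probability.
Context (d : measure_display) (T : measurableType d) (R : realType).
Variable P : probability T R.

(* Mutual independence of the subfamily (X_i), i \in D. *)
Definition mutually_independent (I : choiceType) (D : set I)
    (d' : measure_display) (T' : measurableType d') (X : I -> {RV P >-> T'}) :=
  forall (s : {fset I}) (A : I -> set T'),
    (forall i, i \in s -> D i) -> (forall i, measurable (A i)) ->
    P (\bigcap_(i in [set` s]) (X i @^-1` A i)) =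
    (\prod_(i <- s) P (X i @^-1` A i))%E.

(* (X_t), t >= 1, is i.i.d.; the variable X_0 plays no role. *)
Definition iid (d' : measure_display) (T' : measurableType d')
    (X : nat -> {RV P >-> T'}) :=
  mutually_independent [set t | (1 <= t)%N] X /\
  forall t (A : set T'), (1 <= t)%N -> measurable A ->
    P (X t @^-1` A) = P (X 1%N @^-1` A).

(* Y is a version of the conditional probability P(A | F), where F is a
   sub-sigma-algebra of the events. *)
Definition is_cond_probability (F : set (set T)) (A : set T) (Y : T -> R) :=
  (forall B : set R, measurable B -> F (Y @^-1` B)) /\
  forall B, F B -> P (A `&` B) = (\int[P]_(w in B) (Y w)%:E)%E.

Definition cvg_in_distribution (X : nat -> T -> R)
    (Q : probability (measurableTypeR R) R) :=
  forall f : R -> R, continuous f -> (exists M : R, forall x, `|f x| <= M) ->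
    ('E_P[f \o X n] @[n --> \oo] --> \int[Q]_x (f x)%:E)%E.

End Probability.

(* A network is the sequence of its edges, in order of creation, with
   multiplicities; the vertex v_j is encoded by j, and the edge (t, j) is one
   sent by v_t to v_j. *)
Definition network := seq (nat * nat).

Definition deg (G : network) (v : nat) : nat :=
  \sum_(e <- G) ((e.1 == v) + (e.2 == v)).

(* Networks driven by initial degrees m t (t >= 1) and attachment choices
   c t i (t >= 2, 1 <= i <= m t), the vertex which the i-th edge of v_t is
   attached to. *)
Section Network.
Variables (m : nat -> nat) (c : nat -> nat -> nat).

Definition new_edges (t i : nat) : network :=
  [seq (t, c t l) | l <- iota 1 i].

(* The network has no meaning at time 0. *)
Fixpoint PA (t : nat) : network :=
  match t with
  | 0 => [::]
  | 1 => nseq (m 1) (1, 0)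
  | t'.+1 => PA t' ++ new_edges t (m t)
  end%N.

(* Intermediate networks, for t >= 2 and 0 <= i <= m t. *)
Definition PA_mid (t i : nat) : network := PA t.-1 ++ new_edges t i.

Definition deg_count (n k : nat) : nat :=
  \sum_(v < n.+1) (deg (PA n) v == k).

Definition R_gt (n k : nat) : nat :=
  (2 * (k < m 1) + \sum_(2 <= t < n.+1) (k < m t))%N.

Variable R : realType.

Definition N_gt (n k : nat) : R :=
  \sum_(j \in [set j | (k < j)%N]) ((deg_count n j)%:R : R).

Definition weight (t i v : nat) (delta : R) : R :=
  (deg (PA_mid t i) v)%:R + delta.

Definition total_weight (t i : nat) (delta : R) : R :=
  \sum_(v < t) weight t i v delta.

(* For each n, only finitely many terms of the infinite sum are nonzero. *)
Definition loglik (n : nat) (delta : R) : R :=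
  limn (fun K => \sum_(1 <= k < K)
          ln (k%:R + delta) * ((N_gt n k - (R_gt n k)%:R) / n.+1%:R))
  - n.+1%:R^-1 * \sum_(2 <= t < n.+1) \sum_(1 <= i < (m t).+1)
                   ln (total_weight t i.-1 delta).

End Network.

Section Model.
Context (d : measure_display) (T : measurableType d) (R : realType).
Variables (P : probability T R) (m : nat -> {RV P >-> nat})
  (c : nat -> nat -> {RV P >-> nat}).

Definition m_at (w : T) (t : nat) : nat := m t w.
Definition c_at (w : T) (t i : nat) : nat := c t i w.

(* The past of the i-th choice of v_t: the sigma-algebra generated by the
   whole sequence of initial degrees and by the network PA_(t, i-1), the latter
   recording all the earlier choices since its edges are ordered. *)
Definition past (t i : nat) : set (set T) :=
  <<s [set B | (exists s k, (1 <= s)%N /\ B = [set w | m s w = k]) \/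
               (exists G, B = [set w | PA_mid (m_at w) (c_at w) t i.-1 = G])] >>.

(* The variables c t i with t < 2, i = 0 or i > m t are irrelevant: they are
   not constrained. *)
Record is_PA (delta : R) : Prop := IsPA {
  PA_range : forall t i w, (2 <= t)%N -> (1 <= i <= m t w)%N -> (c t i w < t)%N;
  PA_choice : forall t i j, (2 <= t)%N -> (1 <= i)%N -> (j < t)%N ->
    is_cond_probability P (past t i)
      [set w | (i <= m t w)%N /\ c t i w = j]
      (fun w => if (i <= m t w)%N then
                  weight (m_at w) (c_at w) t i.-1 j delta /
                  total_weight (m_at w) (c_at w) t i.-1 delta
                else 0) }.

(* e n is a maximum likelihood estimator over [-a, b] at every time n >= 1,
   that is, a measurable selection of maximizers. *)
Definition is_MLE (a b : R) (e : nat -> {RV P >-> R}) :=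
  forall n w, (1 <= n)%N ->
    - a <= e n w <= b /\
    forall delta, - a <= delta <= b ->
      loglik (m_at w) (c_at w) n delta <= loglik (m_at w) (c_at w) n (e n w).

Definition init_prob (k : nat) : R := fine (P [set w | m 1%N w = k]).

Definition init_mean : R := fine ('E_P[(fun w => (m 1%N w)%:R)%R])%E.

End Model.

Section Limits.
Variables (R : realType) (mu : R) (r : nat -> R) (delta : R).

Definition theta : R := 2 + delta / mu.

(* Since mu >= 1 and delta > -1, this recursion has exactly one solution. *)
Definition limit_degrees (p : nat -> R) :=
  p 0%N = 0 /\
  forall k, (1 <= k)%N ->
    p k = (k%:R - 1 + delta) / theta * p k.-1
          - (k%:R + delta) / theta * p k + r k.

Definition q_of (p : nat -> R) (k : nat) : R :=
  (k%:R + delta) * p k / (2 * mu + delta).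

Definition nu (p : nat -> R) : R :=
  limn (fun K => \sum_(1 <= k < K) mu * q_of p k / (k%:R + delta) ^+ 2)
  - mu / (2 * mu + delta) ^+ 2.

End Limits.

(* Main.v *)
(** Idea. The log-likelihood at time n is a sum over the edges (t, i) of
    ln (D + delta) - ln S, where D is the degree of the chosen vertex and S the
    total weight. Its derivative at delta0 is a martingale U_n whose increments
    1 / (D + delta0) - t / S are bounded, and the derivative at delta is
    U_n - (delta - delta0) n Q_n(delta) for an explicit average Q_n(delta).
    - Law of large numbers: the degree counts satisfy the recursion defining p_k
      up to errors vanishing in probability, so that N_k(n) / n tends to p_k for
      every k, and hence Q_n(delta0) and the normalized quadratic variation of
      U_n tend to nu_0.
    - Q_n is bounded below by a positive constant uniformly on [-a, b], which
      gives consistency; then U_n = n (deltahat - delta0) Q_n(deltahat), and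
      sqrt n (deltahat - delta0) is U_n / (sqrt n nu_0) up to a negligible term.
    - Central limit theorem: exp (b^2 V / 2) cos (b U + phi), with V the quadratic
      variation of U, is a martingale up to third order terms; no truncation is
      needed besides restricting to the event that M_n <= K n.
    - Convergence of the averages of x |-> cos (u x + phi), together with
      tightness, implies convergence in distribution, because a continuous
      function is approximated on a compact interval by Bernstein polynomials
      in sin (x / L), which are combinations of such functions. *)

Require Import Defs.
From HB Require Import structures.
From mathcomp Require Import all_boot all_order all_algebra.
From mathcomp Require Import finmap.
From mathcomp Require Import all_classical all_reals all_analysis.
From mathcomp Require Import measurable_realfun.
From mathcomp Require Import zify ring lra.

Set Implicit Arguments.
Unset Strict Implicit.
Unset Printing Implicit Defensive.

Import Order.TTheory GRing.Theory Num.Theory.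
Import numFieldNormedType.Exports.

Local Open Scope classical_set_scope.
Local Open Scope ring_scope.

(** * Convergence in probability and tightness *)

(** The model provides versions of conditional probabilities, and no conditional expectation is ever
    formed: what has been observed lives in a countable type, so each conditioning step compares
    integrals over countably many fibers.

    No derivative of the likelihood is taken. The scores at two parameters differ by an exact
    multiple of the distance between them, and optimality of the estimator is tested by moving it
    towards [delta0] or towards an endpoint of the parameter set; this also covers an estimator
    lying on the boundary.

    The average Q_n is a difference, with one term for the chosen degree and one for the total
    weight, so its sign is not apparent. Its positivity is a matter of convexity: 1 / (D + delta)
    lies above its tangent at D = 2 mu, and strictly so on a positive fraction of the edges because
    some degree other than 2 mu has a positive limiting frequency.

    Cosines with an arbitrary phase replace complex characteristic functions; the phase makes the
    family contain the sines and, up to linear combinations, stable under products. *)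

Lemma cvg0_norm_le (R : realType) (I : Type) (F : set_system I) (FF : Filter F)
  (f g : I -> R) : (\forall x \near F, `|f x| <= g x) ->
  g @ F --> 0 -> f @ F --> 0.
Proof.
move=> fg /cvgr0Pnorm_le g0; apply/cvgr0Pnorm_le => e e0.
have {}g0 := g0 e e0; near=> x.
apply: le_trans (_ : `|f x| <= `|g x|) _; last by near: x.
by apply: le_trans (ler_norm _); near: x.
Unshelve. all: by end_near. Qed.

Section WithHighProbability.
Context d (T : measurableType d) (R : realType) (P : probability T R).

(* Convergence in probability is convergence along this filter; the exceptional
   sets are outer so that no measurability is asked of the random variables. *)
Definition whp : set_system (nat * T) := [set A | forall e : R, 0 < e ->
  \forall n \near \oo, exists B, [/\ measurable B, (P B <= e%:E)%E &
    forall w, ~ B w -> A (n, w)]].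

Global Instance whp_filter : ProperFilter whp.
Proof.
split.
  (* At level 1/2 the exceptional set cannot be the whole space. *)
  move=> /(_ 2^-1); rewrite invr_gt0 ltr0n => /(_ isT)[N _ /(_ N (leqnn N))].
  move=> [B [mB PB]] /= B0.
  have BT : B = setT by rewrite -subTset => w _; apply: contrapT; exact: B0.
  move: PB; rewrite BT probability_setT lee_fin => PB.
  by move: PB; lra.
split.
- move=> e e0; near=> n; exists set0; split => //.
  by rewrite measure0 lee_fin ltW.
- move=> A1 A2 H1 H2 e e0.
  have e20 : 0 < e / 2 by rewrite divr_gt0.
  have {}H1 := H1 _ e20; have {}H2 := H2 _ e20.
  near=> n.
  have [B1 [mB1 PB1 AB1]] : exists B, [/\ measurable B, (P B <= (e / 2)%:E)%E &
    forall w, ~ B w -> A1 (n, w)] by near: n.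
  have [B2 [mB2 PB2 AB2]] : exists B, [/\ measurable B, (P B <= (e / 2)%:E)%E &
    forall w, ~ B w -> A2 (n, w)] by near: n.
  exists (B1 `|` B2); split; first exact: measurableU.
    apply: le_trans (measureU2 _ _ _) _ => //.
    by rewrite [e]splitr EFinD leeD.
  move=> w /not_orP[nB1 nB2]; split; [exact: AB1|exact: AB2].
- move=> A1 A2 A12 H1 e e0; have {}H1 := H1 _ e0.
  near=> n.
  have [B1 [mB1 PB1 AB1]] : exists B, [/\ measurable B, (P B <= e%:E)%E &
    forall w, ~ B w -> A1 (n, w)] by near: n.
  exists B1; split => // w nB; exact/A12/AB1.
Unshelve. all: by end_near. Qed.

Lemma whp_near (A : set (nat * T)) :
  (\forall n \near \oo, forall w, A (n, w)) -> whp A.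
Proof.
move=> H e e0; near=> n; exists set0; split => //.
  by rewrite measure0 lee_fin ltW.
by move=> w _; move: w; near: n.
Unshelve. all: by end_near. Qed.

Lemma cvg_whp_cst (u : nat -> R) (l : R) : u @ \oo --> l ->
  (u nw.1 : R) @[nw --> whp] --> l.
Proof.
move=> ul; apply/cvgrPdist_le => e e0; apply: whp_near.
by move/cvgrPdist_le : ul => /(_ e e0) [N _ HN]; exists N => // n /HN.
Qed.

Lemma bounded_integrable (f : T -> R) C : measurable_fun setT f ->
  (forall w, `|f w| <= C) -> P.-integrable setT (EFin \o f).
Proof.
move=> mf fC; apply: (@le_integrable _ _ _ P setT measurableT _ (cst C%:E)).
- exact/measurable_EFinP.
- by move=> w _ /=; rewrite lee_fin (le_trans (fC w)) // ler_norm.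
- apply/integrableP; split; first exact: measurable_cst.
  by rewrite integral_cst //= probability_setT mule1 ltry.
Qed.

Lemma measurable_norm_ge (f : T -> R) e : measurable_fun setT f ->
  measurable [set w | e <= `|f w|].
Proof.
move=> mf.
have /(_ measurableT `[e, +oo[%classic (measurable_itv _)) :
  measurable_fun setT (fun w => `|f w|) by exact: measurableT_comp.
rewrite setTI; congr measurable; apply/seteqP.
by split => w /=; rewrite in_itv /= andbT.
Qed.

Lemma markov_le (f : T -> R) e C : measurable_fun setT f -> 0 < e ->
  (\int[P]_w `|f w|%:E <= C%:E)%E ->
  (P [set w | (e <= `|f w|)%R] <= (C / e)%:E)%E.
Proof.
move=> mf e0 fC.
have mE := measurable_norm_ge e mf.
rewrite -(@lee_pmul2l _ e%:E) ?lte_fin // -EFinM mulrCA divff ?gt_eqF // mulr1.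
apply: le_trans fC; rewrite -integral_cst //.
apply: le_trans (_ : (\int[P]_(w in [set w | (e <= `|f w|)%R]) `|f w|%:E <= _)%E).
  apply: ge0_le_integral => //=.
  - by move=> w _; rewrite lee_fin ltW.
  - apply: measurable_funTS; exact/measurable_EFinP/measurableT_comp.
apply: ge0_subset_integral => //.
by apply/measurable_EFinP/measurableT_comp.
Qed.

Lemma cvg_whp_markov (X : nat -> T -> R) (e : nat -> R) :
  (forall n, measurable_fun setT (X n)) ->
  (forall n, (\int[P]_w `|X n w|%:E <= (e n)%:E)%E) ->
  e @ \oo --> 0 -> X nw.1 nw.2 @[nw --> whp] --> 0.
Proof.
move=> mX Xe e0; apply/cvgr0Pnorm_lt => r r0 s s0.
have rs0 : 0 < r * s by rewrite mulr_gt0.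
near=> n.
exists [set w | (r <= `|X n w|)%R]; split.
- exact: measurable_norm_ge.
- apply: le_trans (markov_le (mX n) r0 (Xe n)) _.
  rewrite lee_fin ler_pdivrMr // mulrC; apply: le_trans (ler_norm _) _; apply: ltW.
  near: n; by move/cvgr0Pnorm_lt: e0; apply.
- by move=> w /= /negP; rewrite -ltNge.
Unshelve. all: by end_near. Qed.

(** Pointwise [|f| <= a + C * \1_B]. This turns closeness off an exceptional set into closeness of
    expectations. *)
Lemma norm_Rintegral_le_off (f : T -> R) B a b C : measurable_fun setT f ->
  (forall w, `|f w| <= C) -> measurable B -> (P B <= b%:E)%E -> 0 <= a ->
  (forall w, ~ B w -> `|f w| <= a) -> `|\int[P]_w f w| <= a + C * b.
Proof.
move=> mf fC mB PB a0 fa.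
(* A probability space has a point, and the bound at that point makes [C] nonnegative. *)
have [w0 C0] : exists w0 : T, 0 <= C.
  have : ~ [set: T] = set0.
    by move=> T0; have := @probability_setT _ _ _ P; rewrite T0 measure0 => /eqP;
      rewrite eqe eq_sym oner_eq0.
  by move/eqP/set0P => [w _]; exists w; exact: le_trans (normr_ge0 _) (fC w).
have iB : P.-integrable setT (EFin \o (\1_B : T -> R)).
  apply: (@bounded_integrable _ 1); first exact: measurable_indic.
  by move=> w; rewrite indicE ger0_norm ?ler0n // lern1 leq_b1.
have ia : P.-integrable setT (EFin \o cst a).
  by apply: (@bounded_integrable _ `|a|) => //; exact: measurable_cst.
have iCB : P.-integrable setT (EFin \o (fun w => C * (\1_B : T -> R) w)).
  apply: (@bounded_integrable _ C).
    by apply: measurable_funM; [exact: measurable_cst|exact: measurable_indic].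
  by move=> w; rewrite indicE; case: (_ \in _); rewrite ?mulr1 ?mulr0 ?normr0 ?ger0_norm.
have iaCB : P.-integrable setT (EFin \o (fun w => a + C * (\1_B : T -> R) w)).
  apply: (@bounded_integrable _ (a + C)).
    apply: measurable_funD => //; apply: measurable_funM => //.
  by move=> w; rewrite indicE; case: (_ \in _); rewrite ?mulr1 ?mulr0 ?addr0 ger0_norm
    ?addr_ge0 // lerDl.
have inf : P.-integrable setT (EFin \o (fun w => `|f w|)).
  apply: (@bounded_integrable _ C); first exact: measurableT_comp.
  by move=> w; rewrite normr_id.
apply: le_trans (le_normr_Rintegral _ (bounded_integrable mf fC)) _ => //.
apply: le_trans (_ : \int[P]_w (a + C * (\1_B : T -> R) w) <= _).
  apply: le_Rintegral => // w _; rewrite indicE.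
  have [wB|wB] := boolP (w \in B); first by rewrite mulr1 ler_wpDl.
  by rewrite mulr0 addr0 fa // => Bw; move: wB; rewrite notin_setE.
rewrite (RintegralD _ ia iCB) // (RintegralZl _ _ iB) // Rintegral_cst //.
rewrite [X in a * X](_ : _ = 1); last by rewrite -[RHS]/(fine 1%E) -(probability_setT P).
rewrite mulr1 lerD2l ler_wpM2l //.
rewrite /Rintegral integral_indic // setIT.
by rewrite -lee_fin fineK ?fin_num_measure.
Qed.

Lemma norm_Rintegral_le (f : T -> R) C : measurable_fun setT f ->
  (forall w, `|f w| <= C) -> 0 <= C -> `|\int[P]_w f w| <= C.
Proof.
move=> mf fC C0; rewrite -[leRHS]addr0 -[X in _ + X](mulr0 C).
apply: (@norm_Rintegral_le_off f set0) => //.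
by rewrite measure0.
Qed.

Lemma integrable_bigsum (I : eqType) (r : seq I) (F : I -> T -> R) :
  (forall i, i \in r -> P.-integrable setT (EFin \o F i)) ->
  P.-integrable setT (EFin \o (fun w => \sum_(i <- r) F i w)).
Proof.
elim: r => [|i r IH] iF.
  rewrite (_ : EFin \o _ = cst 0%E); first exact: integrable0.
  by apply/funext => w /=; rewrite big_nil.
rewrite (_ : EFin \o _ =
  (fun w => (F i w)%:E + (\sum_(i <- r) F i w)%R%:E)%E).
  apply: integrableD => //; first by apply: iF; rewrite mem_head.
  by apply: IH => k kr; apply: iF; rewrite in_cons kr orbT.
by apply/funext => w /=; rewrite big_cons.
Qed.

Lemma Rintegral_sum (I : eqType) (r : seq I) (F : I -> T -> R) :
  (forall i, i \in r -> P.-integrable setT (EFin \o F i)) ->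
  \int[P]_w (\sum_(i <- r) F i w) = \sum_(i <- r) \int[P]_w F i w.
Proof.
elim: r => [|i r IH] iF.
  rewrite big_nil; under eq_Rintegral do rewrite big_nil.
  by rewrite Rintegral_cst // mul0r.
have iFr k : k \in r -> P.-integrable setT (EFin \o F k).
  by move=> kr; apply: iF; rewrite in_cons kr orbT.
under eq_Rintegral do rewrite big_cons.
rewrite big_cons RintegralD // ?IH //; last exact: integrable_bigsum.
by apply: iF; rewrite mem_head.
Qed.

Lemma cvg_whp_bounded (X : nat -> T -> R) C :
  (forall n, measurable_fun setT (X n)) ->
  (forall n w, `|X n w| <= C) ->
  X nw.1 nw.2 @[nw --> whp] --> 0 ->
  (\int[P]_w `|X n w| : R) @[n --> \oo] --> (0 : R).
Proof.
move=> mX XC X0; apply/cvgr0Pnorm_le => e e0.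
have C1 : 0 < `|C| + 1 by rewrite ltr_wpDl.
have e2 : 0 < e / 2 by rewrite divr_gt0.
have eC : 0 < e / 2 / (`|C| + 1) by rewrite divr_gt0.
move/cvgr0Pnorm_le : X0 => /(_ _ e2) /(_ _ eC) X0.
near=> n.
have [B [mB PB XB]] : exists B, [/\ measurable B,
  (P B <= (e / 2 / (`|C| + 1))%:E)%E & forall w, ~ B w -> `|X n w| <= e / 2].
  by near: n.
have -> : e = e / 2 + (`|C| + 1) * (e / 2 / (`|C| + 1)).
  by field; rewrite gt_eqF.
apply: (norm_Rintegral_le_off (B := B)) => //.
- exact: measurableT_comp.
- by move=> w; rewrite normr_id (le_trans (XC n w)) // (le_trans (ler_norm C)) // lerDl.
- exact: ltW.
- by move=> w; rewrite normr_id; exact: XB.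
Unshelve. all: by end_near. Qed.

(** Asking for the bound at large [n] only makes the notion stable under comparisons that hold along
    [whp]. *)
Definition tight (X : nat -> T -> R) := forall e : R, 0 < e -> exists K,
  \forall n \near \oo, exists B, [/\ measurable B, (P B <= e%:E)%E &
    forall w, ~ B w -> `|X n w| <= K].

Lemma tight_whp (X Y : nat -> T -> R) : tight Y ->
  (\forall nw \near whp, `|X nw.1 nw.2| <= `|Y nw.1 nw.2|) -> tight X.
Proof.
move=> tY XY e e0; have e20 : 0 < e / 2 by rewrite divr_gt0.
have [K KY] := tY _ e20; exists K; have {}XY := XY _ e20.
near=> n.
have [B1 [mB1 PB1 AB1]] : exists B, [/\ measurable B, (P B <= (e / 2)%:E)%E &
    forall w, ~ B w -> `|Y n w| <= K] by near: n.
have [B2 [mB2 PB2 AB2]] : exists B, [/\ measurable B, (P B <= (e / 2)%:E)%E &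
    forall w, ~ B w -> `|X n w| <= `|Y n w|] by near: n.
exists (B1 `|` B2); split; first exact: measurableU.
  apply: le_trans (measureU2 _ _ _) _ => //.
  by rewrite [e]splitr EFinD leeD.
by move=> w /not_orP[nB1 nB2]; apply: le_trans (AB2 _ _) (AB1 _ _).
Unshelve. all: by end_near. Qed.

Lemma tight_L2 (X : nat -> T -> R) C : (forall n, measurable_fun setT (X n)) ->
  (forall n, (\int[P]_w (X n w ^+ 2)%:E <= C%:E)%E) -> tight X.
Proof.
(* Chebyshev's inequality bounds the tail by [C / K ^+ 2 <= e]; [C] has no known sign, hence
   [|C| + 1]. *)
move=> mX XC e e0; pose K := Num.sqrt ((`|C| + 1) / e).
have K20 : 0 < (`|C| + 1) / e by rewrite divr_gt0 // ltr_wpDl.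
exists K; near=> n.
have mX2 : measurable_fun setT (fun w => X n w ^+ 2) by exact: measurable_funX.
exists [set w | (K ^+ 2 <= `|X n w ^+ 2|)%R]; split.
- exact: measurable_norm_ge.
- have := @markov_le (fun w => X n w ^+ 2) (K ^+ 2) C mX2.
  rewrite sqr_sqrtr; last exact: ltW.
  move=> /(_ K20) H; apply: le_trans (H _) _.
    under eq_integral do rewrite ger0_norm ?sqr_ge0 //.
    exact: XC.
  rewrite lee_fin invf_div mulrA ler_pdivrMr ?ltr_wpDl // mulrC ler_pM2l //.
  by rewrite (le_trans (ler_norm C)) // lerDl.
- move=> w /= /negP; rewrite -ltNge normrX ltr_pXn2r ?nnegrE ?sqrtr_ge0 //.
  exact: ltW.
Unshelve. all: by end_near. Qed.

Lemma tight_mul_cvg0 (X Y : nat -> T -> R) : tight X ->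
  Y nw.1 nw.2 @[nw --> whp] --> 0 ->
  X nw.1 nw.2 * Y nw.1 nw.2 @[nw --> whp] --> 0.
Proof.
move=> tX Y0; apply/cvgr0Pnorm_le => r r0 e e0.
have e20 : 0 < e / 2 by rewrite divr_gt0.
have [K KX] := tX _ e20.
have rK : 0 < r / (`|K| + 1) by rewrite divr_gt0 // ltr_wpDl.
move/cvgr0Pnorm_le : Y0 => /(_ _ rK) /(_ _ e20) Y0.
near=> n.
have [B1 [mB1 PB1 AB1]] : exists B, [/\ measurable B, (P B <= (e / 2)%:E)%E &
    forall w, ~ B w -> `|X n w| <= K] by near: n.
have [B2 [mB2 PB2 AB2]] : exists B, [/\ measurable B, (P B <= (e / 2)%:E)%E &
    forall w, ~ B w -> `|Y n w| <= r / (`|K| + 1)] by near: n.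
exists (B1 `|` B2); split; first exact: measurableU.
  apply: le_trans (measureU2 _ _ _) _ => //.
  by rewrite [e]splitr EFinD leeD.
move=> w /not_orP[nB1 nB2] /=; rewrite normrM.
apply: (@le_trans _ _ ((`|K| + 1) * (r / (`|K| + 1)))).
  apply: ler_pM => //; last exact: AB2.
  by rewrite (le_trans (AB1 _ nB1)) // (le_trans (ler_norm K)) // lerDl.
by rewrite mulrCA divff ?mulr1 // gt_eqF // ltr_wpDl.
Unshelve. all: by end_near. Qed.

End WithHighProbability.

(** * Degrees along a path of the network *)

Section NetworkPaths.
Variables (m : nat -> nat) (c : nat -> nat -> nat).

Lemma deg_rcons G e v :
  deg (rcons G e) v = (deg G v + ((e.1 == v) + (e.2 == v)))%N.
Proof. by rewrite /deg -cats1 big_cat big_seq1. Qed.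

Lemma new_edgesS t i :
  new_edges c t i.+1 = rcons (new_edges c t i) (t, c t i.+1).
Proof.
by rewrite /new_edges -map_rcons -cats1 -[i.+1 in LHS]addn1 iotaD /= add1n.
Qed.

Lemma PA_midS t i :
  PA_mid m c t i.+1 = rcons (PA_mid m c t i) (t, c t i.+1).
Proof. by rewrite /PA_mid new_edgesS rcons_cat. Qed.

Lemma PA_mid0 t : PA_mid m c t 0 = PA m c t.-1.
Proof. by rewrite /PA_mid cats0. Qed.

Lemma PA_midE t : (2 <= t)%N -> PA m c t = PA_mid m c t (m t).
Proof. by case: t => [//|[//|t]] _. Qed.

Lemma PA1 : PA m c 1 = nseq (m 1) (1, 0)%N.
Proof. by []. Qed.

Arguments PA : simpl never.

Definition init_sum t := (\sum_(1 <= s < t.+1) m s)%N.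

Lemma init_sumS t : init_sum t.+1 = (init_sum t + m t.+1)%N.
Proof. by rewrite /init_sum big_nat_recr. Qed.

Lemma init_sum0 : init_sum 0 = 0%N.
Proof. by rewrite /init_sum big_nil. Qed.

Hypothesis m_gt0 : forall t, (1 <= t)%N -> (1 <= m t)%N.
Hypothesis c_lt : forall t i, (2 <= t)%N -> (1 <= i <= m t)%N -> (c t i < t)%N.

Lemma PA_mid_edges t i e : (2 <= t)%N -> (i <= m t)%N ->
  (forall e', e' \in PA m c t.-1 -> (e'.2 < e'.1 <= t.-1)%N) ->
  e \in PA_mid m c t i -> (e.2 < e.1 <= t)%N.
Proof.
move=> t2; elim: i => [|i IH] im Hp.
  by rewrite PA_mid0 => /Hp; lia.
rewrite PA_midS mem_rcons in_cons => /orP[/eqP ->|] /=; last by apply: IH => //; lia.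
by rewrite leqnn andbT c_lt //=.
Qed.

Lemma PA_edges t e : e \in PA m c t -> (e.2 < e.1 <= t)%N.
Proof.
elim: t e => [//|[_|t IH]] e; first by rewrite PA1 mem_nseq => /andP[_ /eqP ->].
by rewrite PA_midE //; apply: PA_mid_edges => // e'; exact: IH.
Qed.

Lemma deg_PA_eq0 t v : (t < v)%N -> deg (PA m c t) v = 0%N.
Proof.
move=> tv; rewrite /deg big_seq big1 // => e /PA_edges /andP[e21 e1t].
have e1v := leq_ltn_trans e1t tv.
by rewrite (ltn_eqF e1v) (ltn_eqF (ltn_trans e21 e1v)).
Qed.

Lemma deg_PA_mid_old t i v : (v < t)%N ->
  deg (PA_mid m c t i.+1) v = (deg (PA_mid m c t i) v + (c t i.+1 == v))%N.
Proof. by move=> vt; rewrite PA_midS deg_rcons /= gtn_eqF. Qed.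

Lemma deg_PA_mid_new t i : (2 <= t)%N -> (i <= m t)%N ->
  deg (PA_mid m c t i) t = i.
Proof.
move=> t2; elim: i => [|i IH] im; first by rewrite PA_mid0 deg_PA_eq0 //; lia.
rewrite PA_midS deg_rcons /= eqxx IH ?(ltnW im) //.
by rewrite ltn_eqF ?addn0 ?addn1 // c_lt.
Qed.

Lemma deg_PA_new t : (1 <= t)%N -> deg (PA m c t) t = m t.
Proof.
case: t => [//|[_|t _]]; last by rewrite PA_midE // deg_PA_mid_new.
by rewrite /deg PA1 big_nseq /= iter_addn_0 mul1n.
Qed.

Lemma deg_PA1_0 : deg (PA m c 1) 0 = m 1.
Proof. by rewrite /deg PA1 big_nseq /= iter_addn_0 mul1n. Qed.

Lemma deg_PA_mid_ge t i v : (deg (PA m c t.-1) v <= deg (PA_mid m c t i) v)%N.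
Proof.
elim: i => [|i]; first by rewrite PA_mid0.
by rewrite PA_midS deg_rcons; lia.
Qed.

Lemma deg_PA_gt0 t v : (1 <= t)%N -> (v <= t)%N -> (1 <= deg (PA m c t) v)%N.
Proof.
elim: t => [//|[_ _|t IH _]].
  case: v => [|[|//]] _; first by rewrite deg_PA1_0 m_gt0.
  by rewrite deg_PA_new // m_gt0.
rewrite leq_eqVlt => /orP[/eqP ->|vt]; first by rewrite deg_PA_new // m_gt0.
rewrite PA_midE //; apply: leq_trans (deg_PA_mid_ge _ _ _); exact: IH.
Qed.

Lemma deg_PA_mid_gt0 t i v : (2 <= t)%N -> (v < t)%N ->
  (1 <= deg (PA_mid m c t i) v)%N.
Proof.
move=> t2 vt; apply: leq_trans (deg_PA_mid_ge _ _ _).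
by apply: deg_PA_gt0; lia.
Qed.

Lemma sum_eq_ord t j : (j < t)%N -> (\sum_(v < t) (j == v) = 1)%N.
Proof.
move=> jt; rewrite (bigD1 (Ordinal jt)) //= eqxx big1 // => v.
by rewrite -val_eqE /= eq_sym => /negbTE ->.
Qed.

Lemma sum_deg_PA_mid t i : (2 <= t)%N -> (i <= m t)%N ->
  (\sum_(v < t) deg (PA_mid m c t i) v = 2 * init_sum t.-1 + i)%N.
Proof.
elim: t i => [//|t IHt] i t2; elim: i => [|i IH] im.
  rewrite PA_mid0 /= addn0; case: t t2 IHt {im} => [//|[_ _|t _ IHt]].
    rewrite big_ord_recr big_ord1 /= deg_PA1_0.
    by rewrite deg_PA_new // init_sumS init_sum0 mul2n -addnn.
  rewrite big_ord_recr /= deg_PA_new // PA_midE // IHt //= !init_sumS; lia.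
under eq_bigr => v _ do rewrite deg_PA_mid_old ?ltn_ord //.
by rewrite big_split /= IH ?(ltnW im) // sum_eq_ord ?c_lt // addn1 addnS.
Qed.

(** Among the old vertices only the chosen one changes degree, by one, so it newly exceeds [k]
    exactly when its degree was [k]. *)
Lemma count_gt_PA_midS t i k : (2 <= t)%N -> (i < m t)%N ->
  (\sum_(v < t) (k < deg (PA_mid m c t i.+1) v) =
   \sum_(v < t) (k < deg (PA_mid m c t i) v) +
   (deg (PA_mid m c t i) (c t i.+1) == k))%N.
Proof.
move=> t2 im.
have ct : (c t i.+1 < t)%N by rewrite c_lt.
transitivity (\sum_(v < t) ((k < deg (PA_mid m c t i) v) +
   (c t i.+1 == v) * (deg (PA_mid m c t i) (c t i.+1) == k)))%N.
  apply: eq_bigr => v _; rewrite deg_PA_mid_old ?ltn_ord //.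
  case: eqP => [->|_] /=; last by rewrite !addn0.
  by lia.
by rewrite big_split /= -big_distrl /= sum_eq_ord // mul1n.
Qed.

Definition chosen_deg t i := deg (PA_mid m c t i.-1) (c t i).

Definition chosen_count n k :=
  (\sum_(2 <= t < n.+1) \sum_(1 <= i < (m t).+1) (chosen_deg t i == k))%N.

Lemma count_gt_PA_mid t i k : (2 <= t)%N -> (i <= m t)%N ->
  (\sum_(v < t) (k < deg (PA_mid m c t i) v) =
   \sum_(v < t) (k < deg (PA m c t.-1) v) +
   \sum_(1 <= l < i.+1) (chosen_deg t l == k))%N.
Proof.
move=> t2; elim: i => [|i IH] im; first by rewrite PA_mid0 big_nil addn0.
by rewrite count_gt_PA_midS // IH ?(ltnW im) // [in RHS]big_nat_recr //= addnA.
Qed.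

(** The meaning of [N_gt - R_gt] in the likelihood: a vertex of degree above [k] either started
    there or crossed [k] once, when it was chosen while of degree [k]. The factor 2 in [R_gt]
    accounts for [v_0] and [v_1], which both start with degree [m 1]. *)
Lemma count_gt_PA n k : (1 <= n)%N ->
  (\sum_(v < n.+1) (k < deg (PA m c n) v) = R_gt m n k + chosen_count n k)%N.
Proof.
elim: n => [//|[_ _|n IH _]].
  rewrite big_ord_recr big_ord1 /= deg_PA1_0.
  rewrite deg_PA_new // /R_gt /chosen_count.
  by rewrite !big_nil !addn0 mul2n -addnn.
rewrite big_ord_recr /= deg_PA_new // PA_midE // count_gt_PA_mid //= IH //.
rewrite /R_gt /chosen_count [in RHS]big_nat_recr //=.
rewrite [X in (_ = _ + X)%N]big_nat_recr //=; lia.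
Qed.

Lemma chosen_deg_gt0 t i : (2 <= t)%N -> (1 <= i <= m t)%N ->
  (1 <= chosen_deg t i)%N.
Proof. by move=> t2 im; apply: deg_PA_mid_gt0 => //; exact: c_lt. Qed.

Lemma deg_le_size G v : (deg G v <= 2 * size G)%N.
Proof.
elim/last_ind: G => [|G e IH]; first by rewrite /deg big_nil.
rewrite deg_rcons size_rcons; lia.
Qed.

Lemma size_PA_mid t i : (2 <= t)%N -> (i <= m t)%N ->
  size (PA_mid m c t i) = (init_sum t.-1 + i)%N.
Proof.
rewrite /PA_mid size_cat size_map size_iota => t2 _; congr addn.
elim: t t2 => [//|[//|[|t] IH]] _.
  by rewrite PA1 size_nseq init_sumS init_sum0.
by rewrite PA_midE // /PA_mid size_cat size_map size_iota (IH isT) [RHS]init_sumS.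
Qed.

Lemma init_sum_le s t : (s <= t)%N -> (init_sum s <= init_sum t)%N.
Proof.
move=> /subnK <-; elim: (t - s)%N => [//|u IH]; rewrite addSn init_sumS; lia.
Qed.

Lemma chosen_deg_lt n t i : (2 <= t <= n)%N -> (1 <= i <= m t)%N ->
  (chosen_deg t i < (2 * init_sum n).+1)%N.
Proof.
move=> /andP[t2 tn] im; rewrite ltnS; apply: leq_trans (deg_le_size _ _) _.
rewrite size_PA_mid //; last lia.
have := init_sum_le tn; rewrite -(prednK (ltnW t2)) init_sumS /=.
by rewrite (prednK (ltnW t2)); lia.
Qed.

Section RealValued.
Variable R : realType.
Implicit Type delta : R.

Definition edge_sum n (F : nat -> nat -> R) : R :=
  \sum_(2 <= t < n.+1) \sum_(1 <= i < (m t).+1) F t i.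

Lemma eq_edge_sum n F G :
  (forall t i, (2 <= t <= n)%N -> (1 <= i <= m t)%N -> F t i = G t i) ->
  edge_sum n F = edge_sum n G.
Proof.
move=> FG; apply: eq_big_nat => t tn; apply: eq_big_nat => i im.
by apply: FG; lia.
Qed.

Lemma ler_edge_sum n F G :
  (forall t i, (2 <= t <= n)%N -> (1 <= i <= m t)%N -> F t i <= G t i) ->
  edge_sum n F <= edge_sum n G.
Proof.
move=> FG; apply: ler_sum_nat => t tn; apply: ler_sum_nat => i im.
by apply: FG; lia.
Qed.

Lemma edge_sumD n F G :
  edge_sum n (fun t i => F t i + G t i) = edge_sum n F + edge_sum n G.
Proof. by rewrite -big_split; apply: eq_bigr => t _; rewrite -big_split. Qed.

Lemma edge_sumZ n a F :
  edge_sum n (fun t i => a * F t i) = a * edge_sum n F.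
Proof. by rewrite /edge_sum big_distrr; apply: eq_bigr => t _; rewrite big_distrr. Qed.

Lemma edge_sumB n F G :
  edge_sum n (fun t i => F t i - G t i) = edge_sum n F - edge_sum n G.
Proof.
rewrite -mulN1r -edge_sumZ -edge_sumD.
by apply: eq_edge_sum => t i _ _; rewrite mulN1r.
Qed.

Lemma ler_norm_edge_sum n F :
  `|edge_sum n F| <= edge_sum n (fun t i => `|F t i|).
Proof.
apply: le_trans (ler_norm_sum _ _ _) _; apply: ler_sum => t _.
exact: ler_norm_sum.
Qed.

Lemma edge_sum_cst n a :
  edge_sum n (fun _ _ => a) = a * (\sum_(2 <= t < n.+1) m t)%:R.
Proof.
rewrite natr_sum big_distrr; apply: eq_bigr => t _.
by rewrite sumr_const_nat subn1 /= mulr_natr.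
Qed.

Lemma edge_sumS n F : (1 <= n)%N ->
  edge_sum n.+1 F = edge_sum n F + \sum_(1 <= i < (m n.+1).+1) F n.+1 i.
Proof. by move=> n1; rewrite /edge_sum big_nat_recr. Qed.

Lemma edge_sum1 F : edge_sum 1 F = 0.
Proof. by rewrite /edge_sum big_nil. Qed.

Lemma edge_sum_exchange n a b F :
  \sum_(a <= k < b) edge_sum n (F k) =
  edge_sum n (fun t i => \sum_(a <= k < b) F k t i).
Proof.
rewrite exchange_big; apply: eq_bigr => t _.
by rewrite exchange_big.
Qed.

Lemma chosen_countE n k :
  (chosen_count n k)%:R = edge_sum n (fun t i => (chosen_deg t i == k)%:R).
Proof. by rewrite natr_sum; apply: eq_bigr => t _; rewrite natr_sum. Qed.

Lemma sum_pick (f : nat -> R) K D : (1 <= D < K)%N ->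
  \sum_(1 <= k < K) f k * (D == k)%:R = f D.
Proof.
move=> /andP[D1 DK]; rewrite (big_cat_nat (n := D)) ?(ltnW DK) //=.
rewrite (big_ltn (m := D)) // eqxx mulr1 !big_nat !big1 ?add0r ?addr0 // => k kD.
  by rewrite (ltn_eqF (_ : (D < k)%N)) ?mulr0 //; lia.
by rewrite (gtn_eqF (_ : (k < D)%N)) ?mulr0 //; lia.
Qed.

(** A degree is at most twice the number of edges, so the infinite sum can be cut at [B]. *)
Lemma N_gtE n k :
  N_gt m c R n k = (\sum_(v < n.+1) (k < deg (PA m c n) v))%:R.
Proof.
pose B := (2 * size (PA m c n)).+1.
rewrite /N_gt -(@fsbig_widen _ _ _ _ [set` index_iota k.+1 B]); first last.
- move=> j /= [kj jB]; rewrite /deg_count big1 // => v _.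
  apply/eqP; rewrite eqb0; apply/eqP => dj; apply: jB.
  by rewrite mem_index_iota -dj /B ltnS deg_le_size dj kj.
- by move=> j /=; rewrite mem_index_iota => /andP[].
rewrite -fsbig_seq ?iota_uniq // -natr_sum; congr (_%:R).
rewrite /deg_count exchange_big /=; apply: eq_bigr => v _.
set D := deg _ v; have DB : (D < B)%N by rewrite ltnS deg_le_size.
case: (ltnP k D) => kD.
  rewrite (big_cat_nat (n := D)) //=; last exact: ltnW.
  rewrite (big_ltn (m := D)) // eqxx !big_nat !big1 // => j jD.
    by rewrite ltn_eqF //; lia.
  by rewrite gtn_eqF //; lia.
by rewrite big_nat big1 // => j jD; rewrite ltn_eqF //; lia.
Qed.

Lemma total_weightE t i delta : (2 <= t)%N -> (i <= m t)%N ->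
  total_weight m c t i delta = t%:R * delta + (2 * init_sum t.-1 + i)%:R.
Proof.
move=> t2 im; rewrite /total_weight /weight big_split /= -natr_sum.
rewrite sum_deg_PA_mid // addrC; congr (_ + _).
by rewrite (eq_bigr (fun=> delta)) // sumr_const card_ord mulr_natl.
Qed.

(** Grouping the edges by the degree of the chosen vertex recovers the sum over [k]. The partial
    sums are constant once [K] exceeds every possible degree, so the limit is that constant. *)
Lemma loglikE n delta : (1 <= n)%N ->
  loglik m c n delta = n.+1%:R^-1 * edge_sum n (fun t i =>
    ln ((chosen_deg t i)%:R + delta) - ln (total_weight m c t i.-1 delta)).
Proof.
move=> n1; rewrite /loglik edge_sumB mulrBr; congr (_ - _).
apply/cvg_lim => //; apply: cvg_near_cst.
exists (2 * init_sum n).+1 => // K /= nK.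
transitivity (n.+1%:R^-1 * \sum_(1 <= k < K)
   edge_sum n (fun t i => ln (k%:R + delta) * (chosen_deg t i == k)%:R)).
  rewrite big_distrr; apply: eq_bigr => k _.
  rewrite N_gtE count_gt_PA // natrD addrAC subrr add0r chosen_countE.
  by rewrite edge_sumZ /= mulrA mulrC.
congr (_ * _); rewrite edge_sum_exchange; apply: eq_edge_sum => t i tn im.
apply: (sum_pick (fun k => ln (k%:R + delta))).
rewrite chosen_deg_gt0 //=; last by case/andP: tn.
exact: leq_trans (chosen_deg_lt tn im) nK.
Qed.

End RealValued.

End NetworkPaths.

(** * Choices given the past *)

Section CountableStates.
Context d (T : measurableType d).

(** Measurability for the discrete sigma-algebra on [C]: any function of a countable state is then
    measurable, with no structure to be put on networks or lists. *)
Definition cmeasurable (C : Type) (s : T -> C) :=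
  forall A : set C, measurable (s @^-1` A).

Lemma cmeasurable_fibers (C : countType) (s : T -> C) :
  (forall x, measurable (s @^-1` [set x])) -> cmeasurable s.
Proof.
move=> ms A.
rewrite (_ : s @^-1` A = \bigcup_x (if x \in A then s @^-1` [set x] else set0)).
  by apply: countable_bigcupT_measurable => // x; case: ifP.
apply/seteqP; split => w /=.
  by move=> Aw; exists (s w) => //; rewrite mem_set.
by move=> [x _]; case: ifPn => // /set_mem xA /= ->.
Qed.

Lemma cmeasurable_comp (C C' : Type) (f : C -> C') (s : T -> C) :
  cmeasurable s -> cmeasurable (fun w => f (s w)).
Proof. by move=> ms A; exact: (ms (f @^-1` A)). Qed.

Lemma cmeasurable_cst (C : Type) (x : C) : cmeasurable (fun=> x).
Proof.
move=> A; rewrite /preimage; have [xA|xA] := pselect (A x).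
  by rewrite (_ : [set _ | _] = setT) //; apply/seteqP; split.
by rewrite (_ : [set _ | _] = set0) //; apply/seteqP; split.
Qed.

Lemma cmeasurable_pair (C C' : countType) (s : T -> C) (s' : T -> C') :
  cmeasurable s -> cmeasurable s' -> cmeasurable (fun w => (s w, s' w)).
Proof.
move=> ms ms'; apply: cmeasurable_fibers => -[x x'].
rewrite (_ : _ @^-1` _ = (s @^-1` [set x]) `&` (s' @^-1` [set x'])).
  exact: measurableI.
by apply/seteqP; split => w /= [] -> ->.
Qed.

Lemma cmeasurable_comp2 (C C' : countType) (C'' : Type) (f : C -> C' -> C'')
  (s : T -> C) (s' : T -> C') :
  cmeasurable s -> cmeasurable s' -> cmeasurable (fun w => f (s w) (s' w)).
Proof.
move=> ms ms'; have := cmeasurable_pair ms ms'.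
exact: (@cmeasurable_comp _ _ (fun x => f x.1 x.2)).
Qed.

Lemma cmeasurable_RV (R : realType) (P : probability T R) (X : {RV P >-> nat}) : cmeasurable X.
Proof. by move=> A; rewrite -[X in measurable X]setTI; exact: measurable_funP. Qed.

Lemma cmeasurable_index (C : Type) (s : nat -> T -> C) (N : T -> nat) :
  (forall i, cmeasurable (s i)) -> cmeasurable N ->
  cmeasurable (fun w => s (N w) w).
Proof.
move=> ms mN A.
rewrite (_ : _ @^-1` A = \bigcup_i ((N @^-1` [set i]) `&` (s i @^-1` A))).
  by apply: bigcupT_measurable => i; apply: measurableI; [exact: mN|exact: ms].
apply/seteqP; split => w /=; first by move=> Aw; exists (N w).
by move=> [i _ [/= <-]].
Qed.

Lemma cmeasurable_fun (R : realType) (C : Type) (s : T -> C) (g : C -> R) :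
  cmeasurable s -> measurable_fun setT (fun w => g (s w)).
Proof. by move=> ms _ A _; rewrite setTI; exact: (ms (g @^-1` A)). Qed.

(** The substitute for conditional expectation: the fibers of a countable state form a countable
    measurable partition. They are enumerated through [choice.pickle], so some members of the
    enumeration may be empty. *)
Lemma eq_integral_fibers (R : realType) (P : probability T R) (C : countType)
  (s : T -> C) (f g : T -> R) :
  cmeasurable s -> P.-integrable setT (EFin \o f) ->
  P.-integrable setT (EFin \o g) ->
  (forall x, \int[P]_(w in s @^-1` [set x]) (f w)%:E =
             \int[P]_(w in s @^-1` [set x]) (g w)%:E)%E ->
  \int[P]_w f w = \int[P]_w g w.
Proof.
move=> ms jf jg fg; pose F n := s @^-1` [set x : C | choice.pickle x = n].
have mF n : measurable (F n) by exact: ms.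
have tF : trivIset setT F.
  by move=> i j _ _ [w [/= <- <-]].
have FT : \bigcup_n F n = setT.
  by apply/seteqP; split => w // _; exists (choice.pickle (s w)).
rewrite /Rintegral -FT !integral_bigcup ?FT //.
congr fine; apply: eq_eseriesr => n _.
have [->|/set0P[w0 Fw0]] := eqVneq (F n) set0; first by rewrite !integral_set0.
rewrite (_ : F n = s @^-1` [set s w0]); first exact: fg.
apply/seteqP; split => w; rewrite /F /= => sw; last by rewrite sw.
by apply: (pcan_inj (@choice.pickleK C)); rewrite sw.
Qed.

End CountableStates.

(** * Averaging over one choice, and drift along a path *)

Section OneStep.
Context d (T : measurableType d) (R : realType) (P : probability T R).
Variables (m : nat -> {RV P >-> nat}) (c : nat -> nat -> {RV P >-> nat}).
Variable delta : R.
Hypothesis delta_gt : -1 < delta.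
Hypothesis m_pos : forall t w, (1 <= t)%N -> (1 <= m t w)%N.
Hypothesis model : is_PA m c delta.

Local Notation mw := (m_at m).
Local Notation cw := (c_at c).

Let mw_gt0 w : forall t, (1 <= t)%N -> (1 <= mw w t)%N.
Proof. by move=> t; exact: m_pos. Qed.

Let cw_lt w t i : (2 <= t)%N -> (1 <= i <= mw w t)%N -> (cw w t i < t)%N.
Proof. exact: (PA_range model). Qed.

Lemma cmeasurable_new_edges t i : cmeasurable (fun w => new_edges (cw w) t i).
Proof.
elim: i => [|i IH]; first exact: cmeasurable_cst.
rewrite (_ : (fun w => _) = (fun w => rcons (new_edges (cw w) t i) (t, cw w t i.+1))).
  apply: (cmeasurable_comp2 (fun (G : seq (nat * nat)) j => rcons G (t, j))) => //.
  exact: (cmeasurable_RV (c t i.+1)).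
by apply/funext => w; rewrite new_edgesS.
Qed.

Lemma cmeasurable_PA t : cmeasurable (fun w => PA (mw w) (cw w) t).
Proof.
elim: t => [|[_|t IH]]; first exact: cmeasurable_cst.
  apply: (cmeasurable_comp (fun k => nseq k (1, 0)%N)).
  exact: (cmeasurable_RV (m 1)).
apply: (cmeasurable_comp2 (fun G H : seq (nat * nat) => G ++ H)) => //.
apply: (@cmeasurable_index _ _ _ (fun i w => new_edges (cw w) t.+2 i)).
  by move=> i; exact: cmeasurable_new_edges.
exact: (cmeasurable_RV (m t.+2)).
Qed.

Lemma cmeasurable_PA_mid t i : cmeasurable (fun w => PA_mid (mw w) (cw w) t i).
Proof.
apply: (cmeasurable_comp2 (fun G H : seq (nat * nat) => G ++ H)).
  exact: cmeasurable_PA.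
exact: cmeasurable_new_edges.
Qed.

Definition init_list n w := [seq mw w t | t <- iota 1 n].

Lemma init_listS n w : init_list n.+1 w = rcons (init_list n w) (m n.+1 w).
Proof. by rewrite /init_list -map_rcons -cats1 -[n.+1 in LHS]addn1 iotaD /= add1n. Qed.

Lemma init_list_sum n w : sumn (init_list n w) = init_sum (mw w) n.
Proof. by rewrite sumnE big_map /init_sum /index_iota subn1. Qed.

Lemma cmeasurable_init_list n : cmeasurable (init_list n).
Proof.
elim: n => [|n IH]; first exact: cmeasurable_cst.
rewrite (_ : init_list n.+1 = (fun w => rcons (init_list n w) (m n.+1 w))).
  apply: (cmeasurable_comp2 (fun s k => rcons s k)) => //.
  exact: cmeasurable_RV.
by apply/funext => w; exact: init_listS.
Qed.

(** The first [n] initial degrees, possibly beyond time [t], are recorded so that the event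
    [few_edges n] is a function of the state. *)
Definition state n t i w : seq nat * seq (nat * nat) :=
  (init_list n w, PA_mid (mw w) (cw w) t i).

Lemma cmeasurable_state n t i : cmeasurable (state n t i).
Proof.
apply: cmeasurable_pair; first exact: cmeasurable_init_list.
exact: cmeasurable_PA_mid.
Qed.

(** A fiber of the state is a finite intersection of generators of [past], which contains the events
    on all initial degrees, later ones included. *)
Lemma state_past n t i x : past m c t i (state n t i.-1 @^-1` [set x]).
Proof.
rewrite /past; set G := [set B | _].
have gen A : G A -> @measurable _ (g_sigma_algebraType G) A.
  by move=> GA; exact: sub_sigma_algebra.
case: x => l N.
have -> : state n t i.-1 @^-1` [set (l, N)] =
    (init_list n @^-1` [set l]) `&` [set w | PA_mid (mw w) (cw w) t i.-1 = N].
  by apply/seteqP; split => w /=; rewrite /state; [move=> [-> ->]|move=> [-> ->]].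
apply: (@measurableI _ (g_sigma_algebraType G)); last first.
  by apply: gen; right; exists N.
elim: n l => [|n IH] l.
  have [->|l0] := eqVneq l [::].
    rewrite (_ : _ @^-1` _ = setT); first exact: (@measurableT _ (g_sigma_algebraType G)).
    by apply/seteqP; split.
  rewrite (_ : _ @^-1` _ = set0); first exact: (@measurable0 _ (g_sigma_algebraType G)).
  by apply/seteqP; split => w //= l0'; rewrite -l0' in l0.
case/lastP: l => [|l k].
  rewrite (_ : _ @^-1` _ = set0); first exact: (@measurable0 _ (g_sigma_algebraType G)).
  by apply/seteqP; split => w //=.
have -> : init_list n.+1 @^-1` [set rcons l k] =
    (init_list n @^-1` [set l]) `&` [set w | m n.+1 w = k].
  apply/seteqP; split => w /=; rewrite init_listS; first by move/rcons_inj => [].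
  by move=> [-> ->].
apply: (@measurableI _ (g_sigma_algebraType G)); first exact: IH.
by apply: gen; left; exists n.+1, k.
Qed.

Definition wt (G : seq (nat * nat)) v : R := (deg G v)%:R + delta.
Definition tot (G : seq (nat * nat)) t : R := \sum_(v < t) wt G v.

Lemma wt_gt0 w t i v : (2 <= t)%N -> (v < t)%N ->
  1 + delta <= wt (PA_mid (mw w) (cw w) t i) v.
Proof.
move=> t2 vt; rewrite lerD2r ler1n.
exact: (deg_PA_mid_gt0 (mw_gt0 w) (@cw_lt w)).
Qed.

Lemma tot_ge w t i : (2 <= t)%N ->
  t%:R * (1 + delta) <= tot (PA_mid (mw w) (cw w) t i) t.
Proof.
move=> t2; rewrite /tot -[X in X%:R * _]card_ord mulr_natl -sumr_const.
by apply: ler_sum => v _; exact: wt_gt0.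
Qed.

Lemma tot_gt0 w t i : (2 <= t)%N -> 0 < tot (PA_mid (mw w) (cw w) t i) t.
Proof.
move=> t2; apply: lt_le_trans (tot_ge w i t2).
by rewrite mulr_gt0 ?ltr0n; [|lia|rewrite -ltrBlDl sub0r].
Qed.

Lemma choice_prob_bounds w t i (j : nat) : (2 <= t)%N -> (j < t)%N ->
  0 <= wt (PA_mid (mw w) (cw w) t i) j / tot (PA_mid (mw w) (cw w) t i) t <= 1.
Proof.
move=> t2 jt; have tp := tot_gt0 w i t2.
have wp (v : 'I_t) : 0 <= wt (PA_mid (mw w) (cw w) t i) v.
  by apply: le_trans (wt_gt0 w i t2 (ltn_ord v)); rewrite -lerBlDl sub0r ltW.
rewrite divr_ge0 ?(ltW tp) ?(wp (Ordinal jt)) //= ler_pdivrMr // mul1r.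
by rewrite /tot (bigD1 (Ordinal jt)) //= lerDl sumr_ge0.
Qed.

(** On a fiber of the state [phi] is constant, and the fiber belongs to the past, so the defining
    property of the conditional probability applies to it directly. *)
Lemma choice_average n t i j (phi : seq nat * seq (nat * nat) -> R) C :
  (2 <= t)%N -> (1 <= i)%N -> (j < t)%N -> 0 <= C ->
  (forall w, (i <= m t w)%N -> `|phi (state n t i.-1 w)| <= C) ->
  \int[P]_w (((i <= m t w)%N && (c t i w == j))%:R * phi (state n t i.-1 w)) =
  \int[P]_w ((i <= m t w)%N%:R *
    (wt (PA_mid (mw w) (cw w) t i.-1) j / tot (PA_mid (mw w) (cw w) t i.-1) t *
     phi (state n t i.-1 w))).
Proof.
move=> t2 i1 jt C0 phiC; set G := fun w => PA_mid (mw w) (cw w) t i.-1.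
have [mY condY] := PA_choice model t2 i1 jt.
set Y : T -> R := fun w => _ in mY condY; set A : set T := [set w | _] in condY.
have mA : measurable A.
  rewrite (_ : A = (fun w => (m t w, c t i w)) @^-1` [set x | (i <= x.1)%N /\ x.2 = j]) //.
  by apply: cmeasurable_pair; exact: cmeasurable_RV.
have mphi : measurable_fun setT (fun w => phi (state n t i.-1 w)).
  exact: cmeasurable_fun (cmeasurable_state n t i.-1).
have mleq : measurable_fun setT (fun w => (i <= m t w)%N%:R : R).
  exact: (cmeasurable_fun (fun k : nat => (i <= k)%N%:R : R) (cmeasurable_RV (m t))).
have mind : measurable_fun setT (fun w => ((i <= m t w)%N && (c t i w == j))%:R : R).
  apply: (@cmeasurable_fun _ _ R _ (fun w => (m t w, c t i w))
    (fun x : nat * nat => ((i <= x.1)%N && (x.2 == j))%:R : R)).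
  by apply: cmeasurable_pair; exact: cmeasurable_RV.
have mq : measurable_fun setT (fun w => wt (G w) j / tot (G w) t).
  exact: (cmeasurable_fun (fun N => wt N j / tot N t) (cmeasurable_PA_mid t i.-1)).
have q01 w := choice_prob_bounds w i.-1 t2 jt.
have YE w : Y w = (i <= m t w)%N%:R * (wt (G w) j / tot (G w) t).
  by rewrite /Y; case: ifP => _; rewrite ?mul1r ?mul0r.
apply: (eq_integral_fibers (s := state n t i.-1)).
- exact: cmeasurable_state.
- apply: (@bounded_integrable _ _ _ _ _ C); first exact: measurable_funM.
  move=> w; have := phiC w; case: leqP => im => [/(_ isT) pC|_].
    by case: (_ == _); rewrite /= ?mul1r // mul0r normr0.
  by rewrite mul0r normr0.
- apply: (@bounded_integrable _ _ _ _ _ C).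
    by apply: measurable_funM => //; exact: measurable_funM.
  move=> w; have := phiC w; case: leqP => im => [/(_ isT) pC|_].
    rewrite mul1r normrM; have /andP[q0 q1] := q01 w.
    by rewrite (ger0_norm q0) (le_trans _ pC) // ler_piMl.
  by rewrite mul0r normr0.
- move=> x; set B := state n t i.-1 @^-1` [set x].
  have mB : measurable B by exact: cmeasurable_state.
  transitivity (\int[P]_(w in B) ((\1_A w)%:E * (phi x)%:E))%E.
    apply: eq_integral => w /set_mem <-; rewrite -EFinM; congr EFin; congr (_ * _).
    rewrite indicE; congr (_%:R); apply: congr1.
    apply/idP/idP => [/andP[im /eqP cj]|]; first by rewrite mem_set.
    by move=> /set_mem [-> /eqP ->].
  transitivity (\int[P]_(w in B) ((Y w)%:E * (phi x)%:E))%E; last first.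
    by apply: eq_integral => w /set_mem <-; rewrite -EFinM YE -!mulrA.
  have iY : P.-integrable B (EFin \o Y).
    apply: (integrableS measurableT) => //.
    apply: (@bounded_integrable _ _ _ _ _ 1).
      rewrite (_ : Y = (fun w => (i <= m t w)%N%:R * (wt (G w) j / tot (G w) t))).
        exact: measurable_funM.
      by apply/funext.
    move=> w; rewrite YE; have /andP[q0 q1] := q01 w.
    by rewrite ger0_norm; case: (_ <= _)%N; rewrite ?mul1r ?mul0r.
  have iA : P.-integrable B (EFin \o (\1_A : T -> R)).
    apply: (integrableS measurableT) => //.
    apply: (@bounded_integrable _ _ _ _ _ 1); first exact: measurable_indic.
    by move=> w; rewrite indicE ger0_norm ?ler0n // lern1 leq_b1.
  rewrite !integralZr //; congr (_ * _)%E.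
  transitivity (P (A `&` B)); first by rewrite integral_indic.
  exact: (condY B (@state_past n t i x)).
Qed.

(** Summing [choice_average] over the possible values [j] replaces the random choice by its
    conditional average. *)
Lemma one_step n t i (phi : seq nat * seq (nat * nat) -> nat -> R) C :
  (2 <= t)%N -> (1 <= i)%N -> 0 <= C ->
  (forall w j, (i <= m t w)%N -> (j < t)%N -> `|phi (state n t i.-1 w) j| <= C) ->
  \int[P]_w ((i <= m t w)%N%:R * phi (state n t i.-1 w) (c t i w)) =
  \int[P]_w ((i <= m t w)%N%:R *
    \sum_(j < t) wt (PA_mid (mw w) (cw w) t i.-1) j /
                 tot (PA_mid (mw w) (cw w) t i.-1) t * phi (state n t i.-1 w) j).
Proof.
move=> t2 i1 C0 phiC.
have mphi j : measurable_fun setT (fun w => phi (state n t i.-1 w) j).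
  exact: (cmeasurable_fun (fun x => phi x j) (cmeasurable_state n t i.-1)).
have mleq : measurable_fun setT (fun w => (i <= m t w)%N%:R : R).
  exact: (cmeasurable_fun (fun k : nat => (i <= k)%N%:R : R) (cmeasurable_RV (m t))).
transitivity (\int[P]_w (\sum_(j < t)
   (((i <= m t w)%N && (c t i w == j))%:R * phi (state n t i.-1 w) j))).
  apply: eq_Rintegral => w _; case: leqP => im; last first.
    by rewrite mul0r big1 // => j _; rewrite mul0r.
  have ct : (c t i w < t)%N by apply: (PA_range model) => //; rewrite i1.
  rewrite (bigD1 (Ordinal ct)) //= eqxx big1 ?addr0 // => j.
  by rewrite -val_eqE /= eq_sym => /negbTE ->; rewrite mul0r.
transitivity (\int[P]_w (\sum_(j < t) (i <= m t w)%N%:R *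
    (wt (PA_mid (mw w) (cw w) t i.-1) j / tot (PA_mid (mw w) (cw w) t i.-1) t *
    phi (state n t i.-1 w) j))); last first.
  by apply: eq_Rintegral => w _; rewrite mulr_sumr.
rewrite !Rintegral_sum.
- apply: eq_bigr => j _; apply: (@choice_average n t i j (phi^~ j) C) => // w im.
  exact: phiC.
- move=> j _; apply: (@bounded_integrable _ _ _ _ _ C).
    apply: measurable_funM => //; apply: measurable_funM => //.
    exact: (cmeasurable_fun (fun N => wt N j / tot N t) (cmeasurable_PA_mid t i.-1)).
  move=> w; have /andP[q0 q1] := choice_prob_bounds w i.-1 t2 (ltn_ord j).
  case: leqP => im; last by rewrite mul0r normr0.
  rewrite mul1r normrM (ger0_norm q0).
  by apply: le_trans (phiC w j im (ltn_ord j)); rewrite ler_piMl.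
- move=> j _; apply: (@bounded_integrable _ _ _ _ _ C).
    apply: measurable_funM => //.
    apply: (@cmeasurable_fun _ _ R _ (fun w => (m t w, c t i w))
      (fun x : nat * nat => ((i <= x.1)%N && (x.2 == j))%:R : R)).
    by apply: cmeasurable_pair; exact: cmeasurable_RV.
  move=> w; case: leqP => im; last by rewrite mul0r normr0.
  by case: (_ == _); rewrite ?mul1r ?mul0r ?normr0 //; exact: phiC.
Qed.

(* The event that a time-n network has at most L edges bounds the number of
   steps and only depends on the initial degrees, so that conditioning on the
   past of a choice is not affected by it. *)
Definition few_edges n L w := (init_sum (mw w) n <= L)%N.

(** The increment of [psi] telescopes over the edges, and [one_step] replaces each term by its
    conditional average. On the event there are at most [L] such averages, each at most [eps]. The
    constant [C] secures integrability and does not enter the bound. *)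
Lemma drift_bound n L (psi : seq (nat * nat) -> R) C eps :
  (1 <= n)%N -> 0 <= C -> 0 <= eps ->
  (forall w t i, few_edges n L w -> (2 <= t <= n)%N -> (1 <= i <= m t w)%N ->
    let G := PA_mid (mw w) (cw w) t i.-1 in
    `|psi G| <= C /\ forall j, (j < t)%N -> `|psi (rcons G (t, j))| <= C) ->
  (forall w t i, few_edges n L w -> (2 <= t <= n)%N -> (1 <= i <= m t w)%N ->
    let G := PA_mid (mw w) (cw w) t i.-1 in
    `|\sum_(j < t) wt G j / tot G t * (psi (rcons G (t, nat_of_ord j)) - psi G)| <= eps) ->
  `|\int[P]_w ((few_edges n L w)%:R *
      (psi (PA (mw w) (cw w) n) - psi (PA (mw w) (cw w) 1)))| <= eps * L%:R.
Proof.
move=> n1 C0 eps0 psiC psie.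
pose g w : R := (few_edges n L w)%:R.
pose D t i w := g w * ((i <= m t w)%N%:R *
   (psi (PA_mid (mw w) (cw w) t i) - psi (PA_mid (mw w) (cw w) t i.-1))).
have mLe w t : few_edges n L w -> (1 <= t <= n)%N -> (m t w <= L)%N.
  move=> few tn; apply: leq_trans few; rewrite /init_sum.
  by rewrite (big_rem t) ?mem_index_iota //= leq_addr.
(* telescoping over the steps, padded with zero terms up to i = L *)
have tele w : g w * (psi (PA (mw w) (cw w) n) - psi (PA (mw w) (cw w) 1)) =
    \sum_(2 <= t < n.+1) \sum_(1 <= i < L.+1) D t i w.
  rewrite /g; case: (boolP (few_edges n L w)) => few; last first.
    rewrite mul0r big1 // => t _; rewrite big1 // => i _.
    by rewrite /D /g (negbTE few) mul0r.
  rewrite mul1r; have telS (f : nat -> R) k : \sum_(1 <= i < k.+1) (f i - f i.-1) = f k - f 0%N.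
    elim: k => [|k IH]; first by rewrite big_nil subrr.
    by rewrite big_nat_recr //= IH addrC subrKA.
  have inner t : (2 <= t <= n)%N -> \sum_(1 <= i < L.+1) D t i w =
      psi (PA (mw w) (cw w) t) - psi (PA (mw w) (cw w) t.-1).
    move=> tn; have mL : (m t w <= L)%N by apply: mLe => //; lia.
    rewrite (big_cat_nat (n := (m t w).+1)) //= [X in _ + X]big_nat [X in _ + X]big1.
      rewrite addr0 PA_midE; last lia.
      rewrite -PA_mid0 -(telS (fun i => psi (PA_mid (mw w) (cw w) t i))).
      apply: eq_big_nat => i im.
      by rewrite /D /g few mul1r (_ : (i <= m t w)%N) ?mul1r //; lia.
    move=> i im; rewrite /D (_ : (i <= m t w)%N = false) ?mul0r ?mulr0 //.
    by apply/negbTE; lia.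
  rewrite [RHS](eq_big_nat _ _ (F2 := fun t => psi (PA (mw w) (cw w) t) -
    psi (PA (mw w) (cw w) t.-1))); last by move=> t tn; exact: inner.
  have telT (f : nat -> R) k : (1 <= k)%N ->
      \sum_(2 <= t < k.+1) (f t - f t.-1) = f k - f 1%N.
    elim: k => [//|[_ _|k IH _]]; first by rewrite subrr big_nil.
    by rewrite big_nat_recr //= IH // addrC subrKA.
  by rewrite telT.
have mpsi t i : measurable_fun setT (fun w => psi (PA_mid (mw w) (cw w) t i)).
  exact: (cmeasurable_fun psi (cmeasurable_PA_mid t i)).
have mg : measurable_fun setT g.
  rewrite (_ : g = (fun w => (sumn (init_list n w) <= L)%N%:R)); last first.
    by apply/funext => w; rewrite init_list_sum.
  exact: (@cmeasurable_fun _ _ R _ (init_list n) (fun l => (sumn l <= L)%N%:R : R)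
    (cmeasurable_init_list n)).
have mleq t i : measurable_fun setT (fun w => (i <= m t w)%N%:R : R).
  exact: (cmeasurable_fun (fun k : nat => (i <= k)%N%:R : R) (cmeasurable_RV (m t))).
have psi2 w t i j : few_edges n L w -> (2 <= t <= n)%N -> (1 <= i <= m t w)%N ->
    (j < t)%N -> `|psi (rcons (PA_mid (mw w) (cw w) t i.-1) (t, j)) -
                   psi (PA_mid (mw w) (cw w) t i.-1)| <= 2 * C.
  move=> few tn im jt; have [p1 /(_ j jt) p2] := psiC w t i few tn im.
  by apply: le_trans (ler_normB _ _) _; lra.
(* The conditional average of [D t i] given the state before the choice. *)
pose DR t i w := g w * ((i <= m t w)%N%:R *
  \sum_(j < t) wt (PA_mid (mw w) (cw w) t i.-1) j /
               tot (PA_mid (mw w) (cw w) t i.-1) t *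
    (psi (rcons (PA_mid (mw w) (cw w) t i.-1) (t, nat_of_ord j)) -
     psi (PA_mid (mw w) (cw w) t i.-1))).
have mDR t i : measurable_fun setT (DR t i).
  apply: measurable_funM => //; apply: measurable_funM => //.
  exact: (cmeasurable_fun (fun N => \sum_(j < t) wt N j / tot N t *
    (psi (rcons N (t, nat_of_ord j)) - psi N)) (cmeasurable_PA_mid t i.-1)).
have DRe t i w : (2 <= t <= n)%N -> (1 <= i)%N ->
    `|DR t i w| <= eps * (g w * (i <= m t w)%N%:R).
  move=> tn i1; rewrite /DR /g; case: (boolP (few_edges n L w)) => few; last first.
    by rewrite !mul0r normr0 mulr0.
  case: leqP => im; last by rewrite mul0r !mulr0 normr0.
  by rewrite !mul1r mulr1; apply: psie => //; rewrite i1.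
have iD t i : (2 <= t <= n)%N -> (1 <= i)%N -> P.-integrable setT (EFin \o D t i).
  move=> tn i1; apply: (@bounded_integrable _ _ _ _ _ (2 * C)).
    apply: measurable_funM => //; apply: measurable_funM => //.
    exact: measurable_funB.
  move=> w; rewrite /D /g; case: (boolP (few_edges n L w)) => few; last first.
    by rewrite mul0r normr0; lra.
  case: leqP => im; last by rewrite mul0r mulr0 normr0; lra.
  rewrite !mul1r -{1}(prednK i1) PA_midS prednK //.
  apply: psi2 => //; first by rewrite i1.
  by apply: cw_lt; [lia|rewrite i1].
have iDR t i : (2 <= t <= n)%N -> (1 <= i)%N -> P.-integrable setT (EFin \o DR t i).
  move=> tn i1; apply: (@bounded_integrable _ _ _ _ _ eps) => // w.
  apply: le_trans (DRe t i w tn i1) _; rewrite ler_piMr // mulr_ile1 //.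
  by rewrite /g lern1 leq_b1.
  by rewrite lern1 leq_b1.
have DDR t i : (2 <= t <= n)%N -> (1 <= i)%N ->
    \int[P]_w D t i w = \int[P]_w DR t i w.
  move=> tn i1; have t2 : (2 <= t)%N by lia.
  pose phi (x : seq nat * seq (nat * nat)) j : R :=
    (sumn x.1 <= L)%N%:R * (psi (rcons x.2 (t, j)) - psi x.2).
  have gphi w j : phi (state n t i.-1 w) j = g w *
    (psi (rcons (PA_mid (mw w) (cw w) t i.-1) (t, j)) -
     psi (PA_mid (mw w) (cw w) t i.-1)).
    by rewrite /phi /state /= init_list_sum.
  transitivity (\int[P]_w ((i <= m t w)%N%:R * phi (state n t i.-1 w) (c t i w))).
    apply: eq_Rintegral => w _; rewrite gphi /D mulrCA; congr (_ * _).
    by rewrite -{1}(prednK i1) PA_midS prednK.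
  rewrite (@one_step _ _ _ _ (2 * C)) //; last 2 first.
  - by lra.
  - move=> w j im jt; rewrite gphi /g.
    case: (boolP (few_edges n L w)) => few; last by rewrite mul0r normr0; lra.
    by rewrite mul1r; apply: psi2 => //; rewrite i1.
  apply: eq_Rintegral => w _; rewrite /DR mulrCA; congr (_ * _).
  rewrite mulr_sumr; apply: eq_bigr => j _; rewrite gphi.
  by rewrite mulrCA.
have rng t : t \in index_iota 2 n.+1 -> (2 <= t <= n)%N.
  by rewrite mem_index_iota.
have rngi i : i \in index_iota 1 L.+1 -> (1 <= i)%N.
  by rewrite mem_index_iota => /andP[].
have iDi t : t \in index_iota 2 n.+1 ->
    P.-integrable setT (EFin \o (fun w => \sum_(1 <= i < L.+1) D t i w)).
  move=> /rng tn; apply: integrable_bigsum => i /rngi i1; exact: iD.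
have iDRi t : t \in index_iota 2 n.+1 ->
    P.-integrable setT (EFin \o (fun w => \sum_(1 <= i < L.+1) DR t i w)).
  move=> /rng tn; apply: integrable_bigsum => i /rngi i1; exact: iDR.
have -> : \int[P]_w (g w * (psi (PA (mw w) (cw w) n) - psi (PA (mw w) (cw w) 1))) =
    \int[P]_w (\sum_(2 <= t < n.+1) \sum_(1 <= i < L.+1) DR t i w).
  under eq_Rintegral do rewrite tele.
  rewrite !Rintegral_sum //; apply: eq_big_seq => t tr.
  rewrite Rintegral_sum; last by move=> i /rngi i1; apply: iD => //; exact: rng.
  rewrite Rintegral_sum; last by move=> i /rngi i1; apply: iDR => //; exact: rng.
  by apply: eq_big_seq => i /rngi i1; apply: DDR => //; exact: rng.
apply: norm_Rintegral_le; last by rewrite mulr_ge0.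
  by apply: measurable_sum => t; apply: measurable_sum => i.
move=> w; apply: le_trans (_ : \sum_(2 <= t < n.+1) \sum_(1 <= i < L.+1)
    eps * (g w * (i <= m t w)%N%:R) <= _).
  apply: le_trans (ler_norm_sum _ _ _) _; apply: ler_sum_nat => t tn.
  apply: le_trans (ler_norm_sum _ _ _) _; apply: ler_sum_nat => i /andP[i1 _].
  exact: DRe.
under eq_bigr do rewrite -mulr_sumr -mulr_sumr.
rewrite -mulr_sumr -mulr_sumr ler_wpM2l // /g.
case: (boolP (few_edges n L w)) => few; last by rewrite mul0r.
rewrite mul1r; apply: le_trans (_ : \sum_(2 <= t < n.+1) (m t w)%:R <= _).
  apply: ler_sum_nat => t tn; rewrite -natr_sum ler_nat.
  rewrite (big_cat_nat (n := (m t w).+1)) //=; last by rewrite ltnS; apply: mLe => //; lia.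
  rewrite [X in (_ + X)%N]big_nat [X in (_ + X)%N]big1 ?addn0; last first.
    by move=> i im; apply/eqP; rewrite eqb0 -ltnNge; lia.
  apply: leq_trans (_ : (\sum_(1 <= i < (m t w).+1) 1 <= _)%N).
    by apply: leq_sum => i _; rewrite leq_b1.
  by rewrite sum_nat_const_nat; lia.
rewrite -natr_sum ler_nat; apply: leq_trans few.
by rewrite /init_sum [leqRHS]big_ltn ?ltnS // leq_addl.
Qed.

End OneStep.

(** * Martingales of centred increments *)

Section TaylorBounds.
Variable R : realType.
Implicit Types x : R.

(** The mean value theorem passes a bound [|y| ^+ k] on the derivative to a bound [|y| ^+ k.+1] on
    the function; the four estimates follow one another by integration. The lost factorials do not
    matter. *)
Lemma sin_cos_taylor x : `|sin x| <= `|x| /\ `|cos x - 1| <= x ^+ 2 /\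
  `|sin x - x| <= `|x| ^+ 3 /\ `|cos x - 1 + x ^+ 2 / 2| <= x ^+ 4.
Proof.
have mvt (f f' : R -> R) (k : nat) : f 0 = 0 ->
    (forall y : R, is_derive y (1 : R) f (f' y)) ->
    (forall y, `|f' y| <= `|y| ^+ k) -> forall y, `|f y| <= `|y| ^+ k.+1.
  move=> f0 df fk y; have cf : continuous f.
    by move=> z; apply: differentiable_continuous; apply/derivable1_diffP; exact: ex_derive.
  have [y0|y0|y0] := ltgtP 0 y; last by rewrite -y0 f0 !normr0 expr0n.
  - have [|z zy] := @MVT R f f' 0 y y0 (fun z _ => df z); first exact: continuous_subspaceT.
    rewrite f0 !subr0 => ->; rewrite normrM exprS mulrC ler_wpM2l //.
    apply: le_trans (fk z) _; apply: lerXn2r; rewrite ?nnegrE //.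
    by move: zy; rewrite in_itv /= => /andP[z0 zy]; rewrite !gtr0_norm // ltW.
  - have [|z zy] := @MVT R f f' y 0 y0 (fun z _ => df z); first exact: continuous_subspaceT.
    rewrite f0 !sub0r => fy; rewrite -[X in `|X| <= _]opprK fy normrN normrM normrN.
    rewrite exprS mulrC ler_wpM2l //.
    apply: le_trans (fk z) _; apply: lerXn2r; rewrite ?nnegrE //.
    by move: zy; rewrite in_itv /= => /andP[z0 zy]; rewrite !ltr0_norm // lerN2 ltW.
have s1 (y : R) : `|sin y| <= `|y| ^+ 1.
  apply: (mvt (@sin R) (@cos R) 0%N); rewrite ?sin0 // => z.
  by rewrite expr0; exact: cos_max.
have c2 (y : R) : `|cos y - 1| <= `|y| ^+ 2.
  apply: (@mvt (fun y => cos y - 1) (fun y => - sin y) 1); rewrite ?cos0 ?subrr // => z.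
    by apply: trigger_derive; rewrite /GRing.scale /=; ring.
  by rewrite normrN.
have s3 (y : R) : `|sin y - y| <= `|y| ^+ 3.
  apply: (@mvt (fun y : R => sin y - y) (fun y : R => cos y - 1) 2).
  - by rewrite sin0 subrr.
  - exact: c2.
have c4 (y : R) : `|cos y - 1 + y ^+ 2 / 2| <= `|y| ^+ 4.
  apply: (@mvt (fun y => cos y - 1 + y ^+ 2 / 2) (fun y => y - sin y) 3).
  - by rewrite cos0 subrr expr0n mul0r addr0.
  - by move=> z; apply: trigger_derive; rewrite /GRing.scale /=; field.
  - by move=> z; rewrite distrC.
split; first by have := s1 x.
split; first by have := c2 x; rewrite real_normK ?num_real.
split; first exact: s3.
by have := c4 x; rewrite (exprM _ 2 2) real_normK ?num_real // -exprM.
Qed.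

(** Both bounds come from [1 + x <= expR x], taken at [z] and at [- z]. *)
Lemma expR_taylor2 (z : R) : 0 <= z <= 1 / 2 -> 0 <= expR z - 1 - z <= 2 * z ^+ 2.
Proof.
move=> /andP[z0 z1]; have e1 := expR_ge1Dx z; have := expR_ge1Dx (- z).
rewrite expRN => e2; have e0 := expR_gt0 z.
have : expR z * (1 - z) <= 1.
  by rewrite -[leRHS](divff (lt0r_neq0 e0)) ler_wpM2l // ltW.
by move=> e3; apply/andP; split; nra.
Qed.

(* The factor exp(x^2/2) compensates the second order terms. *)
Lemma trig_compensated x : `|x| <= 1 ->
  `|cos x * expR (x ^+ 2 / 2) - 1| <= 4 * `|x| ^+ 3 /\
  `|sin x * expR (x ^+ 2 / 2) - x| <= 3 * `|x| ^+ 3.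
Proof.
move=> x1; have [s1 [_ [s3 c4]]] := sin_cos_taylor x.
have x20 : 0 <= x ^+ 2 := sqr_ge0 x.
have nx2 : `|x| ^+ 2 = x ^+ 2 by rewrite real_normK ?num_real.
have x0 := normr_ge0 x.
set a := `|x| in x1 s1 s3 nx2 x0 *.
set z := x ^+ 2 / 2; set E := expR z.
have z2 : 0 <= z <= 1 / 2 by rewrite /z; nra.
have /andP[r0 r1] := expR_taylor2 z2; rewrite -/E in r0 r1.
have x4 : x ^+ 4 = 4 * z ^+ 2 by rewrite /z; field.
have xa : x ^+ 4 <= a ^+ 3.
  by rewrite (exprM x 2 2) -nx2 -exprM; apply: ler_wiXn2l.
have a3 : a ^+ 3 = 2 * a * z by rewrite /z -nx2; field.
have a30 : 0 <= a ^+ 3 by exact: exprn_ge0.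
have E0 : 0 <= E by exact: expR_ge0.
have E2 : E <= 2 by nra.
split.
  have -> : cos x * E - 1 = (cos x - 1 + x ^+ 2 / 2) * E + (E - 1 - z) * (1 - z) - z ^+ 2.
    by rewrite -/z; ring.
  apply: le_trans (ler_normB _ _) _.
  apply: le_trans (lerD (ler_normD _ _) (lexx _)) _.
  rewrite [ `|_ * E|]normrM [ `|_ * (1 - z)|]normrM (ger0_norm E0) (ger0_norm r0).
  have -> : `|1 - z| = 1 - z by rewrite ger0_norm //; lra.
  rewrite (ger0_norm (sqr_ge0 z)).
  have t1 : `|cos x - 1 + x ^+ 2 / 2| * E <= x ^+ 4 * 2 by apply: ler_pM.
  have t2 : (E - 1 - z) * (1 - z) <= 2 * z ^+ 2 by nra.
  nra.
have -> : sin x * E - x = (sin x - x) * E + x * (E - 1 - z) + x * z by ring.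
apply: le_trans (ler_normD _ _) _.
apply: le_trans (lerD (ler_normD _ _) (lexx _)) _.
rewrite [ `|_ * E|]normrM [ `|_ * z|]normrM [ `|x * _|]normrM.
have -> : `|z| = z by rewrite ger0_norm //; lra.
rewrite (ger0_norm E0) (ger0_norm r0) -/a.
have t1 : `|sin x - x| * E <= a ^+ 3 * 2 by apply: ler_pM.
have t2 : a * (E - 1 - z) <= a * z by rewrite ler_wpM2l //; nra.
nra.
Qed.

End TaylorBounds.

Section Martingale.
Context d (T : measurableType d) (R : realType) (P : probability T R).
Variables (m : nat -> {RV P >-> nat}) (c : nat -> nat -> {RV P >-> nat}).
Variable delta : R.
Hypothesis delta_gt : -1 < delta.
Hypothesis m_pos : forall t w, (1 <= t)%N -> (1 <= m t w)%N.
Hypothesis model : is_PA m c delta.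
Variables (h : nat -> R) (C : R).
Hypothesis hC : forall k, `|h k| <= C.

Local Notation mw := (m_at m).
Local Notation cw := (c_at c).
Local Notation wt := (wt delta).
Local Notation tot := (tot delta).

Let mw_gt0 w : forall t, (1 <= t)%N -> (1 <= mw w t)%N.
Proof. by move=> t; exact: m_pos. Qed.

Let cw_lt w t i : (2 <= t)%N -> (1 <= i <= mw w t)%N -> (cw w t i < t)%N.
Proof. exact: (PA_range model). Qed.

Definition hmean G t : R := \sum_(v < t) wt G v / tot G t * h (deg G v).

Definition incr G (e : nat * nat) : R := h (deg G e.2) - hmean G e.1.

(* For k = 1 the martingale of centred increments, for k = 2 its quadratic
   variation; the edges of PA_1 (with e.1 = 1) are not random choices. *)
Definition mart k (G : seq (nat * nat)) : R :=
  \sum_(p < size G) if (2 <= (nth (0, 0) G p).1)%N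
                    then incr (take p G) (nth (0, 0)%N G p) ^+ k else 0.

Lemma mart_rcons k G e :
  mart k (rcons G e) = mart k G + (if (2 <= e.1)%N then incr G e ^+ k else 0).
Proof.
rewrite /mart size_rcons big_ord_recr /= nth_rcons ltnn eqxx -cats1 take_size_cat //.
congr (_ + _); apply: eq_bigr => p _.
by rewrite nth_cat ltn_ord takel_cat // ltnW.
Qed.

Lemma mart_PA1 k w : mart k (PA (mw w) (cw w) 1) = 0.
Proof.
rewrite /mart PA1 big1 // => p _.
have pm : (p < mw w 1)%N by have := ltn_ord p; rewrite [X in (_ < X)%N]size_nseq.
by rewrite nth_nseq pm.
Qed.

Lemma sum_choice_prob w t i : (2 <= t)%N ->
  \sum_(v < t) wt (PA_mid (mw w) (cw w) t i) v / tot (PA_mid (mw w) (cw w) t i) t = 1.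
Proof.
move=> t2; rewrite -mulr_suml divff // gt_eqF //.
exact: (tot_gt0 delta_gt m_pos model).
Qed.

Let prob_ge0 w t i (v : 'I_t) : (2 <= t)%N ->
  0 <= wt (PA_mid (mw w) (cw w) t i) v / tot (PA_mid (mw w) (cw w) t i) t.
Proof.
move=> t2.
by have /andP[] := choice_prob_bounds delta_gt m_pos model w i t2 (ltn_ord v).
Qed.

Lemma norm_average_le w t i (f : nat -> R) B : (2 <= t)%N ->
  (forall v, (v < t)%N -> `|f v| <= B) ->
  `|\sum_(v < t) wt (PA_mid (mw w) (cw w) t i) v / tot (PA_mid (mw w) (cw w) t i) t * f v|
    <= B.
Proof.
move=> t2 fB; apply: le_trans (ler_norm_sum _ _ _) _.
rewrite -[leRHS]mul1r -(sum_choice_prob w i t2) mulr_suml.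
apply: ler_sum => v _; rewrite normrM ger0_norm ?prob_ge0 //.
by rewrite ler_wpM2l ?prob_ge0 // fB.
Qed.

Lemma norm_hmean_le w t i : (2 <= t)%N -> `|hmean (PA_mid (mw w) (cw w) t i) t| <= C.
Proof.
move=> t2; apply: (norm_average_le w i (f := fun v => h (deg (PA_mid (mw w) (cw w) t i) v))) => //.
Qed.

Lemma norm_incr_le w t i j : (2 <= t)%N ->
  `|incr (PA_mid (mw w) (cw w) t i) (t, j)| <= 2 * C.
Proof.
move=> t2; apply: le_trans (ler_normB _ _) _.
by have := hC (deg (PA_mid (mw w) (cw w) t i) j); have := norm_hmean_le w i t2; rewrite /=; lra.
Qed.

Lemma incr_centred w t i : (2 <= t)%N ->
  \sum_(v < t) wt (PA_mid (mw w) (cw w) t i) v / tot (PA_mid (mw w) (cw w) t i) t *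
    incr (PA_mid (mw w) (cw w) t i) (t, nat_of_ord v) = 0.
Proof.
move=> t2; under eq_bigr do rewrite /incr /= mulrBr.
by rewrite sumrB -mulr_suml sum_choice_prob // mul1r subrr.
Qed.

Let C0 : 0 <= C.
Proof. exact: le_trans (normr_ge0 _) (hC 0). Qed.

Lemma norm_mart_le k w t i : (2 <= t)%N -> (i <= mw w t)%N ->
  `|mart k (PA_mid (mw w) (cw w) t i)| <=
  (2 * C) ^+ k * (size (PA_mid (mw w) (cw w) t i))%:R.
Proof.
have Ck : 0 <= (2 * C) ^+ k by rewrite exprn_ge0 // mulr_ge0.
elim: t i => [//|t IHt] i t2; elim: i => [|i IH] im.
  rewrite PA_mid0 /=; case: t IHt t2 {im} => [//|[_ _|t IHt _]].
    by rewrite mart_PA1 normr0 mulr_ge0.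
  by rewrite PA_midE //; exact: IHt.
rewrite PA_midS mart_rcons t2 size_rcons -[(size _).+1%:R]natr1 mulrDr mulr1.
apply: le_trans (ler_normD _ _) _; apply: lerD; first exact: IH (ltnW im).
by rewrite normrX lerXn2r ?nnegrE ?mulr_ge0 // norm_incr_le.
Qed.

Lemma mart_edge_sum k w n : (1 <= n)%N -> mart k (PA (mw w) (cw w) n) =
  edge_sum (mw w) n
    (fun t i => incr (PA_mid (mw w) (cw w) t i.-1) (t, cw w t i) ^+ k).
Proof.
elim: n => [//|[_ _|n IH _]]; first by rewrite mart_PA1 edge_sum1.
rewrite edge_sumS // -IH // PA_midE //.
elim: (mw w n.+2) => [|i IHi]; first by rewrite PA_mid0 big_nil addr0.
by rewrite PA_midS mart_rcons big_nat_recr //= IHi addrA.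
Qed.

Lemma few_edges_size n L w t i : few_edges m n L w -> (2 <= t <= n)%N ->
  (1 <= i <= mw w t)%N -> (size (PA_mid (mw w) (cw w) t i.-1) < L)%N.
Proof.
move=> few tn im; rewrite size_PA_mid //; [|lia|lia].
apply: leq_trans few; apply: leq_trans (init_sum_le (mw w) (_ : (t <= n)%N)); last lia.
by case: t tn im => [//|t] tn im; rewrite /= init_sumS; lia.
Qed.

Let few_mart k n L w t i : few_edges m n L w -> (2 <= t <= n)%N ->
  (1 <= i <= mw w t)%N -> let G := PA_mid (mw w) (cw w) t i.-1 in
  `|mart k G| <= (2 * C) ^+ k * L%:R /\
  forall j, `|mart k (rcons G (t, j))| <= (2 * C) ^+ k * L%:R.
Proof.
move=> few tn im G; have sG := few_edges_size few tn im; rewrite -/G in sG.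
have t2 : (2 <= t)%N by lia.
have Ck : 0 <= (2 * C) ^+ k by rewrite exprn_ge0 // mulr_ge0.
have MG : `|mart k G| <= (2 * C) ^+ k * (size G)%:R by apply: norm_mart_le => //; lia.
split; first by apply: le_trans MG _; rewrite ler_wpM2l // ler_nat ltnW.
move=> j; rewrite mart_rcons t2.
apply: le_trans (_ : (2 * C) ^+ k * (size G).+1%:R <= _); last first.
  by rewrite ler_wpM2l // ler_nat.
rewrite -[(size G).+1%:R]natr1 mulrDr mulr1.
apply: le_trans (ler_normD _ _) _; apply: lerD => //.
by rewrite normrX lerXn2r ?nnegrE ?mulr_ge0 // norm_incr_le.
Qed.

(** The cross term in the increment of the square averages to zero, which leaves the conditional
    second moment of one increment, at most [(2 * C) ^+ 2]. *)
Lemma mart_L2 n L : (1 <= n)%N ->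
  \int[P]_w ((few_edges m n L w)%:R * mart 1 (PA (mw w) (cw w) n) ^+ 2) <=
  (2 * C) ^+ 2 * L%:R.
Proof.
move=> n1; pose psi G := mart 1 G ^+ 2.
have B0 : 0 <= (2 * C) * L%:R by rewrite !mulr_ge0.
rewrite (_ : \int[P]_w _ = \int[P]_w ((few_edges m n L w)%:R *
    (psi (PA (mw w) (cw w) n) - psi (PA (mw w) (cw w) 1)))); last first.
  by apply: eq_Rintegral => w _; rewrite /psi mart_PA1 expr0n subr0.
apply: le_trans (ler_norm _) _.
apply: (drift_bound delta_gt m_pos model (C := ((2 * C) * L%:R) ^+ 2)) => //.
- exact: exprn_ge0.
- by rewrite exprn_ge0 // mulr_ge0.
- move=> w t i few tn im G; have [M1 M2] := few_mart 1 few tn im.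
  rewrite expr1 in M1 M2; rewrite /psi; split => [|j _].
    by rewrite normrX lerXn2r ?nnegrE.
  by rewrite normrX lerXn2r ?nnegrE.
- move=> w t i few tn im /=; set G := PA_mid (mw w) (cw w) t i.-1.
  have t2 : (2 <= t)%N by lia.
  rewrite (_ : \sum_(j < t) _ = \sum_(j < t) wt G j / tot G t *
      incr G (t, nat_of_ord j) ^+ 2).
    apply: (norm_average_le w i.-1 (f := fun j => incr G (t, j) ^+ 2)) => // j _.
    by rewrite normrX lerXn2r ?nnegrE ?mulr_ge0 // norm_incr_le.
  transitivity (\sum_(j < t) wt G j / tot G t * incr G (t, nat_of_ord j) ^+ 2 +
      2 * mart 1 G * \sum_(j < t) wt G j / tot G t * incr G (t, nat_of_ord j));
    last by rewrite incr_centred // mulr0 addr0.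
  rewrite mulr_sumr -big_split; apply: eq_bigr => j _ /=.
  by rewrite /psi mart_rcons t2 expr1; ring.
Qed.

(** With [x] equal to [b] times an increment, the addition formula and [trig_compensated] reduce the
    relative change of [psi] to a term linear in [x], whose average vanishes, and to errors at most
    [4 * |x| ^+ 3] and [3 * |x| ^+ 3], whence the 7. *)
Lemma mart_cos n L (b phi : R) : (1 <= n)%N -> `|b| * (2 * C) <= 1 ->
  `|\int[P]_w ((few_edges m n L w)%:R *
     (cos (b * mart 1 (PA (mw w) (cw w) n) + phi) *
      expR (b ^+ 2 * mart 2 (PA (mw w) (cw w) n) / 2) - cos phi))| <=
  expR (b ^+ 2 * ((2 * C) ^+ 2 * L%:R) / 2) * (7 * (`|b| * (2 * C)) ^+ 3) * L%:R.
Proof.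
move=> n1 bC.
pose psi G := cos (b * mart 1 G + phi) * expR (b ^+ 2 * mart 2 G / 2).
set B := expR (b ^+ 2 * ((2 * C) ^+ 2 * L%:R) / 2).
have psiB G : `|mart 2 G| <= (2 * C) ^+ 2 * L%:R -> `|psi G| <= B.
  move=> MG; rewrite normrM (ger0_norm (expR_ge0 _)).
  apply: le_trans (_ : 1 * expR (b ^+ 2 * mart 2 G / 2) <= _).
    by rewrite ler_wpM2r ?expR_ge0 // cos_max.
  rewrite mul1r ler_expR ler_pM2r // ler_wpM2l ?sqr_ge0 //.
  by apply: le_trans MG; exact: ler_norm.
rewrite (_ : \int[P]_w _ = \int[P]_w ((few_edges m n L w)%:R *
    (psi (PA (mw w) (cw w) n) - psi (PA (mw w) (cw w) 1)))); last first.
  apply: eq_Rintegral => w _; rewrite /psi !mart_PA1 !mulr0 mul0r expR0 mulr1.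
  by rewrite add0r.
apply: (drift_bound delta_gt m_pos model (C := B)) => //.
- exact: expR_ge0.
- by rewrite mulr_ge0 ?expR_ge0 // mulr_ge0 // exprn_ge0 // mulr_ge0 // mulr_ge0.
- move=> w t i few tn im G; have [M1 M2] := few_mart 2 few tn im.
  by split => [|j _]; apply: psiB.
- move=> w t i few tn im /=; set G := PA_mid (mw w) (cw w) t i.-1.
  have t2 : (2 <= t)%N by lia.
  have [M1 _] := few_mart 2 few tn im; rewrite -/G in M1.
  pose E := expR (b ^+ 2 * mart 2 G / 2); pose y := b * mart 1 G + phi.
  pose x j := b * incr G (t, j).
  have EB : 0 <= E <= B.
    rewrite expR_ge0 /= ler_expR ler_pM2r // ler_wpM2l ?sqr_ge0 //.
    by apply: le_trans M1; exact: ler_norm.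
  have xb j : `|x j| <= `|b| * (2 * C).
    by rewrite normrM ler_wpM2l // norm_incr_le.
  (* The change of [psi] stripped of its part linear in the increment. *)
  pose r j := E * (cos y * (cos (x j) * expR (x j ^+ 2 / 2) - 1) -
                   sin y * (sin (x j) * expR (x j ^+ 2 / 2) - x j)).
  rewrite (_ : \sum_(j < t) _ = \sum_(j < t) wt G j / tot G t * r j).
    apply: (norm_average_le w i.-1 (f := r)) => // j _.
    have [c1 s1] := trig_compensated (le_trans (xb j) bC).
    have x3 : `|x j| ^+ 3 <= (`|b| * (2 * C)) ^+ 3.
      by rewrite lerXn2r ?nnegrE // !mulr_ge0.
    rewrite normrM; apply: ler_pM => //.
      by rewrite ger0_norm; case/andP: EB.
    apply: le_trans (ler_normB _ _) _; rewrite !normrM.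
    have yc := cos_max y; have ys := sin_max y.
    apply: le_trans (lerD (ler_pM _ _ yc c1) (ler_pM _ _ ys s1)) _ => //.
    by lra.
  transitivity (\sum_(j < t) wt G j / tot G t * r j +
      - (E * sin y * b) * \sum_(j < t) wt G j / tot G t * incr G (t, nat_of_ord j));
    last by rewrite incr_centred // mulr0 addr0.
  rewrite mulr_sumr -big_split; apply: eq_bigr => j _ /=.
  rewrite /psi !mart_rcons t2 expr1.
  rewrite (_ : b * (mart 1 G + incr G (t, nat_of_ord j)) + phi = y + x j); last first.
    by rewrite /y /x; ring.
  rewrite (_ : b ^+ 2 * (mart 2 G + incr G (t, nat_of_ord j) ^+ 2) / 2 =
      b ^+ 2 * mart 2 G / 2 + x j ^+ 2 / 2); last by rewrite /x; ring.
  by rewrite expRD -/E -/y cosD /r /x; ring.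
Qed.

End Martingale.

(** * Averages over the edges of a path *)

Lemma sum_nat_eq_le1 (D K : nat) : (\sum_(1 <= k < K) (D == k) <= 1)%N.
Proof.
elim: K => [|[|K] IH]; rewrite ?big_nil // big_nat_recr //=.
case: eqP => [->|_]; last by rewrite addn0.
rewrite big_nat big1 // => k /andP[_ kK]; by rewrite gtn_eqF.
Qed.

Section PathAveraging.
Variables (m : nat -> nat) (c : nat -> nat -> nat).
Hypothesis m_gt0 : forall t, (1 <= t)%N -> (1 <= m t)%N.
Hypothesis c_lt : forall t i, (2 <= t)%N -> (1 <= i <= m t)%N -> (c t i < t)%N.
(** Conservation of vertices: degree [k] is entered initially or by being chosen at degree [k.-1],
    and left by being chosen at degree [k]. The separate term [m 1 == k] is for [v_0]. *)
Lemma deg_countE n k : (1 <= n)%N -> (1 <= k)%N ->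
  (deg_count m c n k + chosen_count m c n k =
   (m 1 == k) + \sum_(1 <= t < n.+1) (k == m t) + chosen_count m c n k.-1)%N.
Proof.
case: k => [//|k] n1 _ /=.
have Gk := count_gt_PA c_lt k n1.
have Gk1 := count_gt_PA c_lt k.+1 n1.
have E1 : (deg_count m c n k.+1 + \sum_(v < n.+1) (k.+1 < deg (PA m c n) v) =
   \sum_(v < n.+1) (k < deg (PA m c n) v))%N.
  rewrite /deg_count -big_split; apply: eq_bigr => v _ /=; lia.
have E2 : ((m 1 == k.+1) + \sum_(1 <= t < n.+1) (k.+1 == m t) + R_gt m n k.+1 =
   R_gt m n k)%N.
  rewrite /R_gt big_ltn //.
  have : (\sum_(2 <= t < n.+1) (k.+1 == m t) + \sum_(2 <= t < n.+1) (k.+1 < m t) =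
    \sum_(2 <= t < n.+1) (k < m t))%N.
    by rewrite -big_split; apply: eq_bigr => t _ /=; lia.
  by lia.
by lia.
Qed.

Variable R : realType.

Lemma total_weight_ge t i (delta : R) : (2 <= t)%N -> (i <= m t)%N ->
  t%:R * (1 + delta) <= total_weight m c t i delta.
Proof.
move=> t2 im; rewrite total_weightE // mulrDr mulr1 addrC lerD2l ler_nat.
have : (t.-1 <= init_sum m t.-1)%N.
  elim: t.-1 => [//|u IH]; rewrite init_sumS; have := m_gt0 (ltn0Sn u); lia.
by lia.
Qed.

Variable mu : R.
Hypothesis mu_ge1 : 1 <= mu.
Implicit Type delta : R.

Let mu_ge0 : 0 <= mu := le_trans ler01 mu_ge1.

Definition dev t : R := (init_sum m t)%:R - mu * t%:R.

(* Replacing t / S_(t,i-1) by 1 / (2 mu + delta) and m_t by mu in sums over the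
   edges creates errors which add up to at most a constant times dev_err n. *)
Definition dev_err n : R := `|dev n| +
  \sum_(1 <= t < n.+1) (1 + (m t)%:R) * (1 + (m t)%:R + `|dev t|) / t%:R.

Let term_ge0 t : 0 <= (1 + (m t)%:R) * (1 + (m t)%:R + `|dev t|) / t%:R.
Proof. by rewrite mulr_ge0 ?invr_ge0 // mulr_ge0 ?addr_ge0. Qed.

Lemma dev_err_ge n : `|dev n| <= dev_err n.
Proof. by rewrite lerDl sumr_ge0. Qed.

Lemma dev_err_sum_le n :
  \sum_(2 <= t < n.+1) (1 + (m t)%:R) * (1 + (m t)%:R + `|dev t|) / t%:R <= dev_err n.
Proof.
case: n => [|n]; first by rewrite big_nil /dev_err addr_ge0 // sumr_ge0.
by rewrite /dev_err [in leRHS]big_ltn // addrA lerDr addr_ge0.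
Qed.

Lemma devS t : dev t.+1 = dev t + ((m t.+1)%:R - mu).
Proof. by rewrite /dev init_sumS natrD -natr1; ring. Qed.

Lemma dev_pred t : (1 <= t)%N -> `|dev t.-1| <= `|dev t| + (m t)%:R + mu.
Proof.
case: t => [//|t] _ /=; rewrite devS.
have -> : dev t = dev t + ((m t.+1)%:R - mu) - ((m t.+1)%:R - mu) by ring.
apply: le_trans (ler_normB _ _) _; rewrite -[leRHS]addrA subrK lerD2l.
by apply: le_trans (ler_normB _ _) _; rewrite !ger0_norm.
Qed.

(** For [s = 2 * mu + delta] the difference [t * s - S] is affine in [dev t.-1] and [i.-1], while
    [S >= t * (1 + delta)] and [s >= 1] control the denominator. *)
Lemma weight_ratio_le t i delta : (2 <= t)%N -> (1 <= i <= m t)%N -> -1 < delta ->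
  `|t%:R / total_weight m c t i.-1 delta - (2 * mu + delta)^-1| <=
  4 * mu / (1 + delta) * ((1 + (m t)%:R + `|dev t|) / t%:R).
Proof.
move=> t2 /andP[i1 im] d1.
have im' : (i.-1 <= m t)%N by lia.
have t0 : 0 < t%:R :> R by rewrite ltr0n; lia.
have Sge := total_weight_ge delta t2 im'.
have d0 : 0 < 1 + delta by lra.
have S0 : 0 < total_weight m c t i.-1 delta by apply: lt_le_trans Sge; rewrite mulr_gt0.
have s1 : 1 <= 2 * mu + delta by have := mu_ge1; lra.
have SE := total_weightE c_lt delta t2 im'.
set S := total_weight _ _ _ _ _ in Sge S0 SE *; set s := 2 * mu + delta in s1 *.
have s0 : 0 < s by lra.
have -> : t%:R / S - s^-1 = (t%:R * s - S) / (S * s) by field; rewrite !gt_eqF.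
rewrite normrM normfV (gtr0_norm (mulr_gt0 S0 s0)) ler_pdivrMr ?mulr_gt0 //.
have dp := dev_pred (ltnW t2).
have nS : `|t%:R * s - S| <= 4 * mu * (1 + (m t)%:R + `|dev t|).
  have -> : t%:R * s - S = 2 * mu - 2 * dev t.-1 - i.-1%:R.
    rewrite SE /s /dev natrD natrM; have -> : (t%:R : R) = t.-1%:R + 1.
      by rewrite natr1 prednK // ltnW.
    by ring.
  apply: le_trans (ler_normB _ _) _; apply: le_trans (lerD (ler_normB _ _) (lexx _)) _.
  rewrite !normrM !(ger0_norm (ler0n _ _)) (ger0_norm mu_ge0).
  have : (i.-1%:R : R) <= (m t)%:R by rewrite ler_nat.
  have m0 : 0 <= (m t)%:R :> R by exact: ler0n.
  have e0 : 0 <= `|dev t| by exact: normr_ge0.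
  rewrite !mulrDr; set z := `|dev t| in dp e0 *.
  have : mu * z >= z by rewrite ler_peMl.
  have : mu * (m t)%:R >= (m t)%:R by rewrite ler_peMl.
  by nra.
apply: le_trans nS _.
set X := 1 + _ + _; have X0 : 0 <= X by rewrite addr_ge0 ?addr_ge0.
have -> : 4 * mu / (1 + delta) * (X / t%:R) * (S * s) =
   4 * mu * X * (S / (t%:R * (1 + delta)) * s) by field; rewrite !gt_eqF.
rewrite ler_peMr ?mulr_ge0 ?mu_ge0 //.
rewrite -[leLHS]mulr1 ler_pM // ler_pdivlMr ?mulr_gt0 // mul1r //.
Qed.

(** Time [t] carries [m t] edges, which accounts for the factor [1 + m t] in [dev_err]. *)
Lemma edge_sum_term_le n A (F : nat -> nat -> R) : 0 <= A ->
  (forall t i, (2 <= t <= n)%N -> (1 <= i <= m t)%N ->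
     F t i <= A * ((1 + (m t)%:R + `|dev t|) / t%:R)) ->
  edge_sum m n F <= A * dev_err n.
Proof.
move=> A0 FA; apply: le_trans (ler_edge_sum FA) _.
rewrite edge_sumZ ler_wpM2l //; apply: le_trans (dev_err_sum_le n).
apply: ler_sum_nat => t /andP[t2 tn].
rewrite sumr_const_nat subSS subn0 -[X in X <= _]mulr_natl -[leRHS]mulrA ler_wpM2r //.
by rewrite lerDr.
Qed.

Lemma edge_sum_weight_ratio n delta : -1 < delta ->
  edge_sum m n (fun t i => `|t%:R / total_weight m c t i.-1 delta - (2 * mu + delta)^-1|)
  <= 4 * mu / (1 + delta) * dev_err n.
Proof.
move=> d1; apply: edge_sum_term_le.
  by rewrite divr_ge0 ?mulr_ge0 ?mu_ge0 //; lra.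
by move=> t i /andP[t2 _] im; exact: weight_ratio_le.
Qed.

(** * Drift of the number of vertices of a given degree *)

Section DegreeCounts.
Variable k : nat.

Let cnt G t : nat := (\sum_(v < t) (deg G v == k))%N.

(** A vertex enters or leaves degree [k] only if its own degree rises, and [i] edges raise the total
    degree of the old vertices by exactly [i]. *)
Lemma count_deg_mid t i : (2 <= t)%N -> (i <= m t)%N ->
  `|(cnt (PA_mid m c t i) t)%:R - (deg_count m c t.-1 k)%:R : R| <= i%:R.
Proof.
move=> t2 im.
have -> : deg_count m c t.-1 k = cnt (PA m c t.-1) t.
  by rewrite /deg_count /cnt prednK //; lia.
have S0 := sum_deg_PA_mid c_lt t2 (leq0n (m t)).
have S1 := sum_deg_PA_mid c_lt t2 im.
rewrite PA_mid0 in S0.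
have le1 : (cnt (PA_mid m c t i) t + \sum_(v < t) deg (PA m c t.-1) v <=
    cnt (PA m c t.-1) t + \sum_(v < t) deg (PA_mid m c t i) v)%N.
  rewrite /cnt -!big_split; apply: leq_sum => v _ /=.
  have := deg_PA_mid_ge m c t i v; lia.
have le2 : (cnt (PA m c t.-1) t + \sum_(v < t) deg (PA m c t.-1) v <=
    cnt (PA_mid m c t i) t + \sum_(v < t) deg (PA_mid m c t i) v)%N.
  rewrite /cnt -!big_split; apply: leq_sum => v _ /=.
  have := deg_PA_mid_ge m c t i v; lia.
have {}le1 : (cnt (PA_mid m c t i) t <= cnt (PA m c t.-1) t + i)%N by lia.
have {}le2 : (cnt (PA m c t.-1) t <= cnt (PA_mid m c t i) t + i)%N by lia.
rewrite ler_norml; move: le1 le2; rewrite -!(ler_nat R) !natrD => *; apply/andP; split; lra.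
Qed.

(** The proportion met by the edges of [v_t]: it is taken at time [t.-1], when there are [t]
    vertices. *)
Definition deg_frac t : R := (deg_count m c t.-1 k)%:R / t%:R.

Lemma deg_frac_bounds t : (1 <= t)%N -> 0 <= deg_frac t <= 1.
Proof.
move=> t1; rewrite divr_ge0 //= ler_pdivrMr ?ltr0n // mul1r ler_nat.
rewrite /deg_count prednK // -[leqRHS]card_ord -sum1_card; apply: leq_sum => v _.
exact: leq_b1.
Qed.

Lemma frac_diff t : (2 <= t)%N ->
  `|deg_frac t - deg_frac t.+1| <= 2 * ((1 + (m t)%:R) / t%:R).
Proof.
move=> t2; have t0 : 0 < t%:R :> R by rewrite ltr0n; lia.
have /andP[f0 f1] := deg_frac_bounds (ltnW t2).
have dE : deg_count m c t k = (cnt (PA_mid m c t (m t)) t + (m t == k))%N.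
  rewrite /deg_count big_ord_recr /= deg_PA_new //; last by lia.
  by rewrite PA_midE.
have := count_deg_mid t2 (leqnn (m t)); rewrite ler_norml => /andP[l1 l2].
have b01 : 0 <= ((m t == k)%:R : R) <= 1 by case: eqP => _; rewrite ?lexx ler01.
have e1 : (deg_count m c t.-1 k)%:R = deg_frac t * t%:R by rewrite /deg_frac divfK // gt_eqF.
have {1}-> : deg_frac t.+1 = (deg_count m c t k)%:R / (t%:R + 1) by rewrite /deg_frac natr1.
rewrite dE natrD; set x := (cnt _ t)%:R in l1 l2 *; set y := (m t == k)%:R in b01 *.
rewrite e1 in l1 l2; set f := deg_frac t in f0 f1 l1 l2 *.
have m0 : 0 <= (m t)%:R :> R by exact: ler0n.
have -> : f - (x + y) / (t%:R + 1) = (f * t%:R + f - x - y) / (t%:R + 1).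
  by field; rewrite gt_eqF // ltr_wpDl // ltW.
rewrite normrM normfV [ `|t%:R + 1| ]gtr0_norm; last by lra.
rewrite mulrA ler_pM ?invr_ge0 //; last by rewrite lef_pV2 ?posrE; lra.
by rewrite ler_norml; apply/andP; split; lra.
Qed.

Lemma init_frac_sum n : (1 <= n)%N ->
  `|\sum_(2 <= t < n.+1) ((m t)%:R - mu) * deg_frac t| <= 2 * dev_err n.
Proof.
(* summation by parts *)
pose E n := \sum_(1 <= t < n.+1) (1 + (m t)%:R) * (1 + (m t)%:R + `|dev t|) / t%:R.
have ES l : E l.+1 = E l + (1 + (m l.+1)%:R) * (1 + (m l.+1)%:R + `|dev l.+1|) / l.+1%:R.
  by rewrite /E big_nat_recr.
move=> n1; suff : `|\sum_(2 <= t < n.+1) ((m t)%:R - mu) * deg_frac t -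
    dev n * deg_frac n.+1| <= 2 * E n.
  move=> H; rewrite -[X in `|X|](subrK (dev n * deg_frac n.+1)).
  apply: le_trans (ler_normD _ _) _; rewrite /dev_err -/(E n).
  have : `|dev n * deg_frac n.+1| <= `|dev n|.
    have /andP[f0 f1] := deg_frac_bounds (ltn0Sn n).
    by rewrite normrM ler_piMr // ger0_norm.
  by have := normr_ge0 (dev n); lra.
elim: n n1 => [//|[_ _|n IH _]].
  rewrite big_nil sub0r normrN normrM /E big_nat1 divr1.
  have /andP[f0 f1] := deg_frac_bounds (ltn0Sn 1); rewrite (ger0_norm f0).
  have m0 : 0 <= (m 1)%:R :> R by exact: ler0n.
  have d0 := normr_ge0 (dev 1); set z := `|dev 1| in d0 *; set x := (m 1)%:R in m0 *.
  have : z * deg_frac 2 <= z by rewrite ler_piMr.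
  by nra.
have {}IH := IH isT; rewrite big_nat_recr // ES.
set G := \sum_(2 <= t < _) _ in IH *.
have -> : G + ((m n.+2)%:R - mu) * deg_frac n.+2 - dev n.+2 * deg_frac n.+3 =
  (G - dev n.+1 * deg_frac n.+2) + dev n.+2 * (deg_frac n.+2 - deg_frac n.+3).
  by rewrite devS; ring.
apply: le_trans (ler_normD _ _) _; rewrite [leRHS]mulrDr lerD ?IH // normrM.
have := frac_diff (isT : (2 <= n.+2)%N) => H.
apply: le_trans (ler_wpM2l (normr_ge0 _) H) _.
have t0 : 0 < n.+2%:R :> R by rewrite ltr0n.
rewrite !mulrA ler_pM2r ?invr_gt0 //.
have m0 : 0 <= (m n.+2)%:R :> R by exact: ler0n.
have := normr_ge0 (dev n.+2); by nra.
Qed.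

(** Three replacements are made: the current count by [deg_frac t * t], at a cost of at most [m t]
    per edge; the ratio [t / S] by its limit; and [m t] by [mu], through [init_frac_sum]. The first
    two contribute 1 and 4 to the factor 5, the last one gives the summand 2. *)
Lemma drift_frac n delta : (1 <= n)%N -> -1 < delta ->
  `|edge_sum m n (fun t i => (cnt (PA_mid m c t i.-1) t)%:R /
       total_weight m c t i.-1 delta)
    - mu / (2 * mu + delta) * \sum_(2 <= t < n.+1) deg_frac t| <=
  (5 * mu / (1 + delta) + 2) * dev_err n.
Proof.
move=> n1 d1.
have d0 : 0 < 1 + delta by lra.
have s1 : 1 <= 2 * mu + delta by have := mu_ge1; lra.
have s0 : 0 < 2 * mu + delta by lra.
set s := 2 * mu + delta in s1 s0 *.
have -> : mu / s * \sum_(2 <= t < n.+1) deg_frac t =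
   edge_sum m n (fun t i => deg_frac t / s) -
   s^-1 * \sum_(2 <= t < n.+1) ((m t)%:R - mu) * deg_frac t.
  rewrite /edge_sum !mulr_sumr -sumrB; apply: eq_bigr => t _.
  by rewrite sumr_const_nat subSS subn0 -mulr_natl; ring.
rewrite opprB addrCA addrC -edge_sumB mulrDl.
apply: le_trans (ler_normD _ _) _; rewrite lerD //; last first.
  rewrite normrM gtr0_norm ?invr_gt0 // mulrC; apply: le_trans (init_frac_sum n1).
  by rewrite ler_piMr // invf_le1.
apply: le_trans (ler_norm_edge_sum _ _ _) _; apply: edge_sum_term_le.
  by rewrite divr_ge0 ?mulr_ge0 ?mu_ge0 // ltW.
move=> t i /andP[t2 tn] im; have /andP[i1 im1] := im.
have im' : (i.-1 <= m t)%N by lia.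
have t0 : 0 < t%:R :> R by rewrite ltr0n; lia.
have Sge := total_weight_ge delta t2 im'.
have S0 : 0 < total_weight m c t i.-1 delta by apply: lt_le_trans Sge; rewrite mulr_gt0.
have W := weight_ratio_le t2 im d1; rewrite -/s in W.
set S := total_weight _ _ _ _ _ in Sge S0 W *.
have C := count_deg_mid t2 im'.
have /andP[f0 f1] := deg_frac_bounds (ltnW t2).
set x := (cnt _ t)%:R in C *.
have e1 : (deg_count m c t.-1 k)%:R = deg_frac t * t%:R by rewrite /deg_frac divfK // gt_eqF.
rewrite e1 in C.
have -> : x / S - deg_frac t / s = (x - deg_frac t * t%:R) / S + deg_frac t * (t%:R / S - s^-1).
  by field; rewrite !gt_eqF.
apply: le_trans (ler_normD _ _) _.
have -> : 5 * mu / (1 + delta) * ((1 + (m t)%:R + `|dev t|) / t%:R) =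
  mu / (1 + delta) * ((1 + (m t)%:R + `|dev t|) / t%:R) +
  4 * mu / (1 + delta) * ((1 + (m t)%:R + `|dev t|) / t%:R) by ring.
apply: lerD.
  rewrite normrM normfV (gtr0_norm S0).
  have -> : mu / (1 + delta) * ((1 + (m t)%:R + `|dev t|) / t%:R) =
     mu * (1 + (m t)%:R + `|dev t|) / (t%:R * (1 + delta)) by field; rewrite !gt_eqF.
  apply: ler_pM; rewrite ?invr_ge0 ?normr_ge0 ?(ltW S0) //.
    apply: le_trans C _; apply: (@le_trans _ _ (1 * (1 + (m t)%:R + `|dev t|))).
      have : (i.-1%:R : R) <= (m t)%:R by rewrite ler_nat.
      by have := normr_ge0 (dev t); lra.
    by rewrite ler_wpM2r // addr_ge0 ?addr_ge0.
  by rewrite lef_pV2 ?posrE ?mulr_gt0.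
rewrite normrM (ger0_norm f0); apply: le_trans W.
by rewrite ler_piMl.
Qed.

End DegreeCounts.

Lemma sum_deg_frac_le1 t K : (1 <= t)%N -> \sum_(1 <= k < K) deg_frac k t <= 1.
Proof.
move=> t1; rewrite /deg_frac -mulr_suml ler_pdivrMr ?ltr0n // mul1r -natr_sum ler_nat.
rewrite /deg_count prednK // exchange_big /= -[leqRHS]card_ord -sum1_card.
apply: leq_sum => v _; have := sum_nat_eq_le1 (deg (PA m c t.-1) v) K.
by [].
Qed.

End PathAveraging.

(** * Initial degrees *)

Lemma mean_cvg (R : realType) (u : nat -> R) (l : R) : u @ \oo --> l ->
  (\sum_(1 <= t < n.+1) u t) / n%:R @[n --> \oo] --> l.
Proof.
move=> ul; have ul1 : u n.+1 @[n --> \oo] --> l by rewrite cvg_shiftS.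
rewrite -cvg_shiftS; apply: cvg_trans (cesaro ul1); apply: near_eq_cvg; near=> n.
by rewrite /arithmetic_mean /series /= mulrC [in RHS]big_add1.
Unshelve. all: by end_near. Qed.

Lemma cvg_sqrt_inv (R : realType) : (Num.sqrt n%:R)^-1 @[n --> \oo] --> (0 : R).
Proof.
apply/cvgr0Pnorm_le => e e0; near=> n.
have n0 : 0 < (n%:R : R) by near: n; exact: nbhs_infty_gtr.
rewrite ger0_norm ?invr_ge0 ?sqrtr_ge0 // -[leRHS]invrK lef_pV2 ?posrE ?invr_gt0 //;
  last by rewrite sqrtr_gt0.
rewrite -[leLHS]gtr0_norm ?invr_gt0 // -sqrtr_sqr ler_wsqrtr //.
by near: n; exact: nbhs_infty_ger.
Unshelve. all: by end_near. Qed.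

Section InitialDegrees.
Context d (T : measurableType d) (R : realType) (P : probability T R).
Variable m : nat -> {RV P >-> nat}.
Hypothesis m_iid : iid m.
Hypothesis m_moment2 : ('E_P[(fun w => (m 1%N w)%:R ^+ 2)%R] < +oo)%E.

Local Notation mw := (m_at m).

Lemma measurable_init (f : nat -> R) t : measurable_fun setT (fun w => f (m t w)).
Proof. exact: (cmeasurable_fun f (cmeasurable_RV (m t))). Qed.

Lemma ge0_integral_init (f : nat -> R) t : (1 <= t)%N -> (forall k, 0 <= f k) ->
  (\int[P]_w (f (m t w))%:E = \int[P]_w (f (m 1%N w))%:E)%E.
Proof.
move=> t1 f0.
have mf : measurable_fun setT (fun k : nat => (f k)%:E) by [].
rewrite -(ge0_integral_distribution (m t) mf) // -(ge0_integral_distribution (m 1%N) mf) //.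
apply: eq_measure_integral => A mA _; exact: m_iid.2.
Qed.

Lemma integrable_init (f : nat -> R) t : (1 <= t)%N ->
  P.-integrable setT (EFin \o (fun w => f (m 1%N w))) ->
  P.-integrable setT (EFin \o (fun w => f (m t w))).
Proof.
move=> t1 /integrableP[_ fi]; apply/integrableP; split.
  by apply/measurable_EFinP; exact: measurable_init.
have := @ge0_integral_init (fun k => `|f k|) t t1 (fun=> normr_ge0 _).
by move=> /= H; rewrite (eq_integral (fun w => `|f (m t w)|%:E)) // H.
Qed.

Lemma Rintegral_init (f : nat -> R) t : (1 <= t)%N ->
  P.-integrable setT (EFin \o (fun w => f (m 1%N w))) ->
  \int[P]_w f (m t w) = \int[P]_w f (m 1%N w).
Proof.
move=> t1 if1; have ift := integrable_init t1 if1.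
have mf : measurable_fun setT (fun k : nat => (f k)%:E) by [].
rewrite /Rintegral -(integral_distribution mf ift) -(integral_distribution mf if1).
congr fine; apply: eq_measure_integral => A mA _; exact: m_iid.2.
Qed.

Lemma indep2 s t k l : (1 <= s)%N -> (1 <= t)%N -> s != t ->
  P ((m s @^-1` [set k]) `&` (m t @^-1` [set l])) =
  (P (m s @^-1` [set k]) * P (m t @^-1` [set l]))%E.
Proof.
move=> s1 t1 st.
pose A i : set nat := if i == s then [set k] else [set l].
have := m_iid.1 [fset s; t]%fset A _ _.
rewrite big_fsetU1 ?inE //= big_seq_fset1 /A eqxx eq_sym (negbTE st) => <- //.
- congr (P _); apply/seteqP; split => w /=.
    move=> [ms mt] i; rewrite /= !inE => /orP[] /eqP ->; first by rewrite eqxx.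
    by rewrite eq_sym (negbTE st).
  move=> H; split; first by have := H s; rewrite /= !inE eqxx; apply.
  by have := H t; rewrite /= !inE eqxx orbT [t == s]eq_sym (negbTE st); apply.
- by move=> i; rewrite !inE => /orP[] /eqP ->.
Qed.

Let int_prod (f g : T -> R) : measurable_fun setT f -> measurable_fun setT g ->
  P.-integrable setT (EFin \o (fun w => f w ^+ 2)) ->
  P.-integrable setT (EFin \o (fun w => g w ^+ 2)) ->
  P.-integrable setT (EFin \o (fun w => f w * g w)).
Proof.
move=> mf mg if2 ig2.
apply: (@le_integrable _ _ _ P setT measurableT _
  (fun w => (f w ^+ 2)%:E + (g w ^+ 2)%:E)%E).
- by apply/measurable_EFinP; exact: measurable_funM.
- move=> w _ /=; rewrite lee_fin; apply: le_trans (ler_norm _).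
  rewrite ler_norml; apply/andP; split; nra.
- exact: integrableD.
Qed.

Let int_sq (f : T -> R) : measurable_fun setT f ->
  P.-integrable setT (EFin \o (fun w => f w ^+ 2)) -> P.-integrable setT (EFin \o f).
Proof.
move=> mf if2.
rewrite (_ : EFin \o f = EFin \o (fun w => f w * cst 1 w)); last first.
  by apply/funext => w; rewrite /= mulr1.
apply: int_prod => //; apply: (@bounded_integrable _ _ _ _ _ 1).
  by apply: measurable_funX; exact: measurable_cst.
by move=> w; rewrite /= expr1n normr1.
Qed.

(** Independence is stated for events. The product formula for functions is obtained on the fibers
    of [m s], and within each of them on the fibers of [m t]. *)
Lemma integral_indep2 (f g : nat -> R) s t : (1 <= s)%N -> (1 <= t)%N -> s != t ->
  P.-integrable setT (EFin \o (fun w => f (m 1%N w) ^+ 2)) ->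
  P.-integrable setT (EFin \o (fun w => g (m 1%N w) ^+ 2)) ->
  \int[P]_w (f (m s w) * g (m t w)) =
  (\int[P]_w f (m s w)) * (\int[P]_w g (m t w)).
Proof.
move=> s1 t1 st if2 ig2.
have ifs := integrable_init (f := fun k => f k ^+ 2) s1 if2.
have igt := integrable_init (f := fun k => g k ^+ 2) t1 ig2.
have mF r k : measurable (m r @^-1` [set k]) by exact: (cmeasurable_RV (m r)).
have ig := int_sq (measurable_init g t) igt.
have if1 := int_sq (measurable_init f s) ifs.
set b := \int[P]_w g (m t w).
have bE : (\int[P]_w (g (m t w))%:E = b%:E)%E by rewrite fineK // integrable_fin_num.
have step k : (\int[P]_(w in m s @^-1` [set k]) (g (m t w))%:E =
    P (m s @^-1` [set k]) * b%:E)%E.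
  set p := P _; have pE : p = (fine p)%:E by rewrite fineK // fin_num_measure.
  have : \int[P]_w (\1_(m s @^-1` [set k]) w * g (m t w)) =
         \int[P]_w (fine p * g (m t w)).
    apply: (eq_integral_fibers (s := m t)).
    - exact: cmeasurable_RV.
    - apply: int_prod => //; [exact: measurable_init|].
      apply: (@bounded_integrable _ _ _ _ _ 1); first by apply: measurable_funX.
      by move=> w; rewrite indicE; case: (_ \in _); rewrite ?expr1n ?expr0n ?normr1 ?normr0.
    - apply: int_prod => //; [exact: measurable_init|].
      by apply: (@bounded_integrable _ _ _ _ _ (fine p ^+ 2)) => // w; rewrite ger0_norm ?sqr_ge0.
    - move=> l.
      transitivity (\int[P]_(w in m t @^-1` [set l])
          ((\1_(m s @^-1` [set k]) w)%:E * (g l)%:E))%E.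
        by apply: eq_integral => w /set_mem /= ->.
      transitivity (\int[P]_(w in m t @^-1` [set l]) (fine p * g l)%:E)%E; last first.
        by apply: eq_integral => w /set_mem /= ->.
      rewrite (@integralZr _ _ _ P (m t @^-1` [set l]) (mF t l)
        (EFin \o \1_(m s @^-1` [set k])) _ (g l)); last first.
        apply: (integrableS measurableT) => //.
        apply: (@bounded_integrable _ _ _ _ _ 1) => // w.
        by rewrite indicE ger0_norm ?ler0n // lern1 leq_b1.
      rewrite integral_indic //.
      rewrite [X in (X * _)%E](indep2 k l s1 t1 st) -/p integral_cst // EFinM -pE.
      by rewrite muleAC.
  rewrite RintegralZl // -/b => H.
  rewrite pE -EFinM -H /Rintegral fineK; last first.
    apply: integrable_fin_num => //; apply: int_prod => //; [exact: measurable_init|].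
    apply: (@bounded_integrable _ _ _ _ _ 1); first by apply: measurable_funX.
    by move=> w; rewrite indicE; case: (_ \in _); rewrite ?expr1n ?expr0n ?normr1 ?normr0.
  rewrite (integral_mkcond (m s @^-1` [set k])); apply: eq_integral => w _.
  by rewrite patchE indicE; case: (_ \in _); rewrite ?mul1r ?mul0r.
have -> : \int[P]_w f (m s w) * b = \int[P]_w (f (m s w) * b) by rewrite RintegralZr.
apply: (eq_integral_fibers (s := m s)).
- exact: cmeasurable_RV.
- by apply: int_prod => //; exact: measurable_init.
- rewrite (_ : EFin \o _ = (fun w => (f (m s w))%:E * b%:E)%E); last by apply/funext.
  exact: integrableZr.
- move=> k.
  transitivity (\int[P]_(w in m s @^-1` [set k]) ((f k)%:E * (g (m t w))%:E))%E.
    by apply: eq_integral => w /set_mem /= ->.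
  transitivity (\int[P]_(w in m s @^-1` [set k]) (f k * b)%:E)%E; last first.
    by apply: eq_integral => w /set_mem /= ->.
  rewrite integralZl //; last exact: (integrableS measurableT).
  rewrite [X in (_ * X)%E]step integral_cst; last exact: mF.
  by rewrite EFinM muleCA muleC.
Qed.

(** * Weak law of large numbers for functions of the initial degrees *)

Section CentredSums.
Variable g : nat -> R.
Hypothesis ig2 : P.-integrable setT (EFin \o (fun w => g (m 1%N w) ^+ 2)).

Let b := \int[P]_w g (m 1%N w).
Let X t w := g (m t w) - b.

Let ig : P.-integrable setT (EFin \o (fun w => g (m 1%N w))).
Proof. by apply: int_sq => //; exact: measurable_init. Qed.

Let iX1 : P.-integrable setT (EFin \o (fun w => (g (m 1%N w) - b) ^+ 2)).
Proof.
rewrite (_ : EFin \o _ = (fun w => (g (m 1%N w) ^+ 2)%:E +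
   ((- (2 * b))%:E * (g (m 1%N w))%:E + (b ^+ 2)%:E))%E).
  apply: integrableD => //; apply: integrableD => //; first exact: integrableZl.
  by apply: (@bounded_integrable _ _ _ P (cst (b ^+ 2)) (b ^+ 2)) => // w;
    rewrite /= ger0_norm ?sqr_ge0.
by apply/funext => w /=; rewrite -!EFinM -!EFinD; congr EFin; ring.
Qed.

Definition centred_var := \int[P]_w (g (m 1%N w) - b) ^+ 2.

Let iXX s t : (1 <= s)%N -> (1 <= t)%N ->
  P.-integrable setT (EFin \o (fun w => X s w * X t w)).
Proof.
move=> s1 t1; apply: int_prod.
- by apply: measurable_funB => //; exact: measurable_init.
- by apply: measurable_funB => //; exact: measurable_init.
- exact: (integrable_init (f := fun k => (g k - b) ^+ 2)).
- exact: (integrable_init (f := fun k => (g k - b) ^+ 2)).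
Qed.

Let EXX s t : (1 <= s)%N -> (1 <= t)%N -> s != t -> \int[P]_w (X s w * X t w) = 0.
Proof.
move=> s1 t1 st.
rewrite (integral_indep2 (f := fun k => g k - b) (g := fun k => g k - b)) //.
have icst : P.-integrable setT (EFin \o cst b).
  by apply: (@bounded_integrable _ _ _ P (cst b) `|b|).
rewrite (RintegralB _ (integrable_init s1 ig) icst) // (Rintegral_init s1 ig).
rewrite Rintegral_cst // [fine _](_ : _ = 1).
  by rewrite mulr1 -/b subrr mul0r.
by rewrite -[RHS]/(fine 1%E) -(probability_setT P).
Qed.

Definition centred_sum n w := \sum_(1 <= t < n.+1) X t w.

Lemma measurable_centred_sum n : measurable_fun setT (centred_sum n).
Proof.
by apply: measurable_sum => t; apply: measurable_funB => //; exact: measurable_init.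
Qed.

(** Independent centred variables are orthogonal, so the second moment is additive. *)
Lemma centred_sum_L2 n :
  P.-integrable setT (EFin \o (fun w => centred_sum n w ^+ 2)) /\
  \int[P]_w (centred_sum n w ^+ 2) = n%:R * centred_var.
Proof.
elim: n => [|n [iS ES]].
  rewrite (_ : (fun w => centred_sum 0 w ^+ 2) = cst 0); last first.
    by apply/funext => w; rewrite /centred_sum big_nil expr0n.
  split; first exact: integrable0.
  by rewrite Rintegral_cst // !mul0r.
have SE w : centred_sum n.+1 w ^+ 2 = centred_sum n w ^+ 2 +
    (2 * \sum_(1 <= t < n.+1) X t w * X n.+1 w + X n.+1 w ^+ 2).
  by rewrite {1}/centred_sum big_nat_recr //= -mulr_suml -/(centred_sum n w); ring.
have iX2 : P.-integrable setT (EFin \o (fun w => X n.+1 w ^+ 2)).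
  exact: (integrable_init (f := fun k => (g k - b) ^+ 2)).
have rng t : t \in index_iota 1 n.+1 -> (1 <= t <= n)%N by rewrite mem_index_iota.
have iC : P.-integrable setT
    (EFin \o (fun w => \sum_(1 <= t < n.+1) X t w * X n.+1 w)).
  by apply: integrable_bigsum => t /rng /andP[t1 _]; exact: iXX.
have iC2 : P.-integrable setT
    (EFin \o (fun w => 2 * \sum_(1 <= t < n.+1) X t w * X n.+1 w)).
  rewrite (_ : EFin \o _ = (fun w => 2%:E *
    (\sum_(1 <= t < n.+1) X t w * X n.+1 w)%R%:E)%E); last by apply/funext.
  exact: integrableZl.
have iCX : P.-integrable setT
    (EFin \o (fun w => 2 * \sum_(1 <= t < n.+1) X t w * X n.+1 w + X n.+1 w ^+ 2)).
  rewrite (_ : EFin \o _ = (fun w => (2 * \sum_(1 <= t < n.+1) X t w * X n.+1 w)%:E +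
    (X n.+1 w ^+ 2)%:E)%E); last by apply/funext.
  exact: integrableD.
split.
  rewrite (_ : EFin \o _ = (fun w => (centred_sum n w ^+ 2)%:E +
    (2 * \sum_(1 <= t < n.+1) X t w * X n.+1 w + X n.+1 w ^+ 2)%:E)%E).
    exact: integrableD.
  by apply/funext => w /=; rewrite SE.
under eq_Rintegral do rewrite SE.
rewrite RintegralD // ES RintegralD // RintegralZl // Rintegral_sum; last first.
  by move=> t /rng /andP[t1 _]; exact: iXX.
rewrite big_seq big1 ?mulr0 ?add0r; last first.
  by move=> t /rng /andP[t1 tn]; apply: EXX => //; rewrite neq_ltn ltnS tn.
rewrite (Rintegral_init (f := fun k => (g k - b) ^+ 2)) // -/centred_var.
by rewrite -natr1; ring.
Qed.

Lemma centred_var_ge0 : 0 <= centred_var.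
Proof. by apply: Rintegral_ge0 => w _; exact: sqr_ge0. Qed.

(** Integrating [|x| <= s + x ^+ 2 / s] with [s = Num.sqrt n] yields the order of Cauchy-Schwarz, up
    to the constant. *)
Lemma centred_sum_L1 n :
  (\int[P]_w `|centred_sum n w|%:E <= (Num.sqrt n%:R * (1 + centred_var))%:E)%E.
Proof.
case: n => [|n].
  rewrite integral0_eq ?sqrtr0 ?mul0r // => w _.
  by rewrite /centred_sum big_nil normr0.
have [iS ES] := centred_sum_L2 n.+1.
set s := Num.sqrt _; have s0 : 0 < s by rewrite sqrtr_gt0 ltr0n.
have s2 : s ^+ 2 = n.+1%:R by rewrite sqr_sqrtr // ler0n.
have iD : P.-integrable setT (EFin \o (fun w => s + s^-1 * centred_sum n.+1 w ^+ 2)).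
  rewrite (_ : EFin \o _ = (fun w => s%:E +
    s^-1%:E * (centred_sum n.+1 w ^+ 2)%:E)%E); last by apply/funext.
  apply: integrableD => //; last exact: integrableZl.
  by apply: (@bounded_integrable _ _ _ P (cst s) s) => // w; rewrite /= gtr0_norm.
have iZ : P.-integrable setT (EFin \o (fun w => s^-1 * centred_sum n.+1 w ^+ 2)).
  rewrite (_ : EFin \o _ = (fun w => s^-1%:E * (centred_sum n.+1 w ^+ 2)%:E)%E);
    last by apply/funext.
  exact: integrableZl.
apply: (@le_trans _ _ (\int[P]_w (s + s^-1 * centred_sum n.+1 w ^+ 2)%:E)%E).
  apply: ge0_le_integral => //.
  - by apply/measurable_EFinP/measurableT_comp => //; exact: measurable_centred_sum.
  - by case/integrableP: iD.
  move=> w _; rewrite lee_fin -(ler_pM2l s0) mulrDr mulrA divff ?gt_eqF // mul1r.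
  set x := centred_sum _ _; rewrite -(real_normK (num_real x)); set y := `|x|.
  have y0 : 0 <= y by exact: normr_ge0.
  by nra.
rewrite -[leLHS]fineK; last exact: integrable_fin_num.
rewrite lee_fin -/(Rintegral _ _ _) RintegralD //; last first.
  by apply: (@bounded_integrable _ _ _ P (cst s) s) => // w; rewrite /= gtr0_norm.
rewrite Rintegral_cst // [fine _](_ : _ = 1); last first.
  by rewrite -[RHS]/(fine 1%E) -(probability_setT P).
rewrite RintegralZl // ES -s2 mulr1 mulrDr mulr1 lerD2l.
by rewrite mulrA expr2 mulrA mulVf ?gt_eqF // mul1r.
Qed.

Lemma centred_mean_cvg0 :
  centred_sum nw.1 nw.2 / nw.1%:R @[nw --> whp P] --> 0.
Proof.
apply: (@cvg_whp_markov _ _ _ P (fun n w => centred_sum n w / n%:R)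
  (fun n => (1 + centred_var) * (Num.sqrt n%:R)^-1)).
- by move=> n; apply: measurable_funM => //; exact: measurable_centred_sum.
- move=> n; under eq_integral do rewrite normrM EFinM.
  rewrite ge0_integralZr //; last first.
    by apply/measurable_EFinP/measurableT_comp => //; exact: measurable_centred_sum.
  case: n => [|n].
    by rewrite invr0 normr0 mule0 sqrtr0 invr0 mulr0.
  apply: (@le_trans _ _ ((Num.sqrt n.+1%:R * (1 + centred_var))%:E *
     `|n.+1%:R^-1|%:E)%E).
    by apply: lee_pmul => //; [exact: integral_ge0|exact: centred_sum_L1].
  rewrite -EFinM lee_fin ger0_norm ?invr_ge0 ?ler0n // mulrAC mulrC.
  set s := Num.sqrt _; have s0 : s != 0 by rewrite gt_eqF // sqrtr_gt0 ltr0n.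
  rewrite (_ : n.+1%:R = s ^+ 2); last by rewrite sqr_sqrtr // ler0n.
  by rewrite (_ : s / s ^+ 2 = s^-1) //; field.
- rewrite -[0](mulr0 (1 + centred_var)); apply: cvgMr.
  exact: cvg_sqrt_inv.
Qed.

End CentredSums.

Let im2 : P.-integrable setT (EFin \o (fun w => ((m 1%N w)%:R : R) ^+ 2)).
Proof.
apply/integrableP; split.
  by apply/measurable_EFinP; exact: (@measurable_init (fun k => k%:R ^+ 2)).
move: m_moment2; rewrite unlock; congr (_ < _)%E.
by apply: eq_integral => w _; rewrite /= ger0_norm // sqr_ge0.
Qed.

Local Notation mu := (init_mean m).

Lemma init_meanE : mu = \int[P]_w ((m 1%N w)%:R : R).
Proof. by rewrite /init_mean unlock. Qed.

Lemma init_probE k : init_prob m k = \int[P]_w ((k == m 1%N w)%:R : R).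
Proof.
rewrite /init_prob /Rintegral; congr fine.
pose A : set T := m 1%N @^-1` [set k].
have mk : measurable A by exact: (cmeasurable_RV (m 1%N)).
rewrite -[LHS]/(P A).
rewrite -[LHS]mul1e -integral_cst // integral_mkcond.
apply: eq_integral => w _; rewrite patchE eq_sym.
case: eqP => [e|e]; first by rewrite (_ : w \in A) // inE.
by rewrite (_ : w \in A = false) //; apply/negbTE; rewrite notin_setE.
Qed.

Lemma init_prob_ge0 k : 0 <= init_prob m k.
Proof. by rewrite init_probE; apply: Rintegral_ge0 => w _; exact: ler0n. Qed.

Lemma init_mean_ge1 (m_pos : forall t w, (1 <= t)%N -> (1 <= m t w)%N) : 1 <= mu.
Proof.
have im := int_sq (@measurable_init (fun k => k%:R) 1%N) im2.
rewrite init_meanE; apply: (@le_trans _ _ (\int[P]_w (cst 1 w : R))).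
  rewrite Rintegral_cst // [fine _](_ : _ = 1) ?mulr1 //.
  by rewrite -[RHS]/(fine 1%E) -(probability_setT P).
apply: le_Rintegral => //.
  by apply: (@bounded_integrable _ _ _ P (cst 1) 1) => // w; rewrite /= normr1.
by move=> w _ /=; rewrite ler1n m_pos.
Qed.

Local Notation cM t w := (dev (mw w) mu t).

Lemma dev_centred_sum t w : cM t w = centred_sum (fun k => k%:R) t w.
Proof.
rewrite /dev /centred_sum -init_meanE sumrB /init_sum natr_sum; congr (_ - _).
by rewrite sumr_const_nat subSS subn0 mulr_natr.
Qed.

Lemma init_sum_mean_cvg :
  (init_sum (mw nw.2) nw.1)%:R / nw.1%:R @[nw --> whp P] --> mu.
Proof.
have H := @centred_mean_cvg0 (fun k => k%:R) im2.
rewrite -[mu]addr0.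
apply: cvg_trans (cvgD (@cvg_cst _ mu _ (whp P) _) H).
apply: near_eq_cvg; apply: whp_near; near=> n => w /=.
rewrite fctE -dev_centred_sum /dev mulrBl mulfK ?subrKC //.
by rewrite /= pnatr_eq0 -lt0n; near: n; exact: nbhs_infty_gt.
Unshelve. all: by end_near. Qed.

Lemma init_count_mean_cvg k :
  (\sum_(1 <= t < nw.1.+1) (k == m t nw.2)%N)%:R / nw.1%:R @[nw --> whp P]
    --> init_prob m k.
Proof.
have H : P.-integrable setT (EFin \o (fun w => ((k == m 1%N w)%:R : R) ^+ 2)).
  apply: (@bounded_integrable _ _ _ P _ 1).
    exact: (@measurable_init (fun j => (k == j)%:R ^+ 2)).
  by move=> w; case: (_ == _); rewrite ?expr1n ?expr0n ?normr1 ?normr0.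
have {}H := @centred_mean_cvg0 (fun j => (k == j)%:R) H.
rewrite -[init_prob m k]addr0.
apply: cvg_trans (cvgD (@cvg_cst _ (init_prob m k) _ (whp P) _) H).
apply: near_eq_cvg; apply: whp_near; near=> n => w /=.
rewrite fctE /centred_sum sumrB -init_probE sumr_const_nat subSS subn0 natr_sum.
rewrite /= mulrBl -[init_prob m k *+ n]mulr_natr mulfK ?subrKC //.
by rewrite /= pnatr_eq0 -lt0n; near: n; exact: nbhs_infty_gt.
Unshelve. all: by end_near. Qed.

Lemma few_edges_whp K : mu < K%:R ->
  \forall nw \near whp P, (few_edges m nw.1 (K * nw.1) nw.2 : bool).
Proof.
move=> muK; have := init_sum_mean_cvg => /cvgr_lt /(_ _ muK) H.
have N0 : \forall nw \near whp P, (0 < nw.1)%N.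
  by apply: whp_near; near=> n => w /=; near: n; exact: nbhs_infty_gt.
near=> nw.
have n0 : (0 < nw.1)%N by near: nw.
rewrite /few_edges -(ler_nat R) natrM -ler_pdivrMr ?ltr0n //.
by apply: ltW; near: nw.
Unshelve. all: by end_near. Qed.

(* By the inequality of arithmetic and geometric means, the expectation of the
   summand of index t is O(t^(-1/2)). *)
Lemma dev_err_mean_cvg : dev_err (mw nw.2) mu nw.1 / nw.1%:R @[nw --> whp P] --> 0.
Proof.
have im := int_sq (@measurable_init (fun k => k%:R) 1%N) im2.
pose B := \int[P]_w ((1 + (m 1%N w)%:R) ^+ 2 : R).
pose V := centred_var (fun k => k%:R).
have iB1 : P.-integrable setT (EFin \o (fun w => ((1 + (m 1%N w)%:R) ^+ 2 : R))).
  rewrite (_ : EFin \o _ = (fun w => ((m 1%N w)%:R ^+ 2)%:E +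
   (2%:E * ((m 1%N w)%:R)%:E + (1 : R)%:E))%E).
    apply: integrableD => //; apply: integrableD => //; first exact: integrableZl.
    by apply: (@bounded_integrable _ _ _ P (cst 1) 1) => // w; rewrite /= normr1.
  by apply/funext => w /=; rewrite -!EFinM -!EFinD; congr EFin; ring.
have iB t : (1 <= t)%N -> P.-integrable setT (EFin \o (fun w => ((1 + (m t w)%:R) ^+ 2 : R))).
  by move=> t1; exact: (integrable_init (f := fun k => (1 + k%:R) ^+ 2)).
have [B0 V0] : 0 <= B /\ 0 <= V.
  split; last exact: centred_var_ge0.
  by apply: Rintegral_ge0 => w _; exact: sqr_ge0.
pose rt t : R := Num.sqrt t%:R.
have rt0 t : (1 <= t)%N -> 0 < rt t by move=> t1; rewrite sqrtr_gt0 ltr0n.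
have rt2 t : rt t ^+ 2 = t%:R by rewrite sqr_sqrtr // ler0n.
(* Weights in powers of [rt t] balance the two squares: the second moment of [cM t] is [t * V], so
   both terms have an expectation of order [(rt t)^-1]. *)
pose F t w : R := 2 * (rt t)^-1 * (1 + (m t w)%:R) ^+ 2 +
   (rt t ^+ 3)^-1 * cM t w ^+ 2.
have iF t : (1 <= t)%N -> P.-integrable setT (EFin \o F t) /\
    \int[P]_w F t w = (2 * B + V) * (rt t)^-1.
  move=> t1.
  have [iS ES] := @centred_sum_L2 (fun k => k%:R) im2 t.
  have i1 : P.-integrable setT (EFin \o (fun w => 2 * (rt t)^-1 * ((1 + (m t w)%:R) ^+ 2 : R))).
    rewrite (_ : EFin \o _ = (fun w => (2 * (rt t)^-1)%:E * ((1 + (m t w)%:R) ^+ 2)%:E)%E);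
      last by apply/funext.
    by apply: integrableZl => //; exact: iB.
  have iS' : P.-integrable setT (EFin \o (fun w => cM t w ^+ 2)).
    by rewrite (_ : (fun w => _) = (fun w => centred_sum (fun k => k%:R) t w ^+ 2)) //;
      apply/funext => w; rewrite dev_centred_sum.
  have i2 : P.-integrable setT (EFin \o (fun w => (rt t ^+ 3)^-1 * cM t w ^+ 2)).
    rewrite (_ : EFin \o _ = (fun w => ((rt t ^+ 3)^-1)%:E * (cM t w ^+ 2)%:E)%E);
      last by apply/funext.
    exact: integrableZl.
  split.
    rewrite (_ : EFin \o _ = (fun w => (2 * (rt t)^-1 * (1 + (m t w)%:R) ^+ 2)%:E +
      ((rt t ^+ 3)^-1 * cM t w ^+ 2)%:E)%E); last by apply/funext.
    exact: integrableD.
  rewrite RintegralD // !RintegralZl //; last exact: iB.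
  under [X in _ + _ * X]eq_Rintegral do rewrite dev_centred_sum.
  rewrite ES -/V (Rintegral_init (f := fun k => (1 + k%:R) ^+ 2)) // -/B -[t%:R]rt2.
  by have := rt0 t t1; move=> /lt0r_neq0 ?; field.
have FE t w : (1 <= t)%N ->
    (1 + (m t w)%:R) * (1 + (m t w)%:R + `|cM t w|) / t%:R <= F t w.
  move=> t1; have r0 := rt0 t t1; have r1 : 1 <= rt t.
    by rewrite -[leLHS]sqrtr1 ler_wsqrtr // ler1n.
  rewrite /F -(real_normK (num_real (cM t w))) -[t%:R]rt2; set y := `|cM t w|; set x := 1 + _.
  have x0 : 0 <= x by rewrite addr_ge0.
  have y0 : 0 <= y by exact: normr_ge0.
  set r := rt t in r0 r1 *.
  rewrite ler_pdivrMr ?exprn_gt0 //.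
  rewrite (_ : _ * r ^+ 2 = 2 * r * x ^+ 2 + r^-1 * y ^+ 2); last first.
    by move/lt0r_neq0: (r0) => ?; field.
  have : x * y <= r * x ^+ 2 + r^-1 * y ^+ 2.
    rewrite -(ler_pM2l r0) [leRHS](_ : _ = (r * x) ^+ 2 + y ^+ 2); last first.
      by move/lt0r_neq0: (r0) => ?; field.
    have : 0 <= (r * x - y) ^+ 2 by exact: sqr_ge0.
    have : 0 <= (r * x) * y by rewrite !mulr_ge0 // ltW.
    by nra.
  have : x ^+ 2 <= r * x ^+ 2 by rewrite ler_peMl ?sqr_ge0.
  by nra.
pose e n : R := (1 + V) * (rt n)^-1 + (\sum_(1 <= t < n.+1) (2 * B + V) * (rt t)^-1) / n%:R.
have mM t : measurable_fun setT (fun w => cM t w).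
  rewrite (_ : (fun w => _) = centred_sum (fun k => k%:R) t); first exact: measurable_centred_sum.
  by apply/funext => w; exact: dev_centred_sum.
have mErr n : measurable_fun setT (fun w => dev_err (mw w) mu n).
  apply: measurable_funD; first exact: measurableT_comp.
  apply: measurable_sum => t; apply: measurable_funM => //.
  apply: measurable_funM; first exact: (@measurable_init (fun k => 1 + k%:R)).
  apply: measurable_funD; first exact: (@measurable_init (fun k => 1 + k%:R)).
  exact: measurableT_comp.
apply: (@cvg_whp_markov _ _ _ P (fun n w => dev_err (mw w) mu n / n%:R) e).
- by move=> n; apply: measurable_funM.
- move=> n.
  case: n => [|n].
    rewrite integral0_eq ?lee_fin ?addr_ge0 ?mulr_ge0 ?addr_ge0 ?invr_ge0 //.
    + exact: sqrtr_ge0.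
    + by rewrite big_nil.
    by move=> w _; rewrite invr0 mulr0 normr0.
  have n0 : 0 < n.+1%:R :> R by rewrite ltr0n.
  have iSF : P.-integrable setT (EFin \o (fun w => \sum_(1 <= t < n.+2) F t w)).
    by apply: integrable_bigsum => t; rewrite mem_index_iota => /andP[/iF[]].
  have mcM : measurable_fun setT (fun w => `|cM n.+1 w|%:E).
    by apply/measurable_EFinP/measurableT_comp.
  have F0 t w : 0 <= F t w.
    by rewrite /F addr_ge0 // mulr_ge0 ?sqr_ge0 ?mulr_ge0 ?invr_ge0 ?exprn_ge0 ?sqrtr_ge0.
  apply: (@le_trans _ _ ((\int[P]_w `|cM n.+1 w|%:E +
      \int[P]_w (\sum_(1 <= t < n.+2) F t w)%:E) * n.+1%:R^-1%:E)%E).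
    rewrite -ge0_integralD //; last 2 first.
    + by move=> w _; rewrite lee_fin sumr_ge0.
    + by case/integrableP: iSF.
    rewrite -ge0_integralZr //; last 2 first.
    + by apply: emeasurable_funD => //; case/integrableP: iSF.
    + by move=> w _; rewrite adde_ge0 // lee_fin sumr_ge0.
    apply: ge0_le_integral => //.
    + by apply/measurable_EFinP/measurableT_comp => //; apply: measurable_funM => //.
    + apply: emeasurable_funM => //; apply: emeasurable_funD => //.
      by case/integrableP: iSF.
    move=> w _; rewrite -EFinD -EFinM lee_fin normrM [ `|n.+1%:R^-1| ]gtr0_norm ?invr_gt0 //.
    rewrite ler_pM2r ?invr_gt0 // ger0_norm; last first.
      exact: le_trans (normr_ge0 _) (dev_err_ge (mw w) mu n.+1).
    rewrite /dev_err lerD2l; apply: ler_sum_nat => t /andP[t1 _]; exact: FE.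
  have -> : (\int[P]_w (\sum_(1 <= t < n.+2) F t w)%:E =
      (\sum_(1 <= t < n.+2) (2 * B + V) * (rt t)^-1)%:E)%E.
    rewrite -[LHS]fineK; last exact: integrable_fin_num.
    rewrite -/(Rintegral _ _ _) Rintegral_sum; last first.
      by move=> t; rewrite mem_index_iota => /andP[/iF[]].
    by congr EFin; apply: eq_big_nat => t /andP[/iF[]].
  apply: (@le_trans _ _ (((rt n.+1 * (1 + V))%:E + _) * n.+1%:R^-1%:E)%E).
    rewrite lee_pmul2r ?lte_fin ?invr_gt0 //; apply: leeD; last exact: lexx.
    under eq_integral do rewrite dev_centred_sum.
    exact: centred_sum_L1.
  rewrite -EFinD -EFinM lee_fin mulrDl /e lerD2r.
  rewrite -[n.+1%:R]rt2 mulrAC mulrC.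
  by have /lt0r_neq0 ? := rt0 n.+1 isT; rewrite (_ : rt n.+1 / _ = (rt n.+1)^-1) //; field.
- have c1 : (1 + V) * (rt n)^-1 @[n --> \oo] --> (1 + V) * 0.
    by apply: cvgMr; exact: cvg_sqrt_inv.
  have c2 : (2 * B + V) * ((\sum_(1 <= t < n.+1) (rt t)^-1) / n%:R) @[n --> \oo]
      --> (2 * B + V) * 0.
    by apply: cvgMr; apply: mean_cvg; exact: cvg_sqrt_inv.
  rewrite (_ : e = (fun n => (1 + V) * (rt n)^-1) +
    (fun n => (2 * B + V) * ((\sum_(1 <= t < n.+1) (rt t)^-1) / n%:R))); last first.
    by apply/funext => n; rewrite fctE /e -mulr_sumr mulrA.
  by have := cvgD c1 c2; rewrite !mulr0 addr0; apply.
Unshelve. all: by end_near. Qed.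

End InitialDegrees.

(** * Law of large numbers for the degree counts *)

Lemma cvg_bigsum (R : realType) (I J : Type) (F : set_system J) (FF : Filter F)
    (r : seq I) (f : I -> J -> R) (l : I -> R) : (forall i, f i @ F --> l i) ->
  \sum_(i <- r) f i x @[x --> F] --> \sum_(i <- r) l i.
Proof.
move=> fl; elim: r => [|i r IH].
  by rewrite big_nil; under eq_fun do rewrite big_nil; exact: cvg_cst.
by rewrite big_cons; under eq_fun do rewrite big_cons; exact: cvgD.
Qed.

Lemma cvg_invn (R : realType) : n%:R^-1 @[n --> \oo] --> (0 : R).
Proof. by rewrite -cvg_shiftS; exact: cvg_harmonic. Qed.

Lemma norm_ge0_EFin d (T : measurableType d) (R : realType) (P : probability T R)
    (f : T -> R) C : P.-integrable setT (EFin \o f) -> (forall w, 0 <= f w) ->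
  \int[P]_w f w <= C -> (\int[P]_w `|f w|%:E <= C%:E)%E.
Proof.
move=> fi f0 fC; under eq_integral do rewrite ger0_norm //.
by rewrite -[leLHS]fineK ?lee_fin // integrable_fin_num.
Qed.

Section LawOfLargeNumbers.
Context d (T : measurableType d) (R : realType) (P : probability T R).
Variables (m : nat -> {RV P >-> nat}) (c : nat -> nat -> {RV P >-> nat}).
Variable delta : R.
Hypothesis delta_gt : -1 < delta.
Hypothesis m_pos : forall t w, (1 <= t)%N -> (1 <= m t w)%N.
Hypothesis m_iid : iid m.
Hypothesis m_moment2 : ('E_P[(fun w => (m 1%N w)%:R ^+ 2)%R] < +oo)%E.
Hypothesis model : is_PA m c delta.

Local Notation mw := (m_at m).
Local Notation cw := (c_at c).
Local Notation mu := (init_mean m).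

Let mw_gt0 w : forall t, (1 <= t)%N -> (1 <= mw w t)%N.
Proof. by move=> t; exact: m_pos. Qed.

Let cw_lt w t i : (2 <= t)%N -> (1 <= i <= mw w t)%N -> (cw w t i < t)%N.
Proof. exact: (PA_range model). Qed.

Let mu_ge1 : 1 <= mu := init_mean_ge1 m_moment2 m_pos.

(** An integer above [mu], so that with high probability there are at most [edge_rate * n] edges at
    time [n]. *)
Definition edge_rate : nat := Num.bound mu.

Lemma edge_rate_whp :
  \forall nw \near whp P, (few_edges m nw.1 (edge_rate * nw.1) nw.2 : bool).
Proof.
by apply: few_edges_whp => //; apply: archi_boundP; exact: le_trans mu_ge1.
Qed.

Section Fluctuations.
Variables (h : nat -> R) (C : R).
Hypothesis hC : forall k, `|h k| <= C.

Lemma norm_mart_PA_le k w n :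
  `|mart delta h k (PA (mw w) (cw w) n)| <= (2 * C) ^+ k * (init_sum (mw w) n)%:R.
Proof.
have C0 : 0 <= C := le_trans (normr_ge0 _) (hC 0%N).
case: n => [|[|n]].
- by rewrite /mart big_ord0 normr0 mulr_ge0 // exprn_ge0 // mulr_ge0.
- by rewrite mart_PA1 normr0 mulr_ge0 // exprn_ge0 // mulr_ge0.
- rewrite PA_midE //.
  have H := norm_mart_le delta_gt m_pos model hC k (w := w) (isT : (2 <= n.+2)%N) (leqnn _).
  apply: le_trans H _.
  by rewrite size_PA_mid // -init_sumS.
Qed.

Definition few_mart n w : R :=
  (few_edges m n (edge_rate * n) w)%:R * mart delta h 1 (PA (mw w) (cw w) n).

Lemma measurable_few_edges n L :
  measurable_fun setT (fun w => (few_edges m n L w)%:R : R).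
Proof.
rewrite (_ : (fun w => _) = fun w => (sumn (init_list m n w) <= L)%N%:R).
  exact: (cmeasurable_fun (fun s => (sumn s <= L)%N%:R : R) (cmeasurable_init_list m n)).
by apply/funext => w; rewrite init_list_sum.
Qed.

Lemma measurable_mart k n :
  measurable_fun setT (fun w => mart delta h k (PA (mw w) (cw w) n)).
Proof. exact: (cmeasurable_fun (mart delta h k) (cmeasurable_PA m c n)). Qed.

Lemma few_mart_L2 n :
  (\int[P]_w `|few_mart n w ^+ 2|%:E <= ((2 * C) ^+ 2 * (edge_rate * n)%:R)%:E)%E.
Proof.
have fE w : few_mart n w ^+ 2 = (few_edges m n (edge_rate * n) w)%:R *
    mart delta h 1 (PA (mw w) (cw w) n) ^+ 2.
  by rewrite exprMn; case: few_edges; rewrite ?expr1n ?expr0n.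
apply: norm_ge0_EFin; last 2 first.
- by move=> w; exact: sqr_ge0.
- under eq_Rintegral do rewrite fE.
  case: n {fE} => [|n]; last exact: (mart_L2 delta_gt m_pos model hC).
  rewrite muln0 mulr0 (_ : (fun w => _) = cst 0) ?Rintegral_cst ?mul0r //.
  by apply/funext => w; rewrite /mart big_ord0 expr0n mulr0.
apply: (@bounded_integrable _ _ _ P _ (((2 * C) * (edge_rate * n)%:R) ^+ 2)).
  apply: measurable_funX; apply: measurable_funM; first exact: measurable_few_edges.
  exact: measurable_mart.
have C0 : 0 <= C := le_trans (normr_ge0 _) (hC 0%N).
move=> w; rewrite normrX lerXn2r ?nnegrE ?normr_ge0 ?mulr_ge0 //.
rewrite /few_mart normrM; case: (boolP (few_edges m n _ w)) => few; last first.
  by rewrite normr0 mul0r !mulr_ge0.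
rewrite normr1 mul1r; apply: le_trans (norm_mart_PA_le 1 w n) _.
by rewrite expr1 ler_wpM2l ?mulr_ge0 // ler_nat.
Qed.

(** The truncated martingale has second moments of order [n], and it coincides with the martingale
    with high probability. *)
Lemma mart_tight :
  tight P (fun n w => mart delta h 1 (PA (mw w) (cw w) n) / Num.sqrt n%:R).
Proof.
apply: (@tight_whp _ _ _ _ _ (fun n w => few_mart n w / Num.sqrt n%:R)); last first.
  near=> nw; rewrite /few_mart.
  have -> : few_edges m nw.1 (edge_rate * nw.1) nw.2 by near: nw; exact: edge_rate_whp.
  by rewrite mul1r.
apply: (@tight_L2 _ _ _ _ _ ((2 * C) ^+ 2 * edge_rate%:R)).
  move=> n; apply: measurable_funM => //.
  by apply: measurable_funM; [exact: measurable_few_edges|exact: measurable_mart].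
have C0 : 0 <= C := le_trans (normr_ge0 _) (hC 0%N).
case=> [|n].
  under eq_integral do rewrite sqrtr0 invr0 mulr0 expr0n /=.
  by rewrite integral0 lee_fin mulr_ge0 // exprn_ge0 // mulr_ge0.
have n0 : 0 < n.+1%:R :> R by rewrite ltr0n.
have -> : (\int[P]_w ((few_mart n.+1 w / Num.sqrt n.+1%:R) ^+ 2)%:E =
   \int[P]_w (`|few_mart n.+1 w ^+ 2|%:E * n.+1%:R^-1%:E))%E.
  apply: eq_integral => w _; rewrite -EFinM ger0_norm ?sqr_ge0 //; congr EFin.
  by rewrite exprMn exprVn sqr_sqrtr // ltW.
have mf : measurable_fun setT (fun w => `|few_mart n.+1 w ^+ 2|%:E).
  apply/measurable_EFinP; apply: measurableT_comp => //; apply: measurable_funX.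
  by apply: measurable_funM; [exact: measurable_few_edges|exact: measurable_mart].
rewrite (ge0_integralZr _ measurableT mf) //.
apply: (@le_trans _ _ (((2 * C) ^+ 2 * (edge_rate * n.+1)%:R)%:E * n.+1%:R^-1%:E)%E).
  by rewrite lee_pmul2r ?lte_fin ?invr_gt0 //; exact: few_mart_L2.
by rewrite -EFinM lee_fin natrM mulrA mulfK // gt_eqF.
Unshelve. all: by end_near. Qed.

Lemma mart_mean_cvg0 :
  mart delta h 1 (PA (mw nw.2) (cw nw.2) nw.1) / nw.1%:R @[nw --> whp P] --> 0.
Proof.
have H := tight_mul_cvg0 (Y := fun n _ => (Num.sqrt n%:R)^-1) mart_tight
  (cvg_whp_cst P (@cvg_sqrt_inv R)).
apply: cvg_trans H; apply: near_eq_cvg; near=> nw => /=.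
by rewrite -mulrA -invfM -expr2 sqr_sqrtr.
Unshelve. all: by end_near. Qed.

End Fluctuations.

(* mu q_k = rate k * p_k is the limiting frequency of the degree k among the
   degrees of the chosen vertices. *)
Definition rate k : R := (k%:R + delta) * (mu / (2 * mu + delta)).

Definition frac_mean k n w : R :=
  (\sum_(2 <= t < n.+1) deg_frac (mw w) (cw w) R k t) / n%:R.

(** The martingale is applied to the indicator of degree [k]. Its compensator at one step is
    [k + delta] times the number of vertices of degree [k] over the total weight, which [drift_frac]
    sums up. *)
Lemma chosen_count_frac k :
  (chosen_count (mw nw.2) (cw nw.2) nw.1 k)%:R / nw.1%:R - rate k * frac_mean k nw.1 nw.2
    @[nw --> whp P] --> 0.
Proof.
pose h j : R := (j == k)%:R.
have h1 j : `|h j| <= 1 by rewrite /h; case: eqP; rewrite ?normr1 ?normr0.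
have M0 := mart_mean_cvg0 h1.
pose K := `|k%:R + delta| * (5 * mu / (1 + delta) + 2).
have bound : `|mart delta h 1 (PA (mw nw.2) (cw nw.2) nw.1) / nw.1%:R| +
   K * (dev_err (mw nw.2) mu nw.1 / nw.1%:R) @[nw --> whp P] --> 0.
  rewrite -[X in _ --> X]addr0 -[X in _ --> X + _](normr0 R) -[X in _ --> _ + X](mulr0 K).
  apply: cvgD; first exact: cvg_norm.
  by apply: cvgMr; exact: dev_err_mean_cvg.
apply: cvg0_norm_le bound; apply: whp_near; exists 1%N => // n /= n1 w.
have n0 : 0 < n%:R :> R by rewrite ltr0n.
have -> : (chosen_count (mw w) (cw w) n k)%:R =
   mart delta h 1 (PA (mw w) (cw w) n) +
   (k%:R + delta) * edge_sum (mw w) n (fun t i =>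
     (\sum_(v < t) (deg (PA_mid (mw w) (cw w) t i.-1) v == k))%N%:R /
       total_weight (mw w) (cw w) t i.-1 delta).
  rewrite chosen_countE mart_edge_sum // -edge_sumZ -edge_sumD.
  apply: eq_edge_sum => t i tn im; rewrite expr1 /incr /hmean /=.
  rewrite -[LHS](subrK (\sum_(v < t) wt delta (PA_mid (mw w) (cw w) t i.-1) v /
   tot delta (PA_mid (mw w) (cw w) t i.-1) t * h (deg (PA_mid (mw w) (cw w) t i.-1) v))).
  congr (_ + _); rewrite natr_sum mulr_suml mulr_sumr; apply: eq_bigr => v _.
  rewrite /h; case: eqP => [kE|_]; last by rewrite !mulr0 mul0r mulr0.
  by rewrite /wt kE mulr1 mul1r.
set E := edge_sum _ _ _; set M := mart _ _ _ _.
rewrite /frac_mean; set S := \sum_(2 <= t < n.+1) _.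
have D : `|E - mu / (2 * mu + delta) * S| <= (5 * mu / (1 + delta) + 2) * dev_err (mw w) mu n.
  exact: (drift_frac (mw_gt0 w) (@cw_lt w)).
have -> : (M + (k%:R + delta) * E) / n%:R - rate k * (S / n%:R) =
   M / n%:R + (k%:R + delta) * (E - mu / (2 * mu + delta) * S) / n%:R.
  by rewrite /rate; ring.
apply: le_trans (ler_normD _ _) _; rewrite lerD2l.
rewrite !normrM normfV (gtr0_norm n0) mulrA ler_pM2r ?invr_gt0 //.
by rewrite /K -[leRHS]mulrA ler_wpM2l.
Unshelve. all: by end_near. Qed.

Lemma measurable_frac k t : measurable_fun setT (fun w => deg_frac (mw w) (cw w) R k t).
Proof.
exact: (cmeasurable_fun (fun G => (\sum_(v < t.-1.+1) (deg G v == k))%N%:R / t%:R : R)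
  (cmeasurable_PA m c t.-1)).
Qed.

Variable p : nat -> R.
Hypothesis p_def : limit_degrees mu (init_prob m) delta p.

Let s_gt0 : 0 < 2 * mu + delta.
Proof. have := mu_ge1; have := delta_gt; lra. Qed.

Lemma rate_ge0 k : (1 <= k)%N -> 0 <= rate k.
Proof.
move=> k1; have m1 := mu_ge1; have d1 := delta_gt.
have : 1 <= k%:R :> R by rewrite ler1n.
by move=> k1r; rewrite mulr_ge0 ?divr_ge0 ?(ltW s_gt0) //; lra.
Qed.

Lemma limit_degreesS k : p k.+1 = rate k * p k - rate k.+1 * p k.+1 + init_prob m k.+1.
Proof.
have [_ /(_ k.+1 isT)] := p_def => /= {1}->.
have m0 : mu != 0 by rewrite gt_eqF // (lt_le_trans ltr01).
have s0 := lt0r_neq0 s_gt0.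
have -> : theta mu delta = (2 * mu + delta) / mu by rewrite /theta; field.
rewrite /rate -natr1; congr (_ - _ + _); field; by rewrite m0 s0.
Qed.

(** Induction on [k]. The compensators involve running averages of the frequencies, so the balance
    of [deg_countE] becomes a linear recursion for the running sum [B]. It is contracting up to
    [eps], which is bounded and vanishes in probability; hence [B n] is at most a constant plus the
    sum of the [|eps j|], whose mean is negligible compared with [n]. *)
Lemma frac_mean_cvg k : frac_mean k nw.1 nw.2 @[nw --> whp P] --> p k.
Proof.
elim: k => [|k IH].
  have [-> _] := p_def.
  suff E0 n w : frac_mean 0 n w = 0.
    apply: (@cvg0_norm_le _ _ _ _ _ (fun=> 0)); last exact: cvg_cst.
    by apply: nearW => nw; rewrite E0 normr0.
  rewrite /frac_mean big_nat big1 ?mul0r // => t /andP[t2 _].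
  rewrite /deg_frac /deg_count big1 ?mul0r // => v _; apply/eqP; rewrite eqb0 -lt0n.
  have t1 : (1 <= t.-1)%N by lia.
  have vt : (v <= t.-1)%N by rewrite -ltnS ltn_ord.
  exact: (deg_PA_gt0 (mw_gt0 w) (@cw_lt w) t1 vt).
set ck := rate k.+1; have ck0 : 0 <= ck by exact: rate_ge0.
set pk := p k.+1.
pose fr n w := deg_frac (mw w) (cw w) R k.+1 n.
have fr01 n w : (1 <= n)%N -> 0 <= fr n w <= 1 by move=> n1; exact: deg_frac_bounds.
pose B n w := \sum_(2 <= t < n.+1) (fr t w - pk).
(* The defect in the balance between the current frequency and the averaged outflow, both centred at
   the limit. *)
pose eps n w := fr n.+1 w - pk + ck * (B n w / n%:R).
pose D := 1 + `|pk|.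
have frD n w : (1 <= n)%N -> `|fr n w - pk| <= D.
  move=> n1; have /andP[f0 f1] := fr01 n w n1.
  by apply: le_trans (ler_normB _ _) _; rewrite lerD2r ger0_norm.
have BD n w : `|B n w| <= D * n%:R.
  apply: le_trans (ler_norm_sum _ _ _) _.
  apply: (@le_trans _ _ (\sum_(2 <= t < n.+1) D)).
    by apply: ler_sum_nat => t /andP[t2 _]; apply: frD; lia.
  rewrite sumr_const_nat -[leLHS]mulr_natr ler_wpM2l ?addr_ge0 // ler_nat; lia.
have mfr n : measurable_fun setT (fr n) by exact: measurable_frac.
have mB n : measurable_fun setT (B n).
  by apply: measurable_sum => t; exact: measurable_funB.
have meps n : measurable_fun setT (eps n).
  apply: measurable_funD; first exact: measurable_funB.
  by apply: measurable_funM => //; exact: measurable_funM.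
have epsD n w : `|eps n w| <= D + ck * D.
  apply: le_trans (ler_normD _ _) _; rewrite lerD ?frD // normrM (ger0_norm ck0) ler_wpM2l //.
  case: n => [|n]; first by rewrite invr0 mulr0 normr0 addr_ge0.
  by rewrite normrM normfV [ `|n.+1%:R| ]ger0_norm // ler_pdivrMr // ltr0n.
have Bmean n w : (1 <= n)%N -> B n w / n%:R = frac_mean k.+1 n w - pk + pk * n%:R^-1.
  move=> n1; have n0 : n%:R != 0 :> R by rewrite pnatr_eq0; lia.
  rewrite /B sumrB sumr_const_nat subSS mulrBl -/(frac_mean k.+1 n w).
  rewrite -[pk *+ _]mulr_natr natrB //; by field.
have invn : (nw.1%:R^-1 : R) @[nw --> whp P] --> 0.
  apply: (@cvg_whp_cst _ _ _ P (fun n => n%:R^-1)).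
  exact: cvg_invn.
have eps0 : eps nw.1 nw.2 @[nw --> whp P] --> 0.
  have H1 := chosen_count_frac k; have H2 := chosen_count_frac k.+1.
  have H3 := init_count_mean_cvg m_iid (k := k.+1).
  pose U (nw : nat * T) : R := `|nw.1%:R^-1| + `|nw.1%:R^-1| +
    `|(\sum_(1 <= t < nw.1.+1) (k.+1 == m t nw.2)%N)%:R / nw.1%:R - init_prob m k.+1| +
    `|(chosen_count (mw nw.2) (cw nw.2) nw.1 k)%:R / nw.1%:R - rate k * frac_mean k nw.1 nw.2| +
    `|rate k| * `|frac_mean k nw.1 nw.2 - p k| +
    `|(chosen_count (mw nw.2) (cw nw.2) nw.1 k.+1)%:R / nw.1%:R - rate k.+1 * frac_mean k.+1 nw.1 nw.2| +
    `|ck * pk| * `|nw.1%:R^-1|.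
  have U0 : U nw @[nw --> whp P] --> 0.
    have Z : 0 = `|0 : R| + `|0 : R| + `|init_prob m k.+1 - init_prob m k.+1| + `|0 : R|
      + `|rate k| * `|p k - p k| + `|0 : R| + `|ck * pk| * `|0 : R|.
      by rewrite !subrr !normr0 !mulr0 !addr0.
    rewrite [X in _ --> X]Z /U.
    apply: cvgD; last by apply: cvgMr; exact: cvg_norm.
    apply: cvgD; last by apply: cvg_norm; exact: H2.
    apply: cvgD; last by apply: cvgMr; apply: cvg_norm; apply: cvgB; [exact: IH|exact: cvg_cst].
    apply: cvgD; last by apply: cvg_norm; exact: H1.
    apply: cvgD; last by apply: cvg_norm; apply: cvgB; [exact: H3|exact: cvg_cst].
    by apply: cvgD; exact: cvg_norm.
  apply: cvg0_norm_le U0; apply: whp_near; exists 1%N => // n /= n1 w.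
  have n0 : n%:R != 0 :> R by rewrite pnatr_eq0; lia.
  rewrite /eps Bmean //.
  have := deg_countE (@cw_lt w) n1 (ltn0Sn k) => /= /(congr1 (fun x => x%:R : R)).
  rewrite !natrD => dE.
  have f1 := fr01 n.+1 w isT.
  (* There are [n.+1] vertices at time [n] but the averages are divided by [n]; the first term of
     [dE'] makes up for the difference. *)
  have frE : (deg_count (mw w) (cw w) n k.+1)%:R = fr n.+1 w * (n%:R + 1).
    by rewrite natr1 /fr /deg_frac divfK // pnatr_eq0.
  have dE' : fr n.+1 w = - fr n.+1 w / n%:R + (mw w 1 == k.+1)%:R / n%:R +
     (\sum_(1 <= t < n.+1) (k.+1 == m t w)%N)%:R / n%:R +
     (chosen_count (mw w) (cw w) n k)%:R / n%:R - (chosen_count (mw w) (cw w) n k.+1)%:R / n%:R.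
    apply: (mulIf n0); move: dE; rewrite frE => dE.
    transitivity (fr n.+1 w * (n%:R + 1) - fr n.+1 w); first by ring.
    have -> : fr n.+1 w * (n%:R + 1) =
       fr n.+1 w * (n%:R + 1) + (chosen_count (mw w) (cw w) n k.+1)%:R
       - (chosen_count (mw w) (cw w) n k.+1)%:R by ring.
    by rewrite dE; field.
  have pE := limit_degreesS k; rewrite -/pk -/ck in pE.
  rewrite (_ : fr n.+1 w - pk + ck * (frac_mean k.+1 n w - pk + pk / n%:R) =
    - (fr n.+1 w * n%:R^-1) + (mw w 1 == k.+1)%:R * n%:R^-1 +
    ((\sum_(1 <= t < n.+1) (k.+1 == m t w)%N)%:R / n%:R - init_prob m k.+1) +
    ((chosen_count (mw w) (cw w) n k)%:R / n%:R - rate k * frac_mean k n w) +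
    rate k * (frac_mean k n w - p k) -
    ((chosen_count (mw w) (cw w) n k.+1)%:R / n%:R - ck * frac_mean k.+1 n w) +
    ck * pk * n%:R^-1); last by rewrite {1}dE' {1}pE; ring.
  rewrite /U /=.
  have L1 : `|- (fr n.+1 w * n%:R^-1)| <= `|n%:R^-1|.
    by rewrite normrN normrM ler_piMl //; case/andP: f1 => ? ?; rewrite ger0_norm.
  have L2 : `|(mw w 1 == k.+1)%:R * n%:R^-1| <= `|n%:R^-1| :> R.
    by rewrite normrM ler_piMl //; case: eqP; rewrite ?normr1 ?normr0.
  do 4!(apply: le_trans (ler_normD _ _) _; apply: lerD; last by rewrite ?normrN ?normrM).
  apply: le_trans (ler_normD _ _) _; apply: lerD => //.
  by apply: le_trans (ler_normD _ _) _; apply: lerD.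
(* Being bounded, [eps] also tends to 0 in mean, and therefore so do its Cesaro averages. *)
have Eeps := cvg_whp_bounded meps epsD eps0.
pose N0 := (Num.bound ck).+1.
(* B n.+1 = (1 - ck / n) B n + eps n, where 0 <= ck / n <= 1 *)
have BS n w : (N0 <= n)%N -> `|B n.+1 w| <= `|B n w| + `|eps n w|.
  move=> nN; have n1 : (1 <= n)%N by apply: leq_trans nN.
  have n0 : 0 < n%:R :> R by rewrite ltr0n.
  have -> : B n.+1 w = (1 - ck / n%:R) * B n w + eps n w.
    rewrite /eps {1}/B big_nat_recr //= -/(B n w).
    by ring.
  apply: le_trans (ler_normD _ _) _; rewrite lerD2r normrM ler_piMl //.
  have : ck / n%:R <= 1.
    rewrite ler_pdivrMr // mul1r; apply: le_trans (ltW (archi_boundP ck0)) _.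
    by rewrite ler_nat; apply: leq_trans nN.
  have : 0 <= ck / n%:R by rewrite divr_ge0 // ltW.
  by rewrite ler_norml => *; apply/andP; split; lra.
have D0 : 0 <= D by rewrite addr_ge0.
have Bsum' n w : `|B n w| <= D * N0%:R + \sum_(1 <= j < n) `|eps j w|.
  elim: n => [|n IHn].
    rewrite big_geq // addr0; apply: le_trans (BD _ _) _; exact: ler_wpM2l.
  have [nN|Nn] := ltnP n N0.
    apply: le_trans (BD _ _) _; apply: (@le_trans _ _ (D * N0%:R)).
      by rewrite ler_wpM2l // ler_nat.
    by rewrite lerDl sumr_ge0.
  apply: le_trans (BS _ _ Nn) _; apply: le_trans (lerD IHn (lexx _)) _.
  by rewrite -addrA lerD2l [leRHS]big_nat_recr //; apply: leq_trans Nn.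
have Bsum n w : `|B n w| <= D * N0%:R + \sum_(1 <= j < n.+1) `|eps j w|.
  apply: le_trans (Bsum' n w) _; rewrite lerD2l.
  by case: n => [|n]; [rewrite !big_geq|rewrite [leRHS]big_nat_recr //= lerDl].
have Bmean0 : B nw.1 nw.2 / nw.1%:R @[nw --> whp P] --> 0.
  have Isum n : P.-integrable setT (EFin \o (fun w => D * N0%:R + \sum_(1 <= j < n.+1) `|eps j w|)).
    apply: (@bounded_integrable _ _ _ P _ (D * N0%:R + \sum_(1 <= j < n.+1) (D + ck * D))).
      by apply: measurable_funD => //; apply: measurable_sum => j; exact: measurableT_comp.
    move=> w; rewrite ger0_norm ?lerD2l; last by rewrite addr_ge0 ?mulr_ge0 ?sumr_ge0.
    by apply: ler_sum => j _; exact: epsD.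
  pose e n : R := D * N0%:R * n%:R^-1 + (\sum_(1 <= j < n.+1) \int[P]_w `|eps j w|) / n%:R.
  apply: (@cvg_whp_markov _ _ _ P (fun n w => B n w / n%:R) e).
  - by move=> n; exact: measurable_funM.
  - move=> n.
    have -> : (\int[P]_w `|B n w / n%:R|%:E = \int[P]_w `| `|B n w| / n%:R|%:E)%E.
      by apply: eq_integral => w _; rewrite !normrM normr_id.
    have iB : P.-integrable setT (EFin \o (fun w => `|B n w| / n%:R)).
      apply: (@bounded_integrable _ _ _ P _ (D * n%:R / n%:R)).
        by apply: measurable_funM => //; exact: measurableT_comp.
      by move=> w; rewrite normrM normr_id [ `|n%:R^-1| ]ger0_norm ?invr_ge0 // ler_wpM2r ?invr_ge0.
    apply: norm_ge0_EFin => //.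
    have ie j : P.-integrable setT (EFin \o (fun w => `|eps j w|)).
      apply: (@bounded_integrable _ _ _ P _ (D + ck * D)); first exact: measurableT_comp.
      by move=> w; rewrite normr_id.
    have -> : e n = \int[P]_w ((D * N0%:R + \sum_(1 <= j < n.+1) `|eps j w|) / n%:R).
      rewrite RintegralZr // RintegralD //; last 2 first.
      + by apply: (@bounded_integrable _ _ _ P (cst (D * N0%:R)) (D * N0%:R)) => // w;
          rewrite /= ger0_norm // mulr_ge0.
      + by apply: integrable_bigsum => j _; exact: ie.
      rewrite Rintegral_sum; last by move=> j _; exact: ie.
      rewrite Rintegral_cst // [fine _](_ : _ = 1) ?mulr1 /e -?mulrDl //.
      by rewrite -[RHS]/(fine 1%E) -(probability_setT P).
    apply: le_Rintegral => //.
      rewrite (_ : EFin \o _ = (fun w => (D * N0%:R + \sum_(1 <= j < n.+1) `|eps j w|)%:E *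
        n%:R^-1%:E)%E); last by apply/funext.
      by apply: integrableZr => //; exact: Isum.
    by move=> w _; rewrite ler_wpM2r ?invr_ge0.
  - rewrite -[X in _ --> X]addr0 -[X in _ --> X + _](mulr0 (D * N0%:R)).
    apply: cvgD; first by apply: cvgMr; exact: cvg_invn.
    exact: mean_cvg.
have H : B nw.1 nw.2 / nw.1%:R + pk - pk * nw.1%:R^-1 @[nw --> whp P] --> 0 + pk - pk * 0.
  apply: cvgB; last by apply: cvgMr.
  by apply: cvgD => //; exact: cvg_cst.
rewrite mulr0 subr0 add0r in H.
apply: cvg_trans H; apply: near_eq_cvg; apply: whp_near; exists 1%N => // n /= n1 w.
by rewrite Bmean //; ring.
Unshelve. all: by end_near. Qed.

(** The sign of [p], like its total mass below, is read off from the frequencies that converge to it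
    rather than from the recursion. *)
Lemma limit_degrees_ge0 k : 0 <= p k.
Proof.
apply: (cvgr_to_ge (@frac_mean_cvg k)); apply: whp_near; near=> n => w /=.
rewrite divr_ge0 // big_nat sumr_ge0 // => t /andP[t2 _].
by have /andP[] := deg_frac_bounds (mw w) (cw w) R k (ltnW t2).
Unshelve. all: by end_near. Qed.

Lemma sum_limit_degrees_le1 K : \sum_(1 <= k < K) p k <= 1.
Proof.
have H : \sum_(1 <= k < K) frac_mean k nw.1 nw.2 @[nw --> whp P] --> \sum_(1 <= k < K) p k.
  by apply: cvg_bigsum => k; exact: frac_mean_cvg.
apply: (cvgr_to_le H); apply: whp_near; exists 1%N => // n /= n1 w.
rewrite /frac_mean -mulr_suml ler_pdivrMr ?ltr0n // mul1r exchange_big /=.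
apply: (@le_trans _ _ (\sum_(2 <= t < n.+1) 1)).
  by apply: ler_sum_nat => t /andP[t2 _]; apply: sum_deg_frac_le1; exact: ltnW.
by rewrite sumr_const_nat ler_nat; lia.
Unshelve. all: by end_near. Qed.

Lemma chosen_count_mean_cvg k :
  (chosen_count (mw nw.2) (cw nw.2) nw.1 k)%:R / nw.1%:R @[nw --> whp P] --> rate k * p k.
Proof.
have H : ((chosen_count (mw nw.2) (cw nw.2) nw.1 k)%:R / nw.1%:R -
    rate k * frac_mean k nw.1 nw.2) + rate k * frac_mean k nw.1 nw.2
    @[nw --> whp P] --> 0 + rate k * p k.
  by apply: cvgD; [exact: chosen_count_frac|apply: cvgMr; exact: frac_mean_cvg].
rewrite add0r in H; apply: cvg_trans H; apply: near_eq_cvg; near=> nw.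
by rewrite subrK.
Unshelve. all: by end_near. Qed.

End LawOfLargeNumbers.

(** * Convergence in distribution from trigonometric averages *)

Section Bernstein.
Variable R : realType.
Implicit Types (g h : nat -> R) (s : R).

(* [bern n g] is the Bernstein polynomial with control values [g 0, .., g n];
   the recursion is Pascal's rule. *)
Fixpoint bern n g s : R :=
  if n is n'.+1 then s * bern n' (g \o S) s + (1 - s) * bern n' g s else g 0%N.

Lemma bern_le n g h s : 0 <= s <= 1 -> (forall k, (k <= n)%N -> g k <= h k) ->
  bern n g s <= bern n h s.
Proof.
move=> /andP[s0 s1]; elim: n g h => [|n IH] g h gh /=; first exact: gh.
apply: lerD; apply: ler_wpM2l; rewrite ?subr_ge0 //; apply: IH => k kn.
  exact: gh.
by apply: gh; exact: leqW.
Qed.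

Lemma bern_cst n a s : bern n (fun=> a) s = a.
Proof. by elim: n => //= n ->; ring. Qed.

Lemma bern_linear n a g h s :
  bern n (fun k => a * g k + h k) s = a * bern n g s + bern n h s.
Proof. by elim: n g h => //= n IH g h; rewrite !IH; ring. Qed.

(** The second moment about [a] of a binomial variable, of mean [n * s] and variance
    [n * s * (1 - s)]. *)
Lemma bern_sq n a s : bern n (fun k => (k%:R - a) ^+ 2) s =
  (n%:R * s - a) ^+ 2 + n%:R * s * (1 - s).
Proof.
elim: n a => [|n IH] a /=; first by ring.
rewrite [X in s * bern n X s](_ : _ = (fun k => (k%:R - (a - 1)) ^+ 2)); last first.
  by apply/funext => k /=; rewrite -natr1; ring.
by rewrite !IH -natr1; ring.
Qed.

(** Averaging the quadratic majorant produces the binomial variance, which after scaling is at most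
    [D / n]; monotonicity of [bern] does the rest. *)
Lemma bern_approx n g s y e D : (0 < n)%N -> 0 <= s <= 1 -> 0 <= D ->
  (forall k, (k <= n)%N -> `|g k - y| <= e + D * (k%:R / n%:R - s) ^+ 2) ->
  `|bern n g s - y| <= e + D / n%:R.
Proof.
move=> n0 s01 D0 gy; have nR : 0 < n%:R :> R by rewrite ltr0n.
have n00 : n%:R != 0 :> R by rewrite gt_eqF.
pose h (k : nat) : R := D / n%:R ^+ 2 * (k%:R - n%:R * s) ^+ 2 + e.
have hE : bern n h s <= e + D / n%:R.
  rewrite bern_linear bern_cst bern_sq subrr expr0n /= add0r addrC lerD2l.
  have -> : D / n%:R ^+ 2 * (n%:R * s * (1 - s)) = D / n%:R * (s * (1 - s)).
    by field.
  apply: ler_piMr; first by rewrite divr_ge0 // ltW.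
  by case/andP: s01 => s0 s1; nra.
have gh k : (k <= n)%N -> `|g k - y| <= h k.
  move=> /gy /le_trans -> //; rewrite le_eqVlt; apply/orP; left; apply/eqP.
  by rewrite /h; field.
have gu : bern n g s <= 1 * bern n h s + y.
  rewrite -[y in X in _ <= X](bern_cst n y s) -bern_linear.
  apply: bern_le => // k kn; rewrite mul1r.
  by have := gh _ kn; rewrite ler_norml => /andP[_ +]; lra.
have gl : -1 * bern n h s + y <= bern n g s.
  rewrite -[y in X in X <= _](bern_cst n y s) -bern_linear.
  apply: bern_le => // k kn; rewrite mulN1r.
  by have := gh _ kn; rewrite ler_norml => /andP[+ _]; lra.
by rewrite ler_norml; apply/andP; split; lra.
Qed.

End Bernstein.

(** * Trigonometric approximation on a compact interval *)

Section WeierstrassTrig.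
Variable R : realType.

(** For [|x| <= K] the argument of the sine stays in [[- pi / 4, pi / 4]], well inside the range
    where [asin] inverts it, so [f] is there a continuous function [h] of [s x]. The bound [M]
    persists on the whole line because Bernstein polynomials average the control values. *)
Lemma bern_sine_approx (f : R -> R) (M K e : R) : continuous f -> 0 < K ->
  0 < e -> (forall x, `|f x| <= M) ->
  exists n g, let p x := bern n g ((1 + sin (pi / (4 * K) * x)) / 2) in
    (forall x, `|p x| <= M) /\ (forall x, `|x| <= K -> `|p x - f x| <= 2 * e).
Proof.
move=> cf K0 e0 fM; pose v : R := pi / (4 * K).
have v0 : 0 < v by rewrite divr_gt0 ?pi_gt0 ?mulr_gt0.
pose s x : R := (1 + sin (v * x)) / 2.
pose h (y : R) : R := f (asin (2 * y - 1) / v).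
have s01 x : 0 <= s x <= 1.
  by rewrite /s; have := sin_geN1 (v * x); have := sin_le1 (v * x); lra.
have vK x : `|x| <= K -> - (pi / 4) <= v * x <= pi / 4.
  move=> xK; rewrite -ler_norml normrM (gtr0_norm v0).
  apply: le_trans (ler_wpM2l (ltW v0) xK) _.
  by rewrite /v le_eqVlt; apply/orP; left; apply/eqP; field; rewrite gt_eqF.
have pi0 := pi_gt0 R.
have sE x : 2 * s x - 1 = sin (v * x) by rewrite /s; field.
have hs x : `|x| <= K -> h (s x) = f x.
  move=> xK; rewrite /h sE sinK; last by have := vK _ xK; rewrite in_itv /=; lra.
  by rewrite mulrC mulKf ?gt_eqF.
have ch x : `|x| <= K -> {for s x, continuous h}.
  move=> xK; apply: continuous_comp; last exact: cf.
  have cA : {for s x, continuous (fun y : R => asin (2 * y - 1))}.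
    apply: (@continuous_comp _ _ _ (fun y : R => 2 * y - 1) (@asin R) (s x)).
      by apply: cvgB; [apply: cvgM; [exact: cvg_cst|exact: cvg_id]|exact: cvg_cst].
    apply: continuous_asin; rewrite sE.
    have vx := vK _ xK.
    have c0 : 0 < cos (v * x) by apply: cos_gt0_pihalf; lra.
    have := cos2Dsin2 (v * x); nra.
  by apply: cvgM; [exact: cA|exact: cvg_cst].
have cs : continuous s.
  move=> x; apply: cvgM; last exact: cvg_cst.
  apply: cvgD; first exact: cvg_cst.
  apply: (@continuous_comp _ _ _ (fun y => v * y) sin).
    by apply: cvgM; [exact: cvg_cst|exact: cvg_id].
  exact: continuous_sin.
(* The control points are not confined to the image of [[- K, K]], so uniformity is needed for [x]
   in the interval and arbitrary [y] near [s x]; compactness turns continuity of [h] at the points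
   [s x] into this. *)
have [dl dl0 Hd] : exists2 dl, 0 < dl & forall x, `|x| <= K -> forall y,
    `|y - s x| < dl -> `|h y - f x| <= e.
  have := @segment_compact _ (- K) K; rewrite compact_near_coveringP.
  move=> /(_ R (0 : R)^'+ (fun dl x => forall y, `|y - s x| < dl ->
    `|h y - f x| <= e)) H.
  have {}H : \forall dl \near (0 : R)^'+, forall x, `[- K, K]%classic x ->
      forall y, `|y - s x| < dl -> `|h y - f x| <= e.
    apply: H => x0; rewrite /= in_itv /= -ler_norml => xK.
    have e2 : 0 < e / 2 by rewrite divr_gt0.
    have /cvgrPdist_le/(_ _ e2)[rho /= rho0 Hrho] := ch _ xK.
    have rho2 : 0 < rho / 2 by rewrite divr_gt0.
    have /cvgrPdist_lt/(_ _ rho2) Hs := cs x0.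
    have /cvgrPdist_le/(_ _ e2) Hf := cf x0.
    near=> x dl => y /= ysx.
    have h1 : `|h (s x0) - h y| <= e / 2.
      apply: Hrho => /=.
      have a1 : `|s x0 - s x| < rho / 2 by near: x.
      have a2 : dl < rho / 2 by near: dl; exact: nbhs_right_lt.
      have := ler_distD (s x) (s x0) y; rewrite (distrC (s x) y); lra.
    have h2 : `|f x0 - f x| <= e / 2 by near: x.
    have := ler_distD (f x0) (h y) (f x); rewrite (distrC (h y)) -(hs x0) //.
    by rewrite (distrC (h y)) distrC (hs x0) //; rewrite (hs x0) // in h1; lra.
  near (0 : R)^'+ => dl; exists dl => //.
  move=> x xK; suff: forall x, `[- K, K]%classic x ->
      forall y, `|y - s x| < dl -> `|h y - f x| <= e.
    by apply; rewrite /= in_itv /= -ler_norml.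
  by near: dl.
have M0 : 0 <= M := le_trans (normr_ge0 _) (fM 0).
(* the grid size that makes the variance term 2M/(dl^2 n) at most e *)
pose D := 2 * M / dl ^+ 2.
have D0 : 0 <= D by rewrite divr_ge0 ?sqr_ge0 // mulr_ge0.
pose n := (Num.truncn (D / e)).+1.
have nR : 0 < n%:R :> R by rewrite ltr0n.
have Dn : D / n%:R <= e.
  rewrite ler_pdivrMr // mulrC -ler_pdivrMr // ltW //.
  by rewrite truncnS_gt.
exists n, (fun k => h (k%:R / n%:R)); split => x.
  rewrite ler_norml; apply/andP; split.
    rewrite -[X in X <= _](bern_cst n (- M) (s x)).
    by apply: bern_le (s01 x) _ => // k _; have := fM (asin (2 * (k%:R / n%:R) - 1) / v);
      rewrite ler_norml => /andP[].
  rewrite -[X in _ <= X](bern_cst n M (s x)).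
  by apply: bern_le (s01 x) _ => // k _; have := fM (asin (2 * (k%:R / n%:R) - 1) / v);
      rewrite ler_norml => /andP[].
move=> xK.
apply: le_trans (_ : e + D / n%:R <= _).
  apply: (bern_approx _ (s01 x) D0) => // k kn.
  (* Close to [s x] the modulus [e] applies; elsewhere the crude bound [2 * M] is absorbed by the
     quadratic term. *)
  have [near_s|far] := ltP `|k%:R / n%:R - s x| dl.
    apply: le_trans (Hd x xK _ near_s) _.
    by rewrite lerDl mulr_ge0 // sqr_ge0.
  apply: le_trans (ler_normB _ _) _.
  apply: le_trans (lerD (fM _) (fM _)) _.
  have sq : dl ^+ 2 <= (k%:R / n%:R - s x) ^+ 2.
    by rewrite -[X in _ <= X]real_normK ?num_real // lerXn2r ?nnegrE ?normr_ge0 // ltW.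
  have : 2 * M <= D * (k%:R / n%:R - s x) ^+ 2.
    apply: le_trans (ler_wpM2l D0 sq).
    by rewrite /D divfK // gt_eqF // exprn_gt0.
  by lra.
by rewrite mulr2n mulrDl mul1r lerD2l.
Unshelve. all: by end_near. Qed.

End WeierstrassTrig.

(** * From cosine averages and tightness to convergence in distribution *)

Section Levy.
Context d (T : measurableType d) (R : realType) (P : probability T R).
Variables (W : nat -> T -> R) (Q : probability (measurableTypeR R) R).
Hypothesis mW : forall n, measurable_fun setT (W n).

Let integrableW n (k : R -> R) (C : R) : measurable_fun setT k ->
  (forall x, `|k x| <= C) -> P.-integrable setT (EFin \o (fun w => k (W n w))).
Proof.
move=> mk kC; apply: (@bounded_integrable _ _ _ _ _ C) => // w.
exact: (measurableT_comp mk (mW n)).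
Qed.

Let integrableQ (k : R -> R) (C : R) : measurable_fun setT k ->
  (forall x, `|k x| <= C) -> Q.-integrable setT (EFin \o k).
Proof. by move=> mk kC; exact: (@bounded_integrable _ _ _ Q k C). Qed.

Record averages_cvg (g : R -> R) : Prop := AveragesCvg {
  averages_cvg_measurable : measurable_fun setT g;
  averages_cvg_bounded : exists C, forall x, `|g x| <= C;
  averages_cvg_lim : (\int[P]_w g (W n w) : R) @[n --> \oo] --> \int[Q]_x g x }.

Lemma averages_cvg_linear a g h :
  averages_cvg g -> averages_cvg h -> averages_cvg (fun x => a * g x + h x).
Proof.
move=> [mg [Cg gC] lg] [mh [Ch hC] lh].
have mag : measurable_fun setT (fun x => a * g x) by exact: measurable_funM.
have agC x : `|a * g x| <= `|a| * Cg by rewrite normrM ler_wpM2l.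
split.
- exact: measurable_funD.
- exists (`|a| * Cg + Ch) => x; apply: le_trans (ler_normD _ _) _.
  exact: lerD.
- rewrite RintegralD //; [|exact: integrableQ mag agC|exact: integrableQ mh hC].
  rewrite RintegralZl //; last exact: integrableQ mg gC.
  rewrite (_ : (fun n => _) = (fun n => a * \int[P]_w g (W n w) +
      \int[P]_w h (W n w))); last first.
    apply/funext => n; rewrite RintegralD //.
    - by rewrite RintegralZl //; exact: (integrableW _ mg gC).
    - exact: (integrableW _ mag agC).
    - exact: (integrableW _ mh hC).
  by apply: cvgD => //; apply: cvgM => //; exact: cvg_cst.
Qed.

Lemma averages_cvg_ext g h : (forall x, g x = h x) ->
  averages_cvg g -> averages_cvg h.
Proof. by move=> gh; have -> : h = g by apply/funext. Qed.

Hypothesis cos_cvg : forall u phi : R,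
  (\int[P]_w cos (u * W n w + phi) : R) @[n --> \oo] -->
  \int[Q]_x cos (u * x + phi).

Lemma averages_cvg_cos u phi : averages_cvg (fun x => cos (u * x + phi)).
Proof.
split; [|by exists 1 => x; exact: cos_max|exact: cos_cvg].
apply: continuous_measurable_fun => x.
apply: (@continuous_comp _ _ _ (fun x : R => u * x + phi) (@cos R)).
  by apply: cvgD; [apply: cvgM; [exact: cvg_cst|exact: cvg_id]|exact: cvg_cst].
exact: continuous_cos.
Qed.

(** The factor [cos (u * x + phi)] makes the induction work: its product with [sin (v * x)] is a
    combination of two cosines of the same form, with frequencies [u + v] and [v - u]. *)
Lemma averages_cvg_bern v n g u phi :
  averages_cvg (fun x => bern n g ((1 + sin (v * x)) / 2) * cos (u * x + phi)).
Proof.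
elim: n g u phi => [|n IH] g u phi.
  apply: (averages_cvg_ext (g := fun x => (g 0%N - 1) * cos (u * x + phi) +
      cos (u * x + phi))) => [x /=|]; first by ring.
  by apply: averages_cvg_linear; exact: averages_cvg_cos.
pose B k x := bern n k ((1 + sin (v * x)) / 2).
pose c1 x := cos (u * x + phi).
pose c2 x := cos ((u + v) * x + (phi - pi / 2)).
pose c3 x := cos ((v - u) * x + (- phi - pi / 2)).
(* The last two terms cancel; they close the sum in the shape [a * g + h] handled by
   [averages_cvg_linear]. *)
apply: (averages_cvg_ext (g := fun x =>
   2^-1 * (B (g \o S) x * c1 x) + (4^-1 * (B (g \o S) x * c2 x) +
   (4^-1 * (B (g \o S) x * c3 x) + (2^-1 * (B g x * c1 x) +
   (- 4^-1 * (B g x * c2 x) + (- 4^-1 * (B g x * c3 x) +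
     (-1 * (B g x * c3 x) + B g x * c3 x)))))))) => [x|].
  rewrite /c2 /c3 /= !addrA !cosBpihalf -/(B _ x) -/(B g x) -/(c1 x).
  rewrite [(u + v) * x + phi](_ : _ = v * x + (u * x + phi)); last by ring.
  rewrite [(v - u) * x - phi](_ : _ = v * x - (u * x + phi)); last by ring.
  by rewrite sinD sinB -/(c1 x); field.
do 6 (apply: averages_cvg_linear; first exact: IH).
by apply: averages_cvg_linear; exact: IH.
Qed.

Hypothesis tightW : tight P W.

Lemma probability_tail (e : R) : 0 < e -> exists K : R,
  0 < K /\ (Q [set x | (K <= `|x|)%R] <= e%:E)%E.
Proof.
move=> e0; pose F (n : nat) : set R := [set x | n.+1%:R <= `|x|].
have mF n : measurable (F n).
  by apply: (@measurable_norm_ge _ _ _ id); exact: measurable_id.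
have F0 : \bigcap_n F n = set0.
  rewrite -subset0 => x /(_ (Num.truncn `|x|) I); rewrite /F /= => h.
  by have := truncnS_gt `|x|; rewrite ltNge h.
have : Q (F n) @[n --> \oo] --> Q (\bigcap_n F n).
  apply: nonincreasing_cvg_mu => //.
  - by apply: le_lt_trans (probability_le1 Q (mF 0%N)) _; rewrite ltry.
  - by rewrite F0.
  - move=> i j ij; apply/subsetPset => x /=; apply: le_trans.
    by rewrite ler_nat.
rewrite F0 measure0 => /fine_cvgP[_] /cvgr0Pnorm_le /(_ _ e0) [n _ /(_ n (leqnn n))] /= Fe.
exists n.+1%:R; split => //; rewrite -[X in (X <= _)%E]fineK.
  by rewrite lee_fin (le_trans (ler_norm _)).
by rewrite fin_num_measure //; exact: mF.
Qed.

Theorem levy_cos : cvg_in_distribution P W Q.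
Proof.
move=> f cf [M fM].
have mf : measurable_fun setT f by exact: continuous_measurable_fun.
suff H : (\int[P]_w f (W n w) : R) @[n --> \oo] --> \int[Q]_x f x.
  rewrite -[X in _ --> X]fineK; last by exact/integrable_fin_num/(integrableQ mf fM).
  rewrite (_ : (fun n => _) = (fun n => (\int[P]_w f (W n w))%:E)).
    by apply: cvg_EFin => //; near=> n.
  apply/funext => n; rewrite unlock /Rintegral fineK //.
  exact/integrable_fin_num/(integrableW _ mf fM).
have M0 : 0 <= M := le_trans (normr_ge0 _) (fM 0).
(* Replacing [f] by [p] costs [2 * eta + 2 * M * eta] under each of the two laws, and the averages
   of [p] differ by at most [eta]. *)
apply/cvgrPdist_le => e e0; pose eta := e / (5 + 4 * M).
have eta0 : 0 < eta by rewrite divr_gt0 //; lra.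
have [K1 KW] := tightW eta0; have [K2 [K20 KQ]] := probability_tail eta0.
pose K := `|K1| + K2; have K0 : 0 < K by rewrite ltr_wpDl.
have [N [g [pM pf]]] := bern_sine_approx cf K0 eta0 fM.
pose p x := bern N g ((1 + sin (pi / (4 * K) * x)) / 2).
have {}pM x : `|p x| <= M := pM x.
have {}pf x : `|x| <= K -> `|p x - f x| <= 2 * eta := pf x.
have [mp _ lp] : averages_cvg p.
  apply: (averages_cvg_ext (g := fun x => p x * cos (0 * x + 0))) => [x|].
    by rewrite mul0r addr0 cos0 mulr1.
  exact: averages_cvg_bern.
have mfp : measurable_fun setT (fun x => f x - p x) by exact: measurable_funB.
have fpM x : `|f x - p x| <= 2 * M.
  by apply: le_trans (ler_normB _ _) _; rewrite mulr_natl mulr2n lerD.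
have fQ : `|\int[Q]_x f x - \int[Q]_x p x| <= 2 * eta + 2 * M * eta.
  rewrite -RintegralB //; [|exact: integrableQ mf fM|exact: integrableQ mp pM].
  apply: (@norm_Rintegral_le_off _ _ _ Q _ [set x | (K2 <= `|x|)%R]) => //.
  - by apply: (@measurable_norm_ge _ _ _ id); exact: measurable_id.
  - by rewrite mulr_ge0 // ltW.
  - by move=> x /= /negP; rewrite -ltNge => xK; rewrite distrC pf // /K; apply: ltW;
      apply: lt_le_trans xK _; rewrite lerDr.
near=> n.
have [B [mB PB WB]] : exists B, [/\ measurable B, (P B <= eta%:E)%E &
    forall w, ~ B w -> `|W n w| <= K1] by near: n.
have fP : `|\int[P]_w f (W n w) - \int[P]_w p (W n w)| <= 2 * eta + 2 * M * eta.
  rewrite -RintegralB //; [|exact: (integrableW _ mf fM)|exact: (integrableW _ mp pM)].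
  apply: (norm_Rintegral_le_off _ _ mB PB).
  - exact: (measurableT_comp mfp (mW n)).
  - by move=> w; exact: fpM.
  - by rewrite mulr_ge0 // ltW.
  - move=> w /WB WK; rewrite distrC pf // /K (le_trans WK) // (le_trans (ler_norm K1)) //.
    by rewrite lerDl ltW.
have pp : `|\int[Q]_x p x - \int[P]_w p (W n w)| <= eta.
  by near: n; move/cvgrPdist_le : lp; apply.
have -> : e = (2 * eta + 2 * M * eta) + (eta + (2 * eta + 2 * M * eta)).
  by rewrite /eta; field; lra.
apply: le_trans (ler_distD (\int[Q]_x p x) _ _) _; apply: lerD => //.
apply: le_trans (ler_distD (\int[P]_w p (W n w)) _ _) _; apply: lerD => //.
by rewrite distrC.
Unshelve. all: by end_near. Qed.

End Levy.

(** * The normal distribution *)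

Section NormalIntegral.
Variables (R : realType) (m s : R).
Local Notation leb := (@lebesgue_measure R).

(** The Radon-Nikodym derivative of [normal_prob] agrees almost everywhere with [normal_pdf], since
    both have the same integral over every measurable set. *)
Lemma integral_normal_prob (f : R -> \bar R) : measurable_fun setT f ->
  (\int[normal_prob m s]_x `|f x| < +oo)%E ->
  (\int[normal_prob m s]_x f x = \int[leb]_x (f x * (normal_pdf m s x)%:E))%E.
Proof.
move=> mf finf; have dom := normal_prob_dominates m s.
rewrite -(Radon_Nikodym_change_of_variables dom) //=; last first.
  by apply/integrableP; split.
apply: ae_eq_integral => //.
- apply: emeasurable_funM => //; apply: (measurable_int leb).
- apply: emeasurable_funM => //=; apply/measurableT_comp => //=.
  exact: measurable_normal_pdf.
- apply: ae_eqe_mul2l => /=.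
  rewrite Radon_NikodymE //=.
  case: cid => /= h [h1 h2 h3].
  apply: integral_ae_eq => //=.
  + by apply/measurable_EFinP; exact: measurable_normal_pdf.
  + by move=> E E01 mE; rewrite -h3.
Qed.

End NormalIntegral.

(** * Cosine averages of the centred normal law *)

Section NormalCos.
Variables (R : realType) (s phi : R).
Hypothesis s0 : 0 < s.
Local Notation leb := (@lebesgue_measure R).
Local Notation g := (normal_pdf 0 s).

Lemma is_derive_normal_pdf (x : R) : is_derive x (1 : R) g (- (x / s ^+ 2) * g x).
Proof.
rewrite normal_pdfE ?gt_eqF //= /normal_fun.
apply: trigger_derive; rewrite subr0 scaler0 /GRing.scale /=.
by field; rewrite gt_eqF.
Qed.

Lemma integrable_mul_normal_pdf (t C : R) (f : R -> R) : t != 0 ->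
  measurable_fun setT f -> (forall x, `|f x| <= C) ->
  leb.-integrable setT (fun x => (f x * normal_pdf 0 t x)%:E).
Proof.
move=> t0 mf fC.
apply: (@le_integrable _ _ _ leb setT measurableT _
   (fun x => C%:E * (normal_pdf 0 t x)%:E)%E).
- apply/measurable_EFinP/measurable_funM => //; exact: measurable_normal_pdf.
- move=> x _ /=; rewrite lee_fin !normrM.
  by apply: ler_pM => //; apply: le_trans (fC x) _; exact: ler_norm.
- by apply: integrableZl => //; exact: integrable_normal_pdf.
Qed.

Let t := s * Num.sqrt 2.

(** The normal density of twice the variance dominates: with [z = x ^+ 2 / (4 * s ^+ 2)] the claim
    reduces to [|x| / s <= 1 + z <= expR z], the first inequality being a square. It provides
    integrability, domination and decay at infinity at once. *)
Lemma normal_pdf_mul_le (x : R) :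
  `|x| * g x <= (s * normal_peak s / normal_peak t) * normal_pdf 0 t x.
Proof.
have t0 : 0 < t by rewrite mulr_gt0 // sqrtr_gt0.
rewrite !normal_pdfE ?gt_eqF //=.
have -> : s * normal_peak s / normal_peak t * (normal_peak t * normal_fun 0 t x) =
    s * normal_peak s * normal_fun 0 t x.
  by field; rewrite gt_eqF // normal_peak_gt0 // gt_eqF.
rewrite mulrCA -mulrA [leRHS]mulrCA ler_wpM2l ?normal_peak_ge0 //.
rewrite /normal_fun subr0 exprMn sqr_sqrtr //.
set z := x ^+ 2 / (s ^+ 2 * 4).
have -> : - x ^+ 2 / (s ^+ 2 *+ 2) = - z - z by rewrite /z; field; rewrite gt_eqF.
have -> : - x ^+ 2 / (s ^+ 2 * 2 *+ 2) = - z by rewrite /z; field; rewrite gt_eqF.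
rewrite expRD mulrA ler_pM2r ?expR_gt0 // expRN ler_pdivrMr ?expR_gt0 //.
have z1 : 1 + z <= expR z by exact: expR_ge1Dx.
apply: le_trans (_ : s * (1 + z) <= _); last by rewrite ler_pM2l.
have : 0 <= (`|x| / (2 * s) - 1) ^+ 2 by exact: sqr_ge0.
have -> : (`|x| / (2 * s) - 1) ^+ 2 = 1 + z - `|x| / s.
  rewrite sqrrB expr1n mulr1 expr_div_n real_normK ?num_real // /z.
  by field; rewrite gt_eqF.
by rewrite subr_ge0 ler_pdivrMr // mulrC.
Qed.

Lemma integrable_norm_normal_pdf : leb.-integrable setT (fun x => (`|x| * g x)%:E).
Proof.
have mn : measurable_fun setT (fun x : R => `|x|).
  by apply: continuous_measurable_fun; exact: norm_continuous.
apply: (@le_integrable _ _ _ leb setT measurableT _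
   (fun x => (s * normal_peak s / normal_peak t)%:E * (normal_pdf 0 t x)%:E)%E).
- apply/measurable_EFinP/measurable_funM => //; last exact: measurable_normal_pdf.
- move=> x _ /=; rewrite lee_fin ger0_norm; last by rewrite mulr_ge0 // normal_pdf_ge0.
  by apply: le_trans (normal_pdf_mul_le x) _; exact: ler_norm.
- by apply: integrableZl => //; exact: integrable_normal_pdf.
Qed.

Let wave u x := u * x + phi.

Lemma continuous_wave u : continuous (wave u).
Proof.
by move=> x; apply: cvgD; [apply: cvgM; [exact: cvg_cst|exact: cvg_id]|exact: cvg_cst].
Qed.

Lemma measurable_cos_wave u : measurable_fun setT (fun x => cos (wave u x)).
Proof.
apply: continuous_measurable_fun => x.
by apply: continuous_comp; [exact: continuous_wave|exact: continuous_cos].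
Qed.

Lemma measurable_sin_wave u : measurable_fun setT (fun x => sin (wave u x)).
Proof.
apply: continuous_measurable_fun => x.
by apply: continuous_comp; [exact: continuous_wave|exact: continuous_sin].
Qed.

Definition normal_cos u := \int[leb]_x (cos (wave u x) * g x).

Lemma normal_cos0 : normal_cos 0 = cos phi.
Proof.
rewrite /normal_cos; under eq_Rintegral do rewrite /wave mul0r add0r.
rewrite RintegralZl //; last exact: integrable_normal_pdf.
by rewrite /Rintegral integral_normal_pdf mulr1.
Qed.

Lemma integrable_x_sin u :
  leb.-integrable setT (fun x => (x * sin (wave u x) * g x)%:E).
Proof.
apply: (@le_integrable _ _ _ leb setT measurableT _ (fun x => (`|x| * g x)%:E)).
- apply/measurable_EFinP/measurable_funM; last exact: measurable_normal_pdf.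
  by apply: measurable_funM => //; exact: measurable_sin_wave.
- move=> x _ /=; rewrite lee_fin !normrM normr_id ler_wpM2r //.
  by rewrite ler_piMr // sin_max.
- exact: integrable_norm_normal_pdf.
Qed.

Lemma derive_normal_cos (u : R) :
  is_derive u (1 : R) normal_cos (- \int[leb]_x (x * sin (wave u x) * g x)).
Proof.
pose f (v x : R) : R := cos (wave v x) * g x.
have Iu : `]u - 1, u + 1[%classic u by rewrite /= in_itv /=; lra.
have df (v x : R) : is_derive v (1 : R) (f ^~ x) (- (x * sin (wave v x) * g x)).
  rewrite /f /wave.
  apply: trigger_derive; rewrite /GRing.scale /=; ring.
have dfE (v x : R) : partial1of2 f v x = - (x * sin (wave v x) * g x).
  by rewrite partial1of2E; apply: derive_val.
have intf v : `]u - 1, u + 1[%classic v -> leb.-integrable setT (EFin \o f v).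
  move=> _; apply: (@integrable_mul_normal_pdf s 1); rewrite ?gt_eqF //.
    exact: measurable_cos_wave.
  by move=> x; exact: cos_max.
have derf v x : `]u - 1, u + 1[%classic v -> [set: R] x -> derivable (f ^~ x) v 1.
  by move=> _ _; apply: ex_derive.
have G0 (x : R) : 0 <= `|x| * g x by rewrite mulr_ge0 // normal_pdf_ge0.
have Gub v x : `]u - 1, u + 1[%classic v -> [set: R] x ->
    `|partial1of2 f v x| <= `|x| * g x.
  move=> _ _; rewrite dfE normrN !normrM (ger0_norm (normal_pdf_ge0 _ _ _)).
  by rewrite ler_wpM2r ?normal_pdf_ge0 // ler_piMr // sin_max.
have H1 := @derivable_under_integral R _ _ leb f setT measurableT u (u - 1) (u + 1)
  Iu intf derf _ G0 integrable_norm_normal_pdf Gub.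
have H2 := @differentiation_under_integral R _ _ leb f setT measurableT u (u - 1) (u + 1)
  Iu intf derf _ G0 integrable_norm_normal_pdf Gub.
apply: DeriveDef; first exact: H1.
rewrite -derive1E H2 -mulN1r -RintegralZl //; last exact: integrable_x_sin.
by apply: eq_Rintegral => x _; rewrite dfE mulN1r.
Qed.

Let H u x := sin (wave u x) * g x.

Lemma is_derive_sin_normal_pdf (u x : R) : is_derive x (1 : R) (H u)
  (u * (cos (wave u x) * g x) - (s ^+ 2)^-1 * (x * sin (wave u x) * g x)).
Proof.
have := is_derive_normal_pdf x; rewrite /H /wave => dg.
apply: trigger_derive; rewrite /GRing.scale /=.
by field; rewrite gt_eqF.
Qed.

(** The derivative of [sin (wave u x) * g x] integrates to zero: over [[- n.+1, n.+1]] its integral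
    is a boundary term that vanishes, and dominated convergence passes to the line. *)
Lemma integral_by_parts_normal_pdf u :
  \int[leb]_x (x * sin (wave u x) * g x) = s ^+ 2 * u * normal_cos u.
Proof.
pose h (x : R) := u * (cos (wave u x) * g x) - (s ^+ 2)^-1 * (x * sin (wave u x) * g x).
have icos : leb.-integrable setT (fun x => (cos (wave u x) * g x)%:E).
  apply: (@integrable_mul_normal_pdf s 1); rewrite ?gt_eqF //.
    exact: measurable_cos_wave.
  by move=> x; exact: cos_max.
have isin := integrable_x_sin u.
have icosu : leb.-integrable setT (fun x => (u * (cos (wave u x) * g x))%:E).
  by rewrite (_ : (fun x => _) = (fun x => u%:E * (cos (wave u x) * g x)%:E)%E);
    [exact: integrableZl|apply/funext].
have isins : leb.-integrable setT
    (fun x => ((s ^+ 2)^-1 * (x * sin (wave u x) * g x))%:E).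
  by rewrite (_ : (fun x => _) = (fun x => ((s ^+ 2)^-1)%:E *
    (x * sin (wave u x) * g x)%:E)%E); [exact: integrableZl|apply/funext].
have ih : leb.-integrable setT (EFin \o h).
  rewrite (_ : EFin \o h = (fun x => (u * (cos (wave u x) * g x))%:E -
     ((s ^+ 2)^-1 * (x * sin (wave u x) * g x))%:E)%E); last by apply/funext.
  exact: integrableB.
have ch : continuous h.
  move=> x; apply: cvgB; apply: cvgM; try exact: cvg_cst.
    apply: cvgM; last by apply: continuous_normal_pdf; rewrite gt_eqF.
    by apply: continuous_comp; [exact: continuous_wave|exact: continuous_cos].
  apply: cvgM; last by apply: continuous_normal_pdf; rewrite gt_eqF.
  apply: cvgM; first exact: cvg_id.
  by apply: continuous_comp; [exact: continuous_wave|exact: continuous_sin].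
suff h0 : \int[leb]_x h x = 0.
  move: h0; rewrite RintegralB //.
  rewrite !RintegralZl // -/(normal_cos u) => /eqP; rewrite subr_eq0 => /eqP h0.
  by rewrite -mulrA h0 mulVKf // expf_neq0 // gt_eqF.
have cH : continuous (H u).
  move=> x; apply: cvgM; last by apply: continuous_normal_pdf; rewrite gt_eqF.
  by apply: continuous_comp; [exact: continuous_wave|exact: continuous_sin].
pose I (n : nat) : set R := `[- n.+1%:R, n.+1%:R]%classic.
have FTC (n : nat) : (\int[leb]_(x in I n) (h x)%:E =
    (H u n.+1%:R)%:E - (H u (- n.+1%:R))%:E)%E.
  apply: continuous_FTC2.
  - by rewrite (@lt_trans _ _ 0) // oppr_lt0.
  - exact: continuous_subspaceT.
  - split.
    + by move=> x _; have dH := is_derive_sin_normal_pdf u x; exact: ex_derive.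
    + by apply: cvg_at_right_filter; exact: cH.
    + by apply: cvg_at_left_filter; exact: cH.
  - move=> x _; rewrite derive1E.
    by have dH := is_derive_sin_normal_pdf u x; rewrite derive_val.
have lim1 : (\int[leb]_(x in I n) (h x)%:E @[n --> \oo] -->
    \int[leb]_x (h x)%:E)%E.
  have mI n : measurable (I n) by exact: measurable_itv.
  have mh := measurable_int _ ih.
  have mhI n : measurable_fun setT ((EFin \o h) \_ (I n)).
    by apply/(measurable_restrictT _ (mI n)); exact: measurable_funTS.
  have ae1 : {ae leb, forall x, [set: R] x ->
      ((EFin \o h) \_ (I n)) x @[n --> \oo] --> (EFin \o h) x}.
    apply: aeW => x _; apply: cvg_near_cst; exists (Num.truncn `|x|) => // n /= nx.
    rewrite patchE mem_set // /I /= in_itv /= -ler_norml.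
    by apply: ltW; apply: lt_le_trans (truncnS_gt _) _; rewrite ler_nat.
  have ae2 : {ae leb, forall x n, [set: R] x ->
      (`|((EFin \o h) \_ (I n)) x| <= `|(EFin \o h) x|)%E}.
    by apply: aeW => x n _; rewrite patchE; case: ifP => // _; rewrite abse0.
  have [_ _] := @dominated_convergence _ _ _ leb setT measurableT
    _ _ _ mhI mh ae1 (integrable_abse ih) ae2.
  rewrite (_ : (fun n => \int[leb]_(x in I n) (h x)%:E)%E =
    (fun n => \int[leb]_x ((EFin \o h) \_ (I n)) x)%E) //.
  by apply/funext => n; rewrite integral_mkcond.
(* A bound for [|x| * g x], so that the boundary terms are at most of order [1 / n]. *)
pose D := s * normal_peak s / normal_peak t * normal_peak t.
have HD n (x : R) : `|x| = n.+1%:R -> `|H u x| <= D * n.+1%:R^-1.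
  move=> xn; rewrite ler_pdivlMr // -xn /H normrM (ger0_norm (normal_pdf_ge0 _ _ _)).
  rewrite mulrC mulrA.
  apply: le_trans (_ : `|x| * g x <= _).
    by rewrite ler_wpM2r ?normal_pdf_ge0 // ler_piMr // sin_max.
  have t0 : 0 < t by rewrite mulr_gt0 // sqrtr_gt0.
  apply: le_trans (normal_pdf_mul_le x) _; apply: ler_wpM2l.
    by rewrite divr_ge0 ?normal_peak_ge0 // mulr_ge0 ?normal_peak_ge0 // ltW.
  by apply: normal_pdf_ub; rewrite gt_eqF.
have lim2 : H u n.+1%:R - H u (- n.+1%:R) @[n --> \oo] --> (0 : R).
  have D0 : (D + D) * harmonic n @[n --> \oo] --> (0 : R).
    rewrite -(mulr0 (D + D)); apply: cvgM; first exact: cvg_cst.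
    exact: cvg_harmonic.
  apply: cvg0_norm_le D0; near=> n.
  rewrite mulrDl; apply: le_trans (ler_normB _ _) _.
  by apply: lerD; apply: HD; rewrite ?normrN ger0_norm.
have lim3 : (\int[leb]_(x in I n) (h x)%:E @[n --> \oo] -->
    (0 : R)%:E)%E.
  under eq_fun do rewrite FTC -EFinB.
  by apply: cvg_EFin => //; near=> n.
by rewrite /Rintegral (cvg_unique _ lim1 lim3).
Unshelve. all: by end_near. Qed.

(** Differentiation under the integral and integration by parts give the equation
    [y' = - s ^+ 2 * u * y]; the product [E] with the inverse Gaussian factor therefore has
    derivative zero. *)
Lemma normal_cosE u : normal_cos u = expR (- (u ^+ 2 * s ^+ 2 / 2)) * cos phi.
Proof.
pose E (v : R) := normal_cos v * expR (v ^+ 2 * s ^+ 2 / 2).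
have dE (v : R) : is_derive v (1 : R) E 0.
  have dn := derive_normal_cos v; rewrite integral_by_parts_normal_pdf in dn.
  rewrite /E; apply: trigger_derive; rewrite /GRing.scale /=.
  by field.
have : E u = E 0 by apply: is_derive_0_is_cst.
rewrite /E normal_cos0 expr0n /= !mul0r expR0 mulr1 => <-.
by rewrite mulrCA -expRD addNr expR0 mulr1.
Qed.

Theorem normal_prob_cos u :
  \int[normal_prob 0 s]_x cos (u * x + phi) =
  expR (- (u ^+ 2 * s ^+ 2 / 2)) * cos phi.
Proof.
rewrite -normal_cosE /normal_cos /Rintegral integral_normal_prob //.
  by apply/measurable_EFinP; exact: measurable_cos_wave.
have /integrableP[_] // : (normal_prob 0 s).-integrable setT
  (EFin \o (fun x => cos (wave u x))).
apply: (@bounded_integrable _ _ _ (normal_prob 0 s) _ 1).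
  exact: measurable_cos_wave.
by move=> x; exact: cos_max.
Qed.

End NormalCos.

(** * Score and information *)

Lemma ln_diff_le (R : realType) (x y : R) : 0 < x -> 0 < y -> ln y - ln x <= (y - x) / x.
Proof.
move=> x0 y0; rewrite -ln_div //.
have -> : y / x = 1 + (y - x) / x by field; rewrite gt_eqF.
apply: le_ln1Dx; rewrite mulrBl divff ?gt_eqF // ltrBrDl subrr; exact: divr_gt0.
Qed.

Lemma le0_of_small_multiples (R : realType) (x C : R) :
  (forall e : R, 0 < e -> e <= 1 -> x <= e * C) -> x <= 0.
Proof.
move=> H; have [//|x0] := leP x 0.
(* For this [e] one has [e * x + 2 * e * |C| + e = x], which contradicts [x <= e * C]. *)
pose e := x / (x + 2 * `|C| + 1).
have C0 := normr_ge0 C; have d0 : 0 < x + 2 * `|C| + 1 by lra.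
have e0 : 0 < e by rewrite divr_gt0.
have e1 : e <= 1 by rewrite ler_pdivrMr // mul1r; lra.
have := H e e0 e1; have : e * C <= e * `|C| by rewrite ler_pM2l // ler_norm.
have : e * (x + 2 * `|C| + 1) = x by rewrite divfK // gt_eqF.
have : 0 <= e * `|C| by rewrite mulr_ge0 // ltW.
have : 0 < e * x by rewrite mulr_gt0.
by lra.
Qed.

Section Score.
Variables (m : nat -> nat) (c : nat -> nat -> nat).
Hypothesis m_gt0 : forall t, (1 <= t)%N -> (1 <= m t)%N.
Hypothesis c_lt : forall t i, (2 <= t)%N -> (1 <= i <= m t)%N -> (c t i < t)%N.
Variables (R : realType) (lo : R).
Hypothesis lo_gt : -1 < lo.
Implicit Types delta x y : R.

Local Notation D t i := ((chosen_deg m c t i)%:R : R).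
Local Notation S t i delta := (total_weight m c t i.-1 delta).

(** This is [n.+1] times the derivative of [loglik]; [t] is the derivative of the total weight in
    [delta]. *)
Definition score n delta : R :=
  edge_sum m n (fun t i => (D t i + delta)^-1 - t%:R / S t i delta).

(** Minus the divided difference of the score between [delta0] and [delta], not a second derivative:
    [score_diff] is then an identity without remainder. *)
Definition info n delta0 delta : R :=
  edge_sum m n (fun t i => ((D t i + delta) * (D t i + delta0))^-1 -
    t%:R / S t i delta * (t%:R / S t i delta0)).

(** A common bound on [[lo, +oo[] for [1 / (D + delta)] and [t / S]; the added 1 makes it also
    dominate [1 / (2 * mu + delta)]. *)
Definition inv_bound : R := 1 + (1 + lo)^-1.

Let lo1 : 0 < 1 + lo. Proof. have := lo_gt; lra. Qed.

Lemma inv_bound_ge1 : 1 <= inv_bound.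
Proof. by rewrite lerDl invr_ge0 ltW. Qed.

Let A0 : 0 < inv_bound := lt_le_trans ltr01 inv_bound_ge1.

Let le_invb delta : lo <= delta -> (1 + delta)^-1 <= inv_bound.
Proof.
move=> ld; have l1 := lo1; apply: (@le_trans _ _ (1 + lo)^-1).
  by rewrite lef_pV2 ?posrE; lra.
by rewrite lerDr.
Qed.

Lemma deg_shift_bounds t i delta : (2 <= t)%N -> (1 <= i <= m t)%N -> lo <= delta ->
  0 < D t i + delta /\ (D t i + delta)^-1 <= inv_bound.
Proof.
move=> t2 im ld; have l1 := lo1.
have D1 : 1 <= D t i by rewrite ler1n chosen_deg_gt0.
have p : 0 < D t i + delta by lra.
split=> //; apply: le_trans (le_invb ld).
by rewrite lef_pV2 ?posrE; lra.
Qed.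

Lemma weight_ratio_bounds t i delta : (2 <= t)%N -> (1 <= i <= m t)%N -> lo <= delta ->
  0 < S t i delta /\ 0 <= t%:R / S t i delta <= inv_bound.
Proof.
move=> t2 im ld; have l1 := lo1; have im' : (i.-1 <= m t)%N by lia.
have t0 : 0 < t%:R :> R by rewrite ltr0n; lia.
have d1 : 0 < 1 + delta by lra.
have Sge := total_weight_ge m_gt0 c_lt delta t2 im'.
have S0 : 0 < S t i delta by apply: lt_le_trans Sge; rewrite mulr_gt0.
split=> //; rewrite divr_ge0 ?(ltW t0) ?(ltW S0) //=.
apply: le_trans (le_invb ld).
by rewrite ler_pdivrMr // mulrC ler_pdivlMr.
Qed.

Lemma total_weightB t i delta delta' : (2 <= t)%N -> (1 <= i <= m t)%N ->
  S t i delta - S t i delta' = t%:R * (delta - delta').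
Proof.
by move=> t2 im; rewrite !(total_weightE c_lt) //; [ring| lia|lia].
Qed.

(* The bound ln z <= z - 1 replaces the differentiation of the likelihood. *)
Lemma maximizer_score n x y : (1 <= n)%N -> lo <= x -> lo <= y ->
  (forall e : R, 0 < e -> e <= 1 ->
     loglik m c n (x + e * (y - x)) <= loglik m c n x) ->
  (y - x) * score n x <= 0.
Proof.
move=> n1 lx ly mx.
set E := edge_sum m n (fun _ _ => 1 : R).
(* A move by [h = e * (y - x)] gains [h * score n x] at first order and loses at most
   [h ^+ 2 * inv_bound ^+ 2] per edge; dividing by [e] leaves an error proportional to [e]. *)
apply: (@le0_of_small_multiples _ _ ((y - x) ^+ 2 * inv_bound ^+ 2 * E)) => e e0 e1.
have := mx e e0 e1; set h := e * (y - x); set z := x + h.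
have lz : lo <= z by rewrite /z /h; nra.
have n0 : 0 < n.+1%:R^-1 :> R by rewrite invr_gt0 ltr0n.
rewrite !(loglikE m_gt0 c_lt) // ler_pM2l // -subr_le0 -edge_sumB => H.
have {H} : h * score n x - h ^+ 2 * inv_bound ^+ 2 * E <= 0.
  apply: le_trans H; rewrite -!edge_sumZ -edge_sumB; apply: ler_edge_sum => t i /andP[t2 _] im.
  have [dx dxA] := deg_shift_bounds t2 im lx; have [dz dzA] := deg_shift_bounds t2 im lz.
  have [sx _] := weight_ratio_bounds t2 im lx; have [sz _] := weight_ratio_bounds t2 im lz.
  have L1 := ln_diff_le dz dx; have L2 := ln_diff_le sx sz.
  rewrite total_weightB // in L2.
  have e3 : z - x = h by rewrite /z; ring.
  rewrite e3 in L2.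
  set d1 := D t i + x in dx dxA L1 *; set d2 := D t i + z in dz dzA L1 *.
  set s1 := S t i x in sx L2 *; set s2 := S t i z in sz L2 *.
  have e4 : d1 - d2 = - h by rewrite /d1 /d2 /z; ring.
  rewrite e4 in L1.
  have L3 : h * d1^-1 = h / d2 + h ^+ 2 * (d1^-1 * d2^-1).
    have d2E : d2 = d1 + h by rewrite /d1 /d2 /z; ring.
    rewrite d2E in dz *; by field; rewrite !gt_eqF.
  have L4 : d1^-1 * d2^-1 <= inv_bound ^+ 2.
    by rewrite expr2 ler_pM // invr_ge0 ltW.
  have L5 : h ^+ 2 * (d1^-1 * d2^-1) <= h ^+ 2 * inv_bound ^+ 2.
    by rewrite ler_wpM2l // sqr_ge0.
  have L6 : h * (t%:R / s1) = t%:R * h / s1 by ring.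
  rewrite mulr1 mulrBr L3 L6; rewrite mulNr in L1.
  by lra.
rewrite subr_le0 /h => H.
have : e * ((y - x) * score n x) <= e * (e * ((y - x) ^+ 2 * inv_bound ^+ 2 * E)).
  by apply: le_trans (_ : e * (y - x) * score n x <= _); [rewrite mulrA|
     apply: le_trans H _; rewrite exprMn !mulrA expr2].
by rewrite ler_pM2l.
Qed.

Lemma score_diff n delta0 delta : lo <= delta0 -> lo <= delta ->
  score n delta = score n delta0 - (delta - delta0) * info n delta0 delta.
Proof.
move=> l0 l; rewrite -edge_sumZ -edge_sumB; apply: eq_edge_sum => t i /andP[t2 _] im.
have [d0 _] := deg_shift_bounds t2 im l0; have [d1 _] := deg_shift_bounds t2 im l.
have [s0 _] := weight_ratio_bounds t2 im l0; have [s1 _] := weight_ratio_bounds t2 im l.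
have SB := total_weightB delta delta0 t2 im.
set S1 := S t i delta in s1 SB *; set S0 := S t i delta0 in s0 SB *.
have e1 : S1 = S0 + t%:R * (delta - delta0) by rewrite -SB; ring.
rewrite e1 in s1 *.
field; by rewrite !gt_eqF.
Qed.

Lemma info_lipschitz n delta0 delta : lo <= delta0 -> lo <= delta ->
  `|info n delta0 delta - info n delta0 delta0| <=
  2 * inv_bound ^+ 3 * `|delta - delta0| * edge_sum m n (fun _ _ => 1).
Proof.
move=> l0 l; rewrite -edge_sumZ -edge_sumB; apply: le_trans (ler_norm_edge_sum _ _ _) _.
apply: ler_edge_sum => t i /andP[t2 _] im; rewrite mulr1.
have [d0 d0A] := deg_shift_bounds t2 im l0; have [d1 d1A] := deg_shift_bounds t2 im l.
have [s0 /andP[r0 r0A]] := weight_ratio_bounds t2 im l0.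
have [s1 /andP[r1 r1A]] := weight_ratio_bounds t2 im l.
have SB := total_weightB delta delta0 t2 im.
set u := (D t i + delta)^-1 in d1A *; set v := (D t i + delta0)^-1 in d0A *.
have u0 : 0 < u by rewrite invr_gt0.
have v0 : 0 < v by rewrite invr_gt0.
have uv : u - v = - (delta - delta0) * (u * v) by rewrite /u /v; field; rewrite !gt_eqF.
set p := t%:R / S t i delta in r1 r1A *; set q := t%:R / S t i delta0 in r0 r0A *.
have pq : p - q = - (delta - delta0) * (p * q).
  have e1 : S t i delta = S t i delta0 + t%:R * (delta - delta0) by rewrite -SB; ring.
  by rewrite /p /q e1 in s1 *; field; rewrite !gt_eqF.
clearbody p q.
rewrite !invfM -/u -/v.
have -> : u * v - p * q - (v * v - q * q) = (u - v) * v - (p - q) * q by ring.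
rewrite uv pq; apply: le_trans (ler_normB _ _) _; rewrite !normrM normrN.
rewrite (gtr0_norm u0) (gtr0_norm v0) (ger0_norm r0) (ger0_norm r1).
have A3 (a b : R) : 0 <= a -> 0 <= b -> a <= inv_bound -> b <= inv_bound ->
    `|delta - delta0| * (a * b) * b <= inv_bound ^+ 3 * `|delta - delta0|.
  move=> a0 b0 aA bA; rewrite -mulrA mulrC ler_wpM2r //.
  have -> : inv_bound ^+ 3 = inv_bound * inv_bound * inv_bound by ring.
  by rewrite !ler_pM // mulr_ge0.
have := A3 u v (ltW u0) (ltW v0) d1A d0A; have := A3 p q r1 r0 r1A r0A.
by lra.
Qed.

Variable mu : R.
Hypothesis mu_ge1 : 1 <= mu.

Let weight_prod_le t i delta delta0 : (2 <= t)%N -> (1 <= i <= m t)%N ->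
  lo <= delta -> lo <= delta0 ->
  `|t%:R / S t i delta * (t%:R / S t i delta0) -
    (2 * mu + delta)^-1 * (2 * mu + delta0)^-1| <=
  inv_bound * (`|t%:R / S t i delta - (2 * mu + delta)^-1| +
    `|t%:R / S t i delta0 - (2 * mu + delta0)^-1|).
Proof.
move=> t2 im l l0; have l1 := lo1; have m1 := mu_ge1; have A1 := inv_bound_ge1.
have [_ /andP[r0 r0A]] := weight_ratio_bounds t2 im l0.
set p := t%:R / _; set q := t%:R / _ in r0 r0A *.
set u := (2 * mu + delta)^-1; set v := (2 * mu + delta0)^-1.
clearbody p q.
have -> : p * q - u * v = (p - u) * q + u * (q - v) by ring.
have u0 : 0 <= u by rewrite invr_ge0; lra.
have uA : u <= inv_bound by apply: le_trans A1; rewrite invf_le1; lra.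
apply: le_trans (ler_normD _ _) _; rewrite !normrM (ger0_norm r0) (ger0_norm u0) mulrDr.
by rewrite [inv_bound * `|p - u|]mulrC lerD //; [rewrite ler_wpM2l|rewrite ler_wpM2r].
Qed.

Lemma weight_prod_sum n delta delta0 : lo <= delta -> lo <= delta0 ->
  edge_sum m n (fun t i => `|t%:R / S t i delta * (t%:R / S t i delta0) -
    (2 * mu + delta)^-1 * (2 * mu + delta0)^-1|) <=
  8 * mu * inv_bound ^+ 2 * dev_err m mu n.
Proof.
move=> l l0; have l1 := lo1; have m1 := mu_ge1.
apply: (@le_trans _ _ (edge_sum m n (fun t i => inv_bound *
   (`|t%:R / S t i delta - (2 * mu + delta)^-1| +
    `|t%:R / S t i delta0 - (2 * mu + delta0)^-1|)))).
  by apply: ler_edge_sum => t i /andP[t2 _] im; exact: weight_prod_le.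
rewrite edge_sumZ edge_sumD.
have e0 : 0 <= dev_err m mu n.
  by rewrite addr_ge0 // sumr_ge0 // => t _; rewrite divr_ge0 // mulr_ge0 // addr_ge0.
have step x : lo <= x -> edge_sum m n (fun t i => `|t%:R / S t i x - (2 * mu + x)^-1|)
    <= 4 * mu * inv_bound * dev_err m mu n.
  move=> lx; have x1 : -1 < x by lra.
  apply: le_trans (edge_sum_weight_ratio m_gt0 c_lt mu_ge1 n x1) _.
  have m4 : 0 <= 4 * mu by lra.
  by rewrite ler_wpM2r // ler_wpM2l //; exact: le_invb.
have -> : 8 * mu * inv_bound ^+ 2 * dev_err m mu n =
  inv_bound * (4 * mu * inv_bound * dev_err m mu n + 4 * mu * inv_bound * dev_err m mu n) by ring.
by rewrite ler_pM2l // lerD // step.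
Qed.

Definition inv_deg_sum n delta0 : R := edge_sum m n (fun t i => (D t i + delta0)^-1).

(* With s = 2 mu + delta, 1/(D + delta) is the sum of its first order expansion
   at D = 2 mu and of (D - 2 mu)^2 / (s^2 (D + delta)); the latter does not
   vanish for degrees D other than 2 mu. *)
Lemma info_lower n k delta0 delta hi : (1 <= k)%N ->
  lo <= delta0 -> lo <= delta -> delta <= hi ->
  (k%:R - 2 * mu) ^+ 2 / ((k%:R + hi) * (k%:R + delta0) * (2 * mu + hi) ^+ 2) *
    (chosen_count m c n k)%:R
  - 2 * `|(2 * mu + delta0) * inv_deg_sum n delta0 - edge_sum m n (fun _ _ => 1)|
  - 8 * mu * inv_bound ^+ 2 * dev_err m mu n <= info n delta0 delta.
Proof.
move=> k1 l0 l dhi; have l1 := lo1; have m1 := mu_ge1.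
set s := 2 * mu + delta; set s0 := 2 * mu + delta0.
have s1 : 1 <= s by rewrite /s; lra.
have s01 : 1 <= s0 by rewrite /s0; lra.
set E := edge_sum m n (fun _ _ => 1 : R); set Pn := inv_deg_sum n delta0.
pose third := edge_sum m n (fun t i =>
  (D t i - 2 * mu) ^+ 2 / ((D t i + delta) * (D t i + delta0) * s ^+ 2)).
set kap := _ / _.
have T3 : kap * (chosen_count m c n k)%:R <= third.
  rewrite chosen_countE -edge_sumZ; apply: ler_edge_sum => t i /andP[t2 _] im.
  have [d0 _] := deg_shift_bounds t2 im l0; have [d1 _] := deg_shift_bounds t2 im l.
  have D1 : 1 <= D t i by rewrite ler1n chosen_deg_gt0.
  case: eqP => [Dk|_]; last first.
    by rewrite mulr0 divr_ge0 ?sqr_ge0 // !mulr_ge0 ?exprn_ge0 ?ltW //; lra.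
  rewrite mulr1 /kap -{}Dk in d0 d1 D1 *.
  rewrite ler_wpM2l ?sqr_ge0 // lef_pV2 ?posrE ?mulr_gt0 ?exprn_gt0 //; [|lra..].
  apply: ler_pM; rewrite ?mulr_ge0 ?exprn_ge0 ?(ltW d0) ?(ltW d1) //; try lra.
    by rewrite ler_wpM2r ?(ltW d0) // lerD2l.
  by rewrite lerXn2r ?nnegrE /s; lra.
pose W := edge_sum m n (fun t i => t%:R / S t i delta * (t%:R / S t i delta0)).
have WE : W <= E / (s * s0) + 8 * mu * inv_bound ^+ 2 * dev_err m mu n.
  rewrite -lerBlDl; apply: le_trans (weight_prod_sum n l l0).
  rewrite /W /E mulrC -edge_sumZ -edge_sumB; apply: ler_edge_sum => t i _ _.
  by rewrite mulr1 invfM; exact: ler_norm.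
have -> : info n delta0 delta = Pn / s - (E - s0 * Pn) / s ^+ 2 + third - W.
  rewrite /info edge_sumB; congr (_ - _).
  rewrite [_ / s]mulrC [_ / s ^+ 2]mulrC /Pn /inv_deg_sum /E -!edge_sumZ -!edge_sumB -!edge_sumZ.
  rewrite -edge_sumB -edge_sumD; apply: eq_edge_sum => t i /andP[t2 _] im.
  have [d0 _] := deg_shift_bounds t2 im l0; have [d1 _] := deg_shift_bounds t2 im l.
  rewrite /s0 /s; field; rewrite !gt_eqF //; lra.
(* The main term [E / (s * s0)] cancels against [W]. The difference [s0 * Pn - E] will be
   negligible, because [Pn / n] tends to [mu / s0]. *)
have -> : Pn / s - (E - s0 * Pn) / s ^+ 2 + third - W =
  third + (s0 * Pn - E) * ((s * s0)^-1 + (s ^+ 2)^-1) + E / (s * s0) - W.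
  by field; rewrite !gt_eqF //; lra.
have N : - (2 * `|s0 * Pn - E|) <= (s0 * Pn - E) * ((s * s0)^-1 + (s ^+ 2)^-1).
  set x := s0 * Pn - E; set y := _ + _.
  have y0 : 0 <= y by rewrite addr_ge0 // invr_ge0 ?mulr_ge0 ?sqr_ge0 //; lra.
  have y2 : y <= 2.
    have i1 : (s * s0)^-1 <= 1 by rewrite invf_le1 ?mulr_gt0; nra.
    have i2 : (s ^+ 2)^-1 <= 1 by rewrite invf_le1 ?exprn_gt0; nra.
    by rewrite /y; lra.
  have : `|x| * y <= `|x| * 2 by rewrite ler_wpM2l.
  have : `|x * y| = `|x| * y by rewrite normrM (ger0_norm y0).
  have := ler_norm (- (x * y)); rewrite normrN; lra.
by lra.
Qed.

End Score.

(** * Limits of the score and of the information *)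

Section FisherInformation.
Context d (T : measurableType d) (R : realType) (P : probability T R).
Variables (m : nat -> {RV P >-> nat}) (c : nat -> nat -> {RV P >-> nat}).
Variables (delta0 : R) (p : nat -> R).
Hypothesis delta_gt : -1 < delta0.
Hypothesis m_pos : forall t w, (1 <= t)%N -> (1 <= m t w)%N.
Hypothesis m_iid : iid m.
Hypothesis m_moment2 : ('E_P[(fun w => (m 1%N w)%:R ^+ 2)%R] < +oo)%E.
Hypothesis model : is_PA m c delta0.

Local Notation mw := (m_at m).
Local Notation cw := (c_at c).
Local Notation mu := (init_mean m).

Hypothesis p_def : limit_degrees mu (init_prob m) delta0 p.

Let mw_gt0 w : forall t, (1 <= t)%N -> (1 <= mw w t)%N.
Proof. by move=> t; exact: m_pos. Qed.

Let cw_lt w t i : (2 <= t)%N -> (1 <= i <= mw w t)%N -> (cw w t i < t)%N.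
Proof. exact: (PA_range model). Qed.

Let mu_ge1 : 1 <= mu := init_mean_ge1 m_moment2 m_pos.

Local Notation s0 := (2 * mu + delta0).

Let s0_ge1 : 1 <= s0.
Proof. have := mu_ge1; have := delta_gt; lra. Qed.

Let d1 : 0 < 1 + delta0.
Proof. have := delta_gt; lra. Qed.

(* The value at 0, which is not a degree, is chosen so that inv_deg is bounded. *)
Definition inv_deg k : R := if k == 0%N then 0 else (k%:R + delta0)^-1.

Lemma norm_inv_deg k : `|inv_deg k| <= (1 + delta0)^-1.
Proof.
rewrite /inv_deg; case: eqP => [_|/eqP k0]; first by rewrite normr0 invr_ge0 ltW.
have k1 : 1 <= k%:R :> R by rewrite ler1n lt0n.
have d1' := d1; rewrite gtr0_norm; last by rewrite invr_gt0; lra.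
by rewrite lef_pV2 ?posrE; lra.
Qed.

Definition mart_inv k n w : R := mart delta0 inv_deg k (PA (mw w) (cw w) n).

(** In the conditional mean the weight [D + delta0] cancels its inverse, which leaves the number [t]
    of vertices over the total weight. This is what makes the score at [delta0] a martingale. *)
Lemma mart_inv_edge_sum k n w : (1 <= n)%N -> mart_inv k n w =
  edge_sum (mw w) n (fun t i => (((chosen_deg (mw w) (cw w) t i)%:R + delta0)^-1 -
    t%:R / total_weight (mw w) (cw w) t i.-1 delta0) ^+ k).
Proof.
move=> n1; rewrite /mart_inv mart_edge_sum //; apply: eq_edge_sum => t i /andP[t2 _] im.
have dE := chosen_deg_gt0 (mw_gt0 w) (@cw_lt w) t2 im.
rewrite /incr /=; congr ((_ - _) ^+ k).
  by rewrite /inv_deg -/(chosen_deg (mw w) (cw w) t i) eqn0Ngt dE.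
rewrite /hmean; under eq_bigr => v _.
  have dv := deg_PA_mid_gt0 (mw_gt0 w) (@cw_lt w) i.-1 t2 (ltn_ord v).
  rewrite /inv_deg eqn0Ngt dv /= mulrAC /wt divff ?mul1r; last first.
    have d1' := d1; have : 1 <= (deg (PA_mid (mw w) (cw w) t i.-1) v)%:R :> R by rewrite ler1n.
    by move=> ?; rewrite gt_eqF //; lra.
  over.
by rewrite sumr_const card_ord -[LHS]mulr_natl.
Qed.

Lemma mart_inv_score n w : (1 <= n)%N -> mart_inv 1 n w = score (mw w) (cw w) n delta0.
Proof.
by move=> n1; rewrite mart_inv_edge_sum //; apply: eq_edge_sum => t i _ _; rewrite expr1.
Qed.

Definition edge_count n w : R := edge_sum (mw w) n (fun _ _ => 1).

Lemma edge_count_dev n w : (1 <= n)%N -> `|edge_count n w - mu * n%:R| <= dev_err (mw w) mu n.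
Proof.
move=> n1.
have -> : edge_count n w - mu * n%:R = dev (mw w) mu n - (m 1%N w)%:R.
  have iE : init_sum (mw w) n = (m 1%N w + \sum_(2 <= t < n.+1) mw w t)%N.
    by rewrite /init_sum big_ltn.
  by rewrite /edge_count edge_sum_cst mul1r /dev iE natrD; ring.
apply: le_trans (ler_normB _ _) _; rewrite /dev_err lerD2l big_ltn // divr1.
rewrite ler_wpDr ?sumr_ge0 //.
have m0 : 0 <= (m 1%N w)%:R :> R by exact: ler0n.
have e0 := normr_ge0 (dev (mw w) mu 1).
rewrite ger0_norm // -[(mw w 1)%:R]/((m 1%N w)%:R).
set x := (m 1%N w)%:R in m0 *; set y := `|_| in e0 *.
by nra.
Qed.

Let dev0 := dev_err_mean_cvg m_iid m_moment2.

Let cvg_dev (F : nat -> T -> R) (C l : R) :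
  (forall n w, (1 <= n)%N -> `|F n w - l * n%:R| <= C * dev_err (mw w) mu n) ->
  F nw.1 nw.2 / nw.1%:R @[nw --> whp P] --> l.
Proof.
move=> FC; have H0 : C * (dev_err (mw nw.2) mu nw.1 / nw.1%:R) @[nw --> whp P] --> 0.
  by rewrite -[X in _ --> X](mulr0 C); apply: cvgMr; exact: dev0.
have H : F nw.1 nw.2 / nw.1%:R - l @[nw --> whp P] --> 0.
  apply: cvg0_norm_le H0; apply: whp_near; exists 1%N => // n /= n1 w.
  have n0 : 0 < n%:R :> R by rewrite ltr0n.
  have -> : F n w / n%:R - l = (F n w - l * n%:R) / n%:R by field; rewrite gt_eqF.
  by rewrite normrM normfV (gtr0_norm n0) mulrA ler_pM2r ?invr_gt0 // FC.
have : F nw.1 nw.2 / nw.1%:R - l + l @[nw --> whp P] --> 0 + l.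
  by apply: cvgD => //; exact: cvg_cst.
rewrite add0r => H'; apply: cvg_trans H'; apply: near_eq_cvg; near=> nw.
by rewrite subrK.
Unshelve. all: by end_near. Qed.

Lemma edge_count_mean_cvg : edge_count nw.1 nw.2 / nw.1%:R @[nw --> whp P] --> mu.
Proof. by apply: (@cvg_dev _ 1) => n w n1; rewrite mul1r; exact: edge_count_dev. Qed.

Let ratio_dev n w : edge_sum (mw w) n (fun t i =>
    `|t%:R / total_weight (mw w) (cw w) t i.-1 delta0 - s0^-1|)
  <= 4 * mu / (1 + delta0) * dev_err (mw w) mu n.
Proof. exact: (edge_sum_weight_ratio (mw_gt0 w) (@cw_lt w)). Qed.

Lemma score_mean_cvg0 : mart_inv 1 nw.1 nw.2 / nw.1%:R @[nw --> whp P] --> 0.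
Proof. exact: (mart_mean_cvg0 delta_gt m_pos m_iid m_moment2 model norm_inv_deg). Qed.

(** The sum of the inverses is the score plus the sum of the ratios [t / S]; the score is negligible
    and the ratios tend to [1 / s0]. *)
Lemma inv_deg_sum_mean_cvg :
  inv_deg_sum (mw nw.2) (cw nw.2) nw.1 delta0 / nw.1%:R @[nw --> whp P] --> mu / s0.
Proof.
have s1 := s0_ge1.
pose W n w := edge_sum (mw w) n (fun t i =>
  t%:R / total_weight (mw w) (cw w) t i.-1 delta0).
have H1 : W nw.1 nw.2 / nw.1%:R @[nw --> whp P] --> mu / s0.
  apply: (@cvg_dev W (4 * mu / (1 + delta0) + 1)) => n w n1.
  have -> : W n w - mu / s0 * n%:R = edge_sum (mw w) n (fun t i =>
     t%:R / total_weight (mw w) (cw w) t i.-1 delta0 - s0^-1) +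
     s0^-1 * (edge_count n w - mu * n%:R).
    have E2 : edge_sum (mw w) n (fun _ _ => s0^-1) = s0^-1 * edge_count n w.
      by rewrite -edge_sumZ; apply: eq_edge_sum => t i _ _; rewrite mulr1.
    by rewrite edge_sumB -/(W n w) E2; ring.
  apply: le_trans (ler_normD _ _) _; rewrite [leRHS]mulrDl; apply: lerD.
    exact: le_trans (ler_norm_edge_sum _ _ _) (ratio_dev n w).
  rewrite normrM ger0_norm ?invr_ge0; last by lra.
  by apply: ler_pM; rewrite ?invr_ge0 ?edge_count_dev //; [lra|rewrite invf_le1; lra].
have H : mart_inv 1 nw.1 nw.2 / nw.1%:R + W nw.1 nw.2 / nw.1%:R @[nw --> whp P] --> 0 + mu / s0.
  by apply: cvgD => //; exact: score_mean_cvg0.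
rewrite add0r in H; apply: cvg_trans H; apply: near_eq_cvg.
apply: whp_near; exists 1%N => // n /= n1 w.
rewrite -mulrDl mart_inv_score // -edge_sumD; congr (_ / _).
by apply: eq_edge_sum => t i _ _; rewrite subrK.
Qed.

Definition inv_deg_sqr_sum n w : R :=
  edge_sum (mw w) n (fun t i => ((chosen_deg (mw w) (cw w) t i)%:R + delta0) ^- 2).

Definition fisher_sum K : R := \sum_(1 <= k < K) mu * q_of mu delta0 p k / (k%:R + delta0) ^+ 2.

Let p_ge0 k : 0 <= p k.
Proof. exact: (limit_degrees_ge0 delta_gt m_pos m_iid m_moment2 model p_def). Qed.

Let fisher_term k : mu * q_of mu delta0 p k / (k%:R + delta0) ^+ 2 =
  rate m delta0 k * p k * (k%:R + delta0) ^- 2.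
Proof. by rewrite /q_of /rate; ring. Qed.

Let k_gt0 k : (1 <= k)%N -> 1 <= k%:R :> R /\ 0 < k%:R + delta0.
Proof.
by move=> k1; have d1' := d1; have k1' : 1 <= k%:R :> R by [rewrite ler1n]; split=> //; lra.
Qed.

(** The terms are nonnegative and at most [mu / (1 + delta0) * p k], and [p] has total mass at most
    1. *)
Lemma fisher_sum_cvg : cvgn fisher_sum.
Proof.
have s1 := s0_ge1; have d1' := d1; have mu1 := mu_ge1.
have T0 k : (1 <= k)%N -> 0 <= mu * q_of mu delta0 p k / (k%:R + delta0) ^+ 2.
  move=> /k_gt0[k1 kd]; rewrite /q_of divr_ge0 ?sqr_ge0 // mulr_ge0 ?divr_ge0 ?mulr_ge0 //; lra.
apply: nondecreasing_is_cvgn.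
  apply/nondecreasing_seqP => -[|K]; rewrite /fisher_sum; first by rewrite !big_geq.
  by rewrite [leRHS]big_nat_recr //= lerDl T0.
exists (mu / (1 + delta0)) => _ [K _ <-].
apply: (@le_trans _ _ (\sum_(1 <= k < K) mu / (1 + delta0) * p k)); last first.
  rewrite -mulr_sumr ler_piMr ?divr_ge0 //; [lra|lra|].
  exact: (sum_limit_degrees_le1 delta_gt m_pos m_iid m_moment2 model p_def).
apply: ler_sum_nat => k /andP[/k_gt0[k1 kd] _].
have -> : mu * q_of mu delta0 p k / (k%:R + delta0) ^+ 2 =
    mu * p k * ((k%:R + delta0)^-1 * s0^-1).
  by rewrite /q_of; field; rewrite !gt_eqF //; lra.
rewrite [leRHS]mulrAC; apply: ler_wpM2l; first by rewrite mulr_ge0 //; lra.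
rewrite -[leRHS]mulr1; apply: ler_pM; rewrite ?invr_ge0 ?invf_le1 //; try lra.
by rewrite lef_pV2 ?posrE; lra.
Qed.

(** Frequencies converge for each degree separately, so the sum is cut at a degree [K]; an edge
    towards a vertex of degree at least [K] contributes at most [(K + delta0) ^- 2], and there are
    about [mu * n] edges. *)
Lemma inv_deg_sqr_sum_cvg :
  inv_deg_sqr_sum nw.1 nw.2 / nw.1%:R @[nw --> whp P] --> limn fisher_sum.
Proof.
have mu1 := mu_ge1; have d1' := d1.
set L := limn fisher_sum; have FL : fisher_sum @ \oo --> L := fisher_sum_cvg.
pose X (K : nat) (nw : nat * T) : R := \sum_(1 <= k < K)
  (k%:R + delta0) ^- 2 * ((chosen_count (mw nw.2) (cw nw.2) nw.1 k)%:R / nw.1%:R).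
have XK K : X K nw @[nw --> whp P] --> fisher_sum K.
  rewrite /fisher_sum; under eq_bigr do rewrite fisher_term mulrC.
  apply: (@cvg_bigsum R nat _ (whp P) _ (index_iota 1 K) (fun k nw => (k%:R + delta0) ^- 2 *
    ((chosen_count (mw nw.2) (cw nw.2) nw.1 k)%:R / nw.1%:R))) => k.
  apply: cvgMr.
  exact: (chosen_count_mean_cvg delta_gt m_pos m_iid m_moment2 model p_def).
have sq0 : ((K%:R + delta0) ^- 2) @[K --> \oo] --> (0 : R).
  apply: (@cvg0_norm_le _ _ _ _ _ (fun K => 2 * K%:R^-1)); last first.
    by rewrite -[X in _ --> X](mulr0 2); apply: cvgMr; exact: cvg_invn.
  exists 2%N => // K /= K2.
  have K2' : 2 <= K%:R :> R by rewrite ler_nat.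
  rewrite ger0_norm ?invr_ge0 ?sqr_ge0 // -[2 as X in X * _]invrK -invfM.
  by rewrite lef_pV2 ?posrE; nra.
pose E (nw : nat * T) := edge_count nw.1 nw.2.
have tail K nw : (1 <= K)%N -> (1 <= nw.1)%N ->
    `|X K nw - inv_deg_sqr_sum nw.1 nw.2 / nw.1%:R| <= (K%:R + delta0) ^- 2 * (E nw / nw.1%:R).
  case: nw => n w K1 /= n1; have n0 : 0 < n%:R :> R by rewrite ltr0n.
  have XE : X K (n, w) = edge_sum (mw w) n (fun t i => \sum_(1 <= k < K)
      (k%:R + delta0) ^- 2 * (chosen_deg (mw w) (cw w) t i == k)%:R) / n%:R.
    rewrite /X -edge_sum_exchange mulr_suml; apply: eq_bigr => k _.
    by rewrite edge_sumZ -chosen_countE mulrA.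
  rewrite XE -mulrBl normrM [ `|n%:R^-1| ]ger0_norm ?invr_ge0 ?(ltW n0) //.
  rewrite mulrA ler_pM2r ?invr_gt0 // /E /edge_count -edge_sumZ -edge_sumB.
  apply: le_trans (ler_norm_edge_sum _ _ _) _; apply: ler_edge_sum => t i /andP[t2 _] im.
  have D1 := chosen_deg_gt0 (mw_gt0 w) (@cw_lt w) t2 im.
  set D := chosen_deg _ _ _ _ in D1 *; rewrite mulr1.
  have [DK|KD] := ltnP D K.
    rewrite (sum_pick (fun k => (k%:R + delta0) ^- 2)) ?D1 // subrr normr0.
    by rewrite invr_ge0 sqr_ge0.
  rewrite big_nat big1 ?sub0r ?normrN; last first.
    by move=> k /andP[_ kK]; rewrite gtn_eqF ?mulr0 // (leq_trans kK).
  have [KR Kd] := k_gt0 K1; have : K%:R <= D%:R :> R by rewrite ler_nat.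
  move=> KDR; rewrite ger0_norm ?invr_ge0 ?sqr_ge0 // lef_pV2 ?posrE ?exprn_gt0 //; [|lra].
  by rewrite lerXn2r ?nnegrE; lra.
apply/cvgrPdist_le => e e0.
have e3 : 0 < e / 3 by lra.
have eM : 0 < e / 3 / (mu + 1) by rewrite divr_gt0 //; lra.
move/cvgrPdist_le : (FL) => /(_ _ e3) HL; move/cvgr0Pnorm_le : (sq0) => /(_ _ eM) Hs.
have [K [K1 LK sK]] : exists K, [/\ (1 <= K)%N, `|L - fisher_sum K| <= e / 3 &
    `|(K%:R + delta0) ^- 2| <= e / 3 / (mu + 1)].
  near \oo => K; exists K; split.
  - by near: K; exact: nbhs_infty_gt.
  - by near: K.
  - by near: K.
move/cvgrPdist_le : (XK K) => /(_ _ e3) HX.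
have mu1' : mu < mu + 1 by lra.
have HE : \forall nw \near whp P, E nw / nw.1%:R <= mu + 1.
  exact: (cvgr_le _ edge_count_mean_cvg _ mu1').
have HN : \forall nw \near whp P, (1 <= nw.1)%N by apply: whp_near; exists 1%N.
near=> nw.
have n1 : (1 <= nw.1)%N by near: nw.
have h1 : `|fisher_sum K - X K nw| <= e / 3 by near: nw.
have h2 : E nw / nw.1%:R <= mu + 1 by near: nw.
have h3 := tail K nw K1 n1.
have E0 : 0 <= E nw / nw.1%:R by rewrite divr_ge0 // /E /edge_count edge_sum_cst mul1r.
have h4 : (K%:R + delta0) ^- 2 * (E nw / nw.1%:R) <= e / 3.
  apply: (@le_trans _ _ (e / 3 / (mu + 1) * (mu + 1))); last by rewrite divfK //; lra.
  by apply: ler_pM => //; [rewrite invr_ge0 sqr_ge0|apply: le_trans sK; exact: ler_norm].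
set A := inv_deg_sqr_sum _ _ / _ in h3 *.
have -> : L - A = (L - fisher_sum K) + (fisher_sum K - X K nw) + (X K nw - A) by ring.
apply: le_trans (ler_normD _ _) _; apply: le_trans (lerD (ler_normD _ _) (lexx _)) _.
by lra.
Unshelve. all: by end_near. Qed.

Local Notation nu0 := (nu mu delta0 p).

Lemma nu_fisher_sum : nu0 = limn fisher_sum - mu / s0 ^+ 2.
Proof. by []. Qed.

Let weight_sqr_mean_cvg :
  edge_sum (mw nw.2) nw.1 (fun t i => t%:R / total_weight (mw nw.2) (cw nw.2) t i.-1 delta0 *
    (t%:R / total_weight (mw nw.2) (cw nw.2) t i.-1 delta0)) / nw.1%:R
  @[nw --> whp P] --> mu / s0 ^+ 2.
Proof.
have s1 := s0_ge1.
pose W n w := edge_sum (mw w) n (fun t i =>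
  t%:R / total_weight (mw w) (cw w) t i.-1 delta0 *
  (t%:R / total_weight (mw w) (cw w) t i.-1 delta0)).
apply: (@cvg_dev W (8 * mu * inv_bound delta0 ^+ 2 + 1)) => n w n1.
have -> : W n w - mu / s0 ^+ 2 * n%:R = edge_sum (mw w) n (fun t i =>
   t%:R / total_weight (mw w) (cw w) t i.-1 delta0 *
   (t%:R / total_weight (mw w) (cw w) t i.-1 delta0) - s0^-1 * s0^-1) +
   s0^-1 * s0^-1 * (edge_count n w - mu * n%:R).
  have E2 : edge_sum (mw w) n (fun _ _ => s0^-1 * s0^-1) = s0^-1 * s0^-1 * edge_count n w.
    by rewrite -edge_sumZ; apply: eq_edge_sum => t i _ _; rewrite mulr1.
  by rewrite edge_sumB -/(W n w) E2 expr2 invfM; ring.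
apply: le_trans (ler_normD _ _) _; rewrite [leRHS]mulrDl; apply: lerD.
  apply: le_trans (ler_norm_edge_sum _ _ _) _.
  exact: (weight_prod_sum (mw_gt0 w) (@cw_lt w) delta_gt mu_ge1 n (lexx _) (lexx _)).
have i1 : s0^-1 <= 1 by rewrite invf_le1; lra.
have i0 : 0 <= s0^-1 by rewrite invr_ge0; lra.
rewrite normrM ger0_norm ?mulr_ge0 //.
by apply: ler_pM; rewrite ?mulr_ge0 ?edge_count_dev //; nra.
Qed.

Lemma info_mean_cvg :
  info (mw nw.2) (cw nw.2) nw.1 delta0 delta0 / nw.1%:R @[nw --> whp P] --> nu0.
Proof.
rewrite nu_fisher_sum.
have H := cvgB inv_deg_sqr_sum_cvg weight_sqr_mean_cvg.
have {}H : inv_deg_sqr_sum nw.1 nw.2 / nw.1%:R -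
  edge_sum (mw nw.2) nw.1 (fun t i => t%:R / total_weight (mw nw.2) (cw nw.2) t i.-1 delta0 *
    (t%:R / total_weight (mw nw.2) (cw nw.2) t i.-1 delta0)) / nw.1%:R
  @[nw --> whp P] --> limn fisher_sum - mu / s0 ^+ 2 by exact: H.
apply: cvg_trans H; apply: near_eq_cvg; near=> nw.
rewrite -mulrBl -edge_sumB; congr (_ / _); exact: eq_edge_sum.
Unshelve. all: by end_near. Qed.

(** With [x = 1 / (D + delta0)] and [r = t / S], one has [(x - r) ^+ 2 = x ^+ 2 - r ^+ 2 - 2 * r *
    (x - r)]. The first two terms sum to the information; in the last one [r] may be replaced by
    [1 / s0], which leaves a multiple of the score. *)
Lemma mart_inv2_mean_cvg : mart_inv 2 nw.1 nw.2 / nw.1%:R @[nw --> whp P] --> nu0.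
Proof.
have s1 := s0_ge1.
pose A := inv_bound delta0.
pose r w t i : R := t%:R / total_weight (mw w) (cw w) t i.-1 delta0.
pose x w t i : R := ((chosen_deg (mw w) (cw w) t i)%:R + delta0)^-1.
pose C n w := edge_sum (mw w) n (fun t i => (r w t i - s0^-1) * (x w t i - r w t i)).
have C0 : C nw.1 nw.2 / nw.1%:R @[nw --> whp P] --> 0.
  apply: (@cvg_dev C (2 * A * (4 * mu / (1 + delta0)))) => n w n1.
  rewrite mul0r subr0; apply: le_trans (ler_norm_edge_sum _ _ _) _.
  rewrite -mulrA; have A0 : 0 <= 2 * A by rewrite mulr_ge0 // (le_trans ler01) // inv_bound_ge1.
  apply: le_trans (ler_wpM2l A0 (ratio_dev n w)).
  rewrite -edge_sumZ; apply: ler_edge_sum => t i /andP[t2 _] im.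
  have [dx dA] := deg_shift_bounds (mw_gt0 w) (@cw_lt w) delta_gt t2 im (lexx delta0).
  have [_ /andP[r0 rA]] := weight_ratio_bounds (mw_gt0 w) (@cw_lt w) delta_gt t2 im (lexx delta0).
  rewrite normrM mulrC ler_wpM2r //; apply: le_trans (ler_normB _ _) _.
  have -> : 2 * A = A + A by ring.
  by rewrite lerD // ger0_norm // invr_ge0 ltW.
have H : info (mw nw.2) (cw nw.2) nw.1 delta0 delta0 / nw.1%:R -
   2 * (C nw.1 nw.2 / nw.1%:R + s0^-1 * (mart_inv 1 nw.1 nw.2 / nw.1%:R))
   @[nw --> whp P] --> nu0 - 2 * (0 + s0^-1 * 0).
  apply: cvgB; first exact: info_mean_cvg.
  by apply: cvgMr; apply: cvgD => //; apply: cvgMr; exact: score_mean_cvg0.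
rewrite mulr0 addr0 mulr0 subr0 in H; apply: cvg_trans H.
apply: near_eq_cvg; apply: whp_near; exists 1%N => // n /= n1 w.
rewrite !mart_inv_edge_sum // mulrA -mulrDl mulrA -mulrBl -[s0^-1 * _]edge_sumZ -edge_sumD.
rewrite -edge_sumZ -edge_sumB; congr (_ / _); apply: eq_edge_sum => t i /andP[t2 _] im.
have [dx _] := deg_shift_bounds (mw_gt0 w) (@cw_lt w) delta_gt t2 im (lexx delta0).
have [sx _] := weight_ratio_bounds (mw_gt0 w) (@cw_lt w) delta_gt t2 im (lexx delta0).
rewrite invfM -/(x w t i) -/(r w t i).
by ring.
Qed.

Let deg_sum_balance :
  `|s0 * inv_deg_sum (mw nw.2) (cw nw.2) nw.1 delta0 - edge_count nw.1 nw.2| / nw.1%:R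
  @[nw --> whp P] --> 0.
Proof.
have s1 := s0_ge1.
have H : s0 * (inv_deg_sum (mw nw.2) (cw nw.2) nw.1 delta0 / nw.1%:R) -
   edge_count nw.1 nw.2 / nw.1%:R @[nw --> whp P] --> s0 * (mu / s0) - mu.
  by apply: cvgB; [apply: cvgMr; exact: inv_deg_sum_mean_cvg|exact: edge_count_mean_cvg].
have e0 : s0 * (mu / s0) - mu = 0 by field; rewrite gt_eqF //; lra.
rewrite e0 in H.
have {}H : `|s0 * (inv_deg_sum (mw nw.2) (cw nw.2) nw.1 delta0 / nw.1%:R) -
   edge_count nw.1 nw.2 / nw.1%:R| @[nw --> whp P] --> `|0 : R| by exact: cvg_norm.
rewrite normr0 in H.
apply: cvg_trans H; apply: near_eq_cvg; near=> nw.
by rewrite /= mulrA -mulrBl normrM [ `|_^-1| ]ger0_norm // invr_ge0.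
Unshelve. all: by end_near. Qed.

Let r_gt0 : exists2 k, (1 <= k)%N & 0 < init_prob m k.
Proof.
apply: contrapT => H.
have r0 k : P (m 1%N @^-1` [set k]) = 0%E.
  case: k => [|k].
    rewrite (_ : _ @^-1` _ = set0) ?measure0 //; apply/seteqP; split => w //= m0.
    by have := m_pos w (leqnn 1); rewrite m0.
  apply/eqP; apply/negPn/negP => rk; apply: H; exists k.+1 => //.
  rewrite lt0r (init_prob_ge0 m k.+1) andbT /init_prob.
  apply: contra rk => /eqP rk; rewrite -[X in X == _]fineK ?fin_num_measure //.
    by apply/eqP; congr EFin.
  exact: (cmeasurable_RV (m 1%N)).
have : \int[P]_w (cst 1 w : R) = \int[P]_w (cst 0 w).
  apply: (eq_integral_fibers (s := m 1%N)).
  - exact: cmeasurable_RV.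
  - by apply: (@bounded_integrable _ _ _ P (cst 1) 1) => // w; rewrite /= normr1.
  - by apply: (@bounded_integrable _ _ _ P (cst 0) 0) => // w; rewrite /= normr0.
  - have c0 (x : R) k : (\int[P]_(w in m 1%N @^-1` [set k]) (cst x w)%:E = 0)%E.
      transitivity (x%:E * P (m 1%N @^-1` [set k]))%E; last by rewrite r0 mule0.
      rewrite (_ : (fun w => (cst x w)%:E) = cst x%:E) // integral_cst //.
      exact: (cmeasurable_RV (m 1%N)).
    by move=> k; rewrite !c0.
rewrite !Rintegral_cst // mul0r [fine _](_ : _ = 1); last first.
  by rewrite -[RHS]/(fine 1%E) -(probability_setT P).
by rewrite mulr1 => /eqP; rewrite oner_eq0.
Qed.

(** A degree charged by the initial law has positive limiting frequency, and by the recursion so has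
    the next one; two consecutive degrees cannot both equal [2 * mu]. *)
Let p_gt0 : exists k, [/\ (1 <= k)%N, 0 < p k & k%:R != 2 * mu].
Proof.
have pS k : p k.+1 =
    (rate m delta0 k * p k + init_prob m k.+1) / (1 + rate m delta0 k.+1).
  have := limit_degreesS delta_gt m_pos m_moment2 p_def k.
  have c0 := rate_ge0 delta_gt m_pos m_moment2 (ltn0Sn k).
  by move=> pE; apply: (@mulIf _ (1 + rate m delta0 k.+1)); [rewrite gt_eqF //; lra|
    rewrite divfK; [lra|rewrite gt_eqF //; lra]].
have cp k : 0 <= rate m delta0 k * p k.
  case: k => [|k]; first by have [-> _] := p_def; rewrite mulr0.
  by rewrite mulr_ge0 // (rate_ge0 delta_gt m_pos m_moment2).
have c1 k : 0 < 1 + rate m delta0 k.+1.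
  by have := rate_ge0 delta_gt m_pos m_moment2 (ltn0Sn k); lra.
have [[//|k] _ rk] := r_gt0.
have pk : 0 < p k.+1 by rewrite pS // divr_gt0 // ltr_wpDl.
have pk1 : 0 < p k.+2.
  rewrite pS // divr_gt0 // ltr_pwDl ?init_prob_ge0 // mulr_gt0 //.
  have [kR kd] := k_gt0 (ltn0Sn k); have := mu_ge1; have := s0_ge1 => s1 m1.
  by rewrite /rate mulr_gt0 // divr_gt0; lra.
have [e|ne] := eqVneq (k.+1%:R : R) (2 * mu).
  by exists k.+2; split => //; rewrite -e eqr_nat; lia.
by exists k.+1; split.
Qed.

Lemma info_lower_whp (lo hi : R) : -1 < lo -> lo <= delta0 -> exists2 q : R, 0 < q &
  \forall nw \near whp P, forall delta, lo <= delta <= hi ->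
    q * nw.1%:R <= info (mw nw.2) (cw nw.2) nw.1 delta0 delta.
Proof.
move=> lo1 lod; have mu1 := mu_ge1.
have [k [k1 pk kmu]] := p_gt0; have [kR kd] := k_gt0 k1.
(* For an empty range of parameters the claim is vacuous; otherwise [hi > -1], and the denominator
   of [kap] is positive. *)
have [hlo|hlo] := ltP hi lo.
  exists 1 => //; apply: nearW => nw delta /andP[h1 h2]; have := le_trans h1 h2.
  by rewrite leNgt hlo.
pose kap := (k%:R - 2 * mu) ^+ 2 / ((k%:R + hi) * (k%:R + delta0) * (2 * mu + hi) ^+ 2).
have kap0 : 0 < kap.
  rewrite divr_gt0 //; first by rewrite lt0r sqr_ge0 andbT sqrf_eq0 subr_eq0.
  by rewrite !mulr_gt0 ?exprn_gt0 //; lra.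
pose l := rate m delta0 k * p k.
have l0 : 0 < l.
  by rewrite mulr_gt0 // /rate mulr_gt0 // divr_gt0 //; [lra|have := s0_ge1; lra].
pose G (nw : nat * T) := kap * ((chosen_count (mw nw.2) (cw nw.2) nw.1 k)%:R / nw.1%:R) -
  2 * (`|s0 * inv_deg_sum (mw nw.2) (cw nw.2) nw.1 delta0 - edge_count nw.1 nw.2| / nw.1%:R) -
  8 * mu * inv_bound lo ^+ 2 * (dev_err (mw nw.2) mu nw.1 / nw.1%:R).
have H : G nw @[nw --> whp P] --> kap * l - 2 * 0 - 8 * mu * inv_bound lo ^+ 2 * 0.
  apply: cvgB; [apply: cvgB|]; apply: cvgMr.
  - exact: (chosen_count_mean_cvg delta_gt m_pos m_iid m_moment2 model p_def).
  - exact: deg_sum_balance.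
  - exact: dev0.
rewrite !mulr0 !subr0 in H.
have kl : kap * l / 2 < kap * l by have := mulr_gt0 kap0 l0; lra.
exists (kap * l / 2); first by rewrite divr_gt0 // mulr_gt0.
have {}H : \forall nw \near whp P, kap * l / 2 <= G nw by exact: (cvgr_ge _ H _ kl).
have HN : \forall nw \near whp P, (1 <= nw.1)%N by apply: whp_near; exists 1%N.
near=> nw => delta /andP[h1 h2].
have n1 : (1 <= nw.1)%N by near: nw.
have n0 : 0 < nw.1%:R :> R by rewrite ltr0n.
apply: le_trans (info_lower (mw_gt0 nw.2) (@cw_lt nw.2) lo1 mu_ge1 nw.1 k1 lod h1 h2).
rewrite -ler_pdivlMr // !mulrBl -/kap.
have : kap * l / 2 <= G nw by near: nw.
by rewrite /G !mulrA.
Unshelve. all: by end_near. Qed.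

(** Positivity is inherited from the lower bound on the information, used with the single parameter
    [delta0], and not read off from the formula. *)
Lemma nu_gt0 : 0 < nu0.
Proof.
have [q q0 H] := info_lower_whp delta0 delta_gt (lexx delta0).
apply: lt_le_trans q0 _; apply: (cvgr_to_ge info_mean_cvg).
have HN : \forall nw \near whp P, (1 <= nw.1)%N by apply: whp_near; exists 1%N.
near=> nw; have n1 : (1 <= nw.1)%N by near: nw.
rewrite ler_pdivlMr ?ltr0n //.
have : forall delta, delta0 <= delta <= delta0 ->
  q * nw.1%:R <= info (mw nw.2) (cw nw.2) nw.1 delta0 delta by near: nw.
by apply; rewrite lexx.
Unshelve. all: by end_near. Qed.

End FisherInformation.

(** * Asymptotic normality of the estimator *)

Lemma tight_scale d (T : measurableType d) (R : realType) (P : probability T R)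
    (X : nat -> T -> R) (k : R) : tight P X -> tight P (fun n w => X n w * k).
Proof.
move=> tX e e0; have [K XK] := tX e e0; exists (K * `|k|).
apply: filterS XK => n [B [mB PB XB]]; exists B; split=> // w nB.
by rewrite normrM ler_wpM2r // XB.
Qed.

Lemma cos_dist_le (R : realType) (x y : R) : `|cos x - cos y| <= `|x - y| + (x - y) ^+ 2.
Proof.
set z := x - y; have -> : x = y + z by rewrite /z; ring.
have [s1 [c1 _]] := sin_cos_taylor z.
have -> : cos (y + z) - cos y = cos y * (cos z - 1) - sin y * sin z by rewrite cosD; ring.
apply: le_trans (ler_normB _ _) _; rewrite !normrM addrC; apply: lerD.
  by apply: le_trans s1; rewrite ler_piMl // sin_max.
by apply: le_trans c1; rewrite ler_piMl // cos_max.
Qed.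

Section AsymptoticNormality.
Context (R : realType) d (T : measurableType d) (P : probability T R).
Variables (m : nat -> {RV P >-> nat}) (c : nat -> nat -> {RV P >-> nat}).
Variables (a b delta0 : R) (p : nat -> R) (deltahat : nat -> {RV P >-> R}).
Hypothesis m_pos : forall t w, (1 <= t)%N -> (1 <= m t w)%N.
Hypothesis m_iid : iid m.
Hypothesis m_moment2 : ('E_P[(fun w => (m 1%N w)%:R ^+ 2)%R] < +oo)%E.
Hypothesis a_lt1 : -1 < - a.
Hypothesis delta0_interior : - a < delta0 < b.
Hypothesis model : is_PA m c delta0.
Hypothesis mle : is_MLE m c a b deltahat.

Local Notation mw := (m_at m).
Local Notation cw := (c_at c).
Local Notation mu := (init_mean m).

Hypothesis p_def : limit_degrees mu (init_prob m) delta0 p.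

Local Notation nu0 := (nu mu delta0 p).

Let delta_gt : -1 < delta0.
Proof. have := a_lt1; have := delta0_interior; lra. Qed.

Let lo_le : - a <= delta0.
Proof. have := delta0_interior; lra. Qed.

Let mw_gt0 w : forall t, (1 <= t)%N -> (1 <= mw w t)%N.
Proof. by move=> t; exact: m_pos. Qed.

Let cw_lt w t i : (2 <= t)%N -> (1 <= i <= mw w t)%N -> (cw w t i < t)%N.
Proof. exact: (PA_range model). Qed.

Let nu0_gt0 : 0 < nu0 := nu_gt0 delta_gt m_pos m_iid m_moment2 model p_def.

Local Notation U := (mart_inv m c delta0 1).
Local Notation x n w := (deltahat n w - delta0).
Local Notation I n w delta := (info (mw w) (cw w) n delta0 delta).

Lemma mle_score n w y : (1 <= n)%N -> - a <= y <= b ->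
  (y - deltahat n w) * score (mw w) (cw w) n (deltahat n w) <= 0.
Proof.
move=> n1 /andP[y1 y2]; have [/andP[d1 d2] dmax] := mle w n1.
apply: (maximizer_score (mw_gt0 w) (@cw_lt w) a_lt1 n1 d1 y1) => e e0 e1.
by apply: dmax; apply/andP; split; nra.
Qed.

Let score_mle n w : (1 <= n)%N -> score (mw w) (cw w) n (deltahat n w) =
  U n w - x n w * I n w (deltahat n w).
Proof.
move=> n1; have [/andP[d1 d2] _] := mle w n1.
rewrite (score_diff (mw_gt0 w) (@cw_lt w) a_lt1 n lo_le d1).
by rewrite (mart_inv_score delta_gt m_pos model).
Qed.

Let whp_ge1 : \forall nw \near whp P, (1 <= nw.1)%N.
Proof. by apply: whp_near; exists 1%N. Qed.

(** Testing the maximizer against [delta0] gives [x ^+ 2 * I <= x * U], wherever the maximizer lies;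
    then [I >= q * n] uniformly. *)
Lemma mle_error_whp : exists2 q : R, 0 < q &
  \forall nw \near whp P, `|x nw.1 nw.2| * (q * nw.1%:R) <= `|U nw.1 nw.2|.
Proof.
have [q q0 H] := info_lower_whp delta_gt m_pos m_iid m_moment2 model p_def b a_lt1 lo_le.
exists q => //; near=> nw.
have n1 : (1 <= nw.1)%N by near: nw; exact: whp_ge1.
have h : forall delta, - a <= delta <= b -> q * nw.1%:R <= I nw.1 nw.2 delta by near: nw.
have [dab _] := mle nw.2 n1; have {}h := h _ dab.
have [l1 l2] := andP delta0_interior.
have d0ab : - a <= delta0 <= b by rewrite !ltW.
have := mle_score nw.2 n1 d0ab; rewrite score_mle //.
have n0 : 0 < nw.1%:R :> R by rewrite ltr0n.
set z := x _ _; set i := I _ _ _ in h *; set u := U _ _.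
have -> : delta0 - deltahat nw.1 nw.2 = - z by rewrite /z; ring.
move=> H1; have H2 : z ^+ 2 * i <= `|z| * `|u|.
  by rewrite -normrM; apply: le_trans (ler_norm _); lra.
have H3 : z ^+ 2 * (q * nw.1%:R) <= `|z| * `|u|.
  by apply: le_trans H2; rewrite ler_wpM2l // sqr_ge0.
have [->|z0] := eqVneq z 0; first by rewrite normr0 mul0r.
rewrite -(ler_pM2l (_ : 0 < `|z|)) ?normr_gt0 //; apply: le_trans H3.
by rewrite -(real_normK (num_real z)) le_eqVlt; apply/orP; left; apply/eqP; ring.
Unshelve. all: by end_near. Qed.

Let score_mean0 : U nw.1 nw.2 / nw.1%:R @[nw --> whp P] --> 0.
Proof. exact: (score_mean_cvg0 delta_gt m_pos m_iid m_moment2 model). Qed.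

Lemma mle_consistent : x nw.1 nw.2 @[nw --> whp P] --> 0.
Proof.
have [q q0 H] := mle_error_whp.
have H0 : q^-1 * `|U nw.1 nw.2 / nw.1%:R| @[nw --> whp P] --> q^-1 * `|0 : R|.
  by apply: cvgMr; exact: cvg_norm.
rewrite normr0 mulr0 in H0; apply: cvg0_norm_le H0; near=> nw.
have n1 : (1 <= nw.1)%N by near: nw; exact: whp_ge1.
have n0 : 0 < nw.1%:R :> R by rewrite ltr0n.
rewrite normrM normfV (gtr0_norm n0) mulrCA -invfM ler_pdivlMr ?mulr_gt0 //.
by near: nw.
Unshelve. all: by end_near. Qed.

(** By consistency the estimator is eventually interior with high probability; testing it against
    both endpoints then forces the score to vanish. *)
Lemma score_mle_eq0_whp :
  \forall nw \near whp P, U nw.1 nw.2 = x nw.1 nw.2 * I nw.1 nw.2 (deltahat nw.1 nw.2).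
Proof.
have [l1 l2] := andP delta0_interior.
pose r := Num.min (b - delta0) (delta0 + a).
have r0 : 0 < r by rewrite lt_min; apply/andP; split; lra.
move/cvgr0Pnorm_lt : mle_consistent => /(_ _ r0) H.
near=> nw.
have n1 : (1 <= nw.1)%N by near: nw; exact: whp_ge1.
have h : `|x nw.1 nw.2| < r by near: nw.
move: h; rewrite lt_min !ltr_norml => /andP[/andP[_ h1] /andP[h2 _]].
have ab1 : - a <= b <= b by rewrite lexx andbT; lra.
have ab2 : - a <= - a <= b by rewrite lexx /=; lra.
have := mle_score nw.2 n1 ab1; have := mle_score nw.2 n1 ab2.
rewrite score_mle //; set v := U _ _; set z := x _ _ * _.
have p1 : - a - deltahat nw.1 nw.2 < 0 by lra.
have p2 : 0 < b - deltahat nw.1 nw.2 by lra.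
by rewrite (nmulr_rle0 _ p1) (pmulr_rle0 _ p2) => *; lra.
Unshelve. all: by end_near. Qed.

Lemma info_mle_mean_cvg :
  I nw.1 nw.2 (deltahat nw.1 nw.2) / nw.1%:R @[nw --> whp P] --> nu0.
Proof.
have H0 : 2 * inv_bound (- a) ^+ 3 * (`|x nw.1 nw.2| * (edge_count m nw.1 nw.2 / nw.1%:R))
   @[nw --> whp P] --> 2 * inv_bound (- a) ^+ 3 * (`|0 : R| * mu).
  apply: cvgMr; apply: cvgM; first by apply: cvg_norm; exact: mle_consistent.
  exact: (edge_count_mean_cvg m_iid m_moment2).
rewrite normr0 mul0r mulr0 in H0.
have H : I nw.1 nw.2 (deltahat nw.1 nw.2) / nw.1%:R - I nw.1 nw.2 delta0 / nw.1%:R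
    @[nw --> whp P] --> 0.
  apply: cvg0_norm_le H0; near=> nw.
  have n1 : (1 <= nw.1)%N by near: nw; exact: whp_ge1.
  have n0 : 0 < nw.1%:R :> R by rewrite ltr0n.
  have [/andP[d1 d2] _] := mle nw.2 n1.
  rewrite -mulrBl normrM normfV (gtr0_norm n0) [leRHS]mulrA [leRHS]mulrA ler_pM2r ?invr_gt0 //.
  exact: (info_lipschitz (mw_gt0 nw.2) (@cw_lt nw.2) a_lt1 nw.1 lo_le d1).
have H1 : I nw.1 nw.2 (deltahat nw.1 nw.2) / nw.1%:R - I nw.1 nw.2 delta0 / nw.1%:R +
    I nw.1 nw.2 delta0 / nw.1%:R @[nw --> whp P] --> 0 + nu0.
  by apply: cvgD => //; exact: (info_mean_cvg delta_gt m_pos m_iid m_moment2 model p_def).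
rewrite add0r in H1; apply: cvg_trans H1; apply: near_eq_cvg; near=> nw.
by rewrite subrK.
Unshelve. all: by end_near. Qed.

Definition mle_scaled n w : R := Num.sqrt n%:R * x n w.

Local Notation W := mle_scaled.
Local Notation Z := (fun n w => U n w / Num.sqrt n%:R).

Let score_tight : tight P Z.
Proof. exact: (mart_tight delta_gt m_pos m_iid m_moment2 model (norm_inv_deg delta_gt)). Qed.

Let sqrt_split n : (1 <= n)%N -> 0 < Num.sqrt n%:R :> R /\
  n%:R = Num.sqrt n%:R * Num.sqrt n%:R :> R.
Proof. by move=> n1; rewrite sqrtr_gt0 ltr0n n1 -expr2 sqr_sqrtr. Qed.

Lemma mle_tight : tight P W.
Proof.
have [q q0 H] := mle_error_whp.
apply: (@tight_whp _ _ _ _ _ (fun n w => Z n w * q^-1)).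
  exact: tight_scale.
near=> nw.
have n1 : (1 <= nw.1)%N by near: nw; exact: whp_ge1.
have [s0 sE] := sqrt_split n1.
have h : `|x nw.1 nw.2| * (q * nw.1%:R) <= `|U nw.1 nw.2| by near: nw.
rewrite /mle_scaled !normrM !normfV (gtr0_norm q0) (gtr0_norm s0).
rewrite -mulrA -invfM ler_pdivlMr ?mulr_gt0 //.
apply: le_trans h; rewrite [X in _ <= _ * (q * X)]sE le_eqVlt; apply/orP; left.
by apply/eqP; ring.
Unshelve. all: by end_near. Qed.

(** Where the score vanishes the difference equals [W * (nu0 - I / n) / nu0], a tight sequence times
    one tending to 0 in probability. *)
Lemma mle_linearization : W nw.1 nw.2 - Z nw.1 nw.2 / nu0 @[nw --> whp P] --> 0.
Proof.
have H1 : nu0 - I nw.1 nw.2 (deltahat nw.1 nw.2) / nw.1%:R @[nw --> whp P] --> nu0 - nu0.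
  by apply: cvgB; [exact: cvg_cst|exact: info_mle_mean_cvg].
rewrite subrr in H1.
have H2 := tight_mul_cvg0 (Y := fun n w => nu0 - I n w (deltahat n w) / n%:R) mle_tight H1.
have H3 : W nw.1 nw.2 * (nu0 - I nw.1 nw.2 (deltahat nw.1 nw.2) / nw.1%:R) / nu0
    @[nw --> whp P] --> 0 * nu0^-1 by apply: cvgMl.
rewrite mul0r in H3; apply: cvg_trans H3; apply: near_eq_cvg; near=> nw.
have n1 : (1 <= nw.1)%N by near: nw; exact: whp_ge1.
have [s0 sE] := sqrt_split n1.
have -> : U nw.1 nw.2 = x nw.1 nw.2 * I nw.1 nw.2 (deltahat nw.1 nw.2).
  by near: nw; exact: score_mle_eq0_whp.
rewrite /mle_scaled; set s := Num.sqrt _ in s0 sE *; rewrite sE; field.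
by rewrite !gt_eqF.
Unshelve. all: by end_near. Qed.

Let mcos (f : T -> R) : measurable_fun setT f -> measurable_fun setT (fun w => cos (f w)).
Proof.
move=> mf; apply: measurableT_comp => //.
by apply: continuous_measurable_fun; exact: continuous_cos.
Qed.

Let mexp (f : T -> R) : measurable_fun setT f -> measurable_fun setT (fun w => expR (f w)).
Proof. by move=> mf; exact: measurableT_comp. Qed.

Lemma measurable_mle_scaled n : measurable_fun setT (W n).
Proof. by apply: measurable_funM => //; apply: measurable_funB. Qed.

(** By [mart_cos] the compensated cosine has a mean close to [cos phi]. Since [V] tends to the
    constant [kap], its exponential factor can be exchanged for [expR kap], and the linearization
    exchanges the score for the estimator. *)
Lemma mle_cos_cvg u phi : (\int[P]_w cos (u * W n w + phi) : R) @[n --> \oo] -->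
  expR (- (u ^+ 2 / nu0 / 2)) * cos phi.
Proof.
pose K := edge_rate m; pose C := (1 + delta0)^-1.
pose few n w : R := (few_edges m n (K * n) w)%:R.
pose kap := u ^+ 2 / nu0 / 2.
pose y n w := u / nu0 * Z n w + phi.
pose V n w := (u / nu0 / Num.sqrt n%:R) ^+ 2 * mart_inv m c delta0 2 n w / 2.
pose A n w := few n w * (cos (y n w) * expR (V n w) - cos phi).
(* A n has mean O(n^(-1/2)) by mart_cos, and r n tends to 0 in probability. *)
pose r n w := cos (u * W n w + phi) - expR (- kap) * cos phi - expR (- kap) * A n w.
(* A bound for [V n] on the event of few edges, uniform in [n]; it keeps the exponential bounded and
   allows passing from convergence in probability to means. *)
pose B := (u / nu0) ^+ 2 * ((2 * C) ^+ 2 * K%:R) / 2.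
have C0 : 0 < C by rewrite invr_gt0; have := delta_gt; lra.
have nu0' := nu0_gt0.
have VB n w : few_edges m n (K * n) w -> V n w <= B.
  move=> fw; rewrite /V /B ler_pM2r //.
  have M2 := norm_mart_PA_le delta_gt m_pos model (norm_inv_deg delta_gt) 2 w n.
  have {}M2 : mart_inv m c delta0 2 n w <= (2 * C) ^+ 2 * (K%:R * n%:R).
    apply: le_trans (ler_norm _) _; apply: le_trans M2 _.
    by rewrite ler_wpM2l ?sqr_ge0 // -natrM ler_nat.
  case: n fw M2 => [|n] fw M2.
    by rewrite sqrtr0 invr0 mulr0 expr0n mul0r mulr_ge0 ?sqr_ge0 // mulr_ge0 ?sqr_ge0.
  rewrite exprMn -mulrA ler_wpM2l ?sqr_ge0 // exprVn sqr_sqrtr ?ler0n //.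
  by rewrite mulrC ler_pdivrMr ?ltr0n // -mulrA.
have kap0 : 0 <= kap by rewrite !divr_ge0 ?sqr_ge0 // ltW.
have ek : 0 <= expR (- kap) <= 1 by rewrite expR_ge0 /= expR_le1; lra.
have cosn z : `|cos z| <= 1 :> R by exact: cos_max.
have AB n w : `|A n w| <= expR B + 1.
  rewrite /A /few; case: (boolP (few_edges m n (K * n) w)) => fw; last first.
    by rewrite mul0r normr0 addr_ge0 ?expR_ge0.
  rewrite mul1r; apply: le_trans (ler_normB _ _) _; rewrite lerD // normrM.
  rewrite [X in _ * X]ger0_norm ?expR_ge0 // -[leRHS]mul1r.
  by rewrite ler_pM ?expR_ge0 // ler_expR VB.
have rB n w : `|r n w| <= 1 + 1 + (expR B + 1).
  have [k0 k1] := andP ek.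
  apply: le_trans (ler_normB _ _) _; apply: lerD.
    apply: le_trans (ler_normB _ _) _; apply: lerD => //.
    by rewrite normrM (ger0_norm k0) -[leRHS]mulr1 ler_pM.
  by rewrite normrM (ger0_norm k0) -[leRHS]mul1r ler_pM.
have mfew n : measurable_fun setT (few n) by exact: measurable_few_edges.
have mmart k n : measurable_fun setT (mart_inv m c delta0 k n) by exact: measurable_mart.
have mA n : measurable_fun setT (A n).
  apply: measurable_funM => //; apply: measurable_funB => //; apply: measurable_funM.
    apply: mcos; apply: measurable_funD => //; apply: measurable_funM => //.
    exact: measurable_funM.
  apply: mexp; apply: measurable_funM => //; exact: measurable_funM.
have mcW n : measurable_fun setT (fun w => cos (u * W n w + phi)).
  apply: mcos; apply: measurable_funD => //; apply: measurable_funM => //.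
  exact: measurable_mle_scaled.
have mr n : measurable_fun setT (r n).
  by apply: measurable_funB; [exact: measurable_funB|exact: measurable_funM].
have r0 : r nw.1 nw.2 @[nw --> whp P] --> 0.
  have V0 : V nw.1 nw.2 @[nw --> whp P] --> kap.
    have H : (u / nu0) ^+ 2 * (mart_inv m c delta0 2 nw.1 nw.2 / nw.1%:R) / 2 @[nw --> whp P]
        --> (u / nu0) ^+ 2 * nu0 / 2.
      apply: cvgMl; apply: cvgMr.
      exact: (mart_inv2_mean_cvg delta_gt m_pos m_iid m_moment2 model p_def).
    have e1 : (u / nu0) ^+ 2 * nu0 / 2 = kap by rewrite /kap; field; rewrite gt_eqF.
    rewrite e1 in H; apply: cvg_trans H; apply: near_eq_cvg; near=> nw.
    by rewrite /V [(_ / Num.sqrt _) ^+ 2]exprMn exprVn sqr_sqrtr ?ler0n //; ring.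
  have D0 : u * (W nw.1 nw.2 - Z nw.1 nw.2 / nu0) @[nw --> whp P] --> u * 0.
    by apply: cvgMr; exact: mle_linearization.
  rewrite mulr0 in D0.
  have H : `|u * (W nw.1 nw.2 - Z nw.1 nw.2 / nu0)| + (u * (W nw.1 nw.2 - Z nw.1 nw.2 / nu0)) ^+ 2
     + `|1 - expR (- kap) * expR (V nw.1 nw.2)| @[nw --> whp P] -->
     `|0 : R| + 0 * 0 + `|1 - expR (- kap) * expR kap|.
    apply: cvgD; first apply: cvgD.
    - exact: cvg_norm.
    - exact: cvgM.
    - apply: cvg_norm; apply: cvgB; first exact: cvg_cst.
      apply: cvgMr; apply: (@continuous_cvg _ _ _ (whp P) _ _ (@expR R)) => //.
      exact: continuous_expR.
  rewrite -expRD addNr expR0 subrr normr0 mul0r !addr0 in H.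
  apply: cvg0_norm_le H; near=> nw.
  have fw : few_edges m nw.1 (K * nw.1) nw.2.
    by near: nw; exact: (edge_rate_whp m_pos m_iid m_moment2).
  rewrite /r /A /few fw mul1r.
  have -> : cos (u * W nw.1 nw.2 + phi) - expR (- kap) * cos phi -
      expR (- kap) * (cos (y nw.1 nw.2) * expR (V nw.1 nw.2) - cos phi) =
    (cos (u * W nw.1 nw.2 + phi) - cos (y nw.1 nw.2)) +
    cos (y nw.1 nw.2) * (1 - expR (- kap) * expR (V nw.1 nw.2)) by ring.
  apply: le_trans (ler_normD _ _) _; apply: lerD; last by rewrite normrM ler_piMl.
  have -> : u * (W nw.1 nw.2 - Z nw.1 nw.2 / nu0) = (u * W nw.1 nw.2 + phi) - y nw.1 nw.2.
    by rewrite /y; ring.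
  exact: cos_dist_le.
have Er : (\int[P]_w r n w : R) @[n --> \oo] --> (0 : R).
  apply: cvg0_norm_le (cvg_whp_bounded mr rB r0); near=> n.
  apply: le_normr_Rintegral => //.
  by apply: (@bounded_integrable _ _ _ P (r n) _ (mr n) (rB n)).
have EA : (\int[P]_w A n w : R) @[n --> \oo] --> (0 : R).
  (* With [L = K * n] and [b] of order [1 / Num.sqrt n], the bound of [mart_cos] is
     [e / Num.sqrt n]. *)
  pose e := expR B * (7 * (`|u / nu0| * (2 * C)) ^+ 3) * K%:R.
  have e0 : e * (Num.sqrt n%:R)^-1 @[n --> \oo] --> e * 0.
    by apply: cvgMr; exact: cvg_sqrt_inv.
  rewrite mulr0 in e0; apply: cvg0_norm_le e0.
  (* [mart_cos] requires [|b| * (2 * C) <= 1], which holds for large [n] only. *)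
  have b0 : `|u / nu0| * (2 * C) * (Num.sqrt n%:R)^-1 @[n --> \oo] --> `|u / nu0| * (2 * C) * 0.
    by apply: cvgMr; exact: cvg_sqrt_inv.
  rewrite mulr0 in b0; move/cvgr0Pnorm_le : b0 => /(_ 1 ltr01) b0.
  near=> n.
  have n1 : (1 <= n)%N by near: n; exact: nbhs_infty_gt.
  have [s0 sE] := sqrt_split n1.
  pose bn := u / nu0 / Num.sqrt n%:R.
  have bnE : `|bn| = `|u / nu0| / Num.sqrt n%:R by rewrite normrM normfV (gtr0_norm s0).
  have bnC : `|bn| * (2 * C) <= 1.
    rewrite bnE mulrAC; apply: le_trans (ler_norm _) _; near: n; exact: b0.
  have := mart_cos delta_gt m_pos model (norm_inv_deg delta_gt) (K * n) phi n1 bnC.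
  rewrite (_ : \int[P]_w _ = \int[P]_w A n w); last first.
    apply: eq_Rintegral => w _; rewrite /A /few /y /V -/bn; congr (_ * (cos (_ + _) * _ - _)).
    by rewrite /bn mulrAC mulrA.
  move=> /le_trans; apply; rewrite -/C bnE natrM.
  have -> : (u / nu0 / Num.sqrt n%:R) ^+ 2 * ((2 * C) ^+ 2 * (K%:R * n%:R)) / 2 = B.
    rewrite /B; set s := Num.sqrt _ in s0 sE *; rewrite sE; field.
    by rewrite !gt_eqF.
  rewrite le_eqVlt; apply/orP; left; apply/eqP; rewrite /e.
  set s := Num.sqrt _ in s0 sE *; rewrite sE; field.
  by rewrite gt_eqF.
have H : (\int[P]_w r n w) + expR (- kap) * cos phi + expR (- kap) * (\int[P]_w A n w)
    @[n --> \oo] --> 0 + expR (- kap) * cos phi + expR (- kap) * 0.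
  apply: cvgD; last exact: cvgMr.
  by apply: cvgD => //; exact: cvg_cst.
rewrite mulr0 addr0 add0r in H; apply: cvg_trans H; apply: near_eq_cvg; near=> n.
have ir := @bounded_integrable _ _ _ P (r n) _ (mr n) (rB n).
have iA := @bounded_integrable _ _ _ P (A n) _ (mA n) (AB n).
have iA' : P.-integrable setT (EFin \o (fun w => expR (- kap) * A n w)).
  rewrite (_ : EFin \o _ = (fun w => (expR (- kap))%:E * (A n w)%:E)%E); last by apply/funext.
  exact: integrableZl.
have ic : P.-integrable setT (EFin \o cst (expR (- kap) * cos phi)).
  by apply: (@bounded_integrable _ _ _ P (cst _) `|expR (- kap) * cos phi|).
have irc : P.-integrable setT (EFin \o (fun w => r n w + expR (- kap) * cos phi)).
  rewrite (_ : EFin \o _ = (fun w => (r n w)%:E + (expR (- kap) * cos phi)%:E)%E);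
    last by apply/funext.
  exact: (integrableD measurableT ir ic).
transitivity (\int[P]_w ((r n w + expR (- kap) * cos phi) + expR (- kap) * A n w)).
  rewrite RintegralD // (RintegralD measurableT ir ic) RintegralZl // Rintegral_cst //.
  rewrite [fine _](_ : _ = 1) ?mulr1 //.
  by rewrite -[RHS]/(fine 1%E) -(probability_setT P).
by apply: eq_Rintegral => w _; rewrite /r; ring.
Unshelve. all: by end_near. Qed.

End AsymptoticNormality.

Theorem theorem2 (R : realType) (d : measure_display) (T : measurableType d)
  (P : probability T R)
  (m : nat -> {RV P >-> nat}) (c : nat -> nat -> {RV P >-> nat})
  (a b delta0 : R) (p0 : nat -> R) (deltahat : nat -> {RV P >-> R})
  (m_pos : forall t w, (1 <= t)%N -> (1 <= m t w)%N)
  (m_iid : iid m)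
  (m_moment2 : ('E_P[(fun w => (m 1%N w)%:R ^+ 2)%R] < +oo)%E)
  (a_lt1 : -1 < - a) (ab : - a < b)
  (delta0_interior : - a < delta0 < b)
  (model : is_PA m c delta0)
  (mle : is_MLE m c a b deltahat)
  (p0_def : limit_degrees (init_mean m) (init_prob m) delta0 p0) :
  cvg_in_distribution P
    (fun n w => Num.sqrt n%:R * (deltahat n w - delta0))
    (normal_prob 0 (Num.sqrt (nu (init_mean m) delta0 p0)^-1)).
Proof.
have delta_gt : -1 < delta0 by move: a_lt1 delta0_interior; lra.
have nu0 := nu_gt0 delta_gt m_pos m_iid m_moment2 model p0_def.
have s0 : 0 < Num.sqrt (nu (init_mean m) delta0 p0)^-1 by rewrite sqrtr_gt0 invr_gt0.
apply: levy_cos.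
- exact: measurable_mle_scaled.
- move=> u phi; rewrite normal_prob_cos // sqr_sqrtr ?invr_ge0 ?(ltW nu0) //.
  exact: (mle_cos_cvg m_pos m_iid m_moment2 a_lt1 delta0_interior model mle p0_def).
- exact: (mle_tight m_pos m_iid m_moment2 a_lt1 delta0_interior model mle p0_def).
Qed.
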